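(* Let $F$ be a global field and let $E/F$ be a (possibly infinite) Galois extension. Then: (i) $\overline{\mathbb V}_E$ is a metrizable topological ring which is complete with respect to any invariant metric on $\overline{\mathbb V}_E$. (ii) For every $K\in\mathcal I_E$ there exist a topological subring $\mathbb V_K\subseteq\overline{\mathbb V}_E$ and a topological ring isomorphism $\phi_K:\mathbb A_K\to\mathbb V_K$ such that for all $K,L\in\mathcal I_E$ with $K\subseteq L$ one has $\mathbb V_K\subseteq\mathbb V_L$ and the square formed by $\mathrm{con}_{L/K}:\mathbb A_K\to\mathbb A_L$, the inclusion $\iota:\mathbb V_K\to\mathbb V_L$, and the mutually inverse maps $\phi_K^{\pm1},\phi_L^{\pm1}$ commutes, i.e. $\phi_L\circ\mathrm{con}_{L/K}=\iota\circ\phi_K$ and $\mathrm{con}_{L/K}\circ\phi_K^{-1}=\phi_L^{-1}\circ\iota$. (iii) With $\mathbb V_K$ as in (ii), if $\mathbb V_E=\bigcup_{K\in\mathcal I_E}\mathbb V_K$, then $\overline{\mathbb V}_E$ is equal to the closure of $\mathbb V_E$ in $\overline{\mathbb V}_E$.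
   Context: Places. $F$ is a fixed global field, $E/F$ is Galois (possibly infinite), and $\mathcal I_E=\{K\subseteq E: K/F\text{ finite Galois}\}$. For a field $L$ with $F\subseteq L\subseteq E$, $Y_L$ is the set of places of $L$ (equivalence classes of nontrivial absolute values), and $L_w$ is the completion of $L$ at $w\in Y_L$. For $F\subseteq K\subseteq L\subseteq E$ and $v\in Y_K$, $Y(L/K,v)$ is the set of places of $L$ dividing $v$ (i.e. restricting to $v$ on $K$). $Y_E$ carries the topology with basis $\{Y(E/K,v):K\in\mathcal I_E,\ v\in Y_K\}$; it is Hausdorff and totally disconnected, and each basis element is compact and non-empty. Subsets carry the subspace topology. For each $p\in Y_F$ an absolute value $|\ |_p$ in $p$ is fixed; for $y\in Y_E$ dividing $p$, $|\ |_y$ is the unique absolute value on $E$ belonging to $y$ and extending $|\ |_p$, also extended to $E_y$; $\mathcal O_y=\{\alpha\in E_y:|\alpha|_y\le1\}$. Galois action. Galois groups carry the Krull topology. For $K\in\mathcal I_E$, $\sigma\in\mathrm{Gal}(E/K)$ and $y\in Y(E/K,v)$, $\sigma(y)\in Y(E/K,v)$ is the place with $|\sigma(\alpha)|_{\sigma(y)}=|\alpha|_y$ for all $\alpha\in E$; $\sigma$ extends to an isometric isomorphism $E_y\to E_{\sigma(y)}$, also denoted $\sigma$. For $v\in Y_K$, a $v$-adic transition diagram on $E$ is a continuous map $\lambda:Y(E/K,v)\times Y(E/K,v)\to\mathrm{Gal}(E/K)$ such that $\lambda(x,x)=1$, $\lambda(x,y)(x)=y$, and $\lambda(y,z)\lambda(x,y)=\lambda(x,z)$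 for all $x,y,z\in Y(E/K,v)$. $T(E/K,v)$ is the set of these; it is non-empty. The ring $\overline{\mathbb V}_E$. Fix $K\in\mathcal I_E$ and, for each $v\in Y_K$, $\lambda_v\in T(E/K,v)$ and $r_v\in Y(E/K,v)$. $\overline{\mathbb V}_E$ is the set of all $(a_y)_{y\in Y_E}\in\prod_{y\in Y_E}E_y$ such that (A.1) there is a compact $Z\subseteq Y_E$ with $a_y\in\mathcal O_y$ for all $y\in Y_E\setminus Z$; and (A.2) for every $v\in Y_K$ the map $Y(E/K,v)\to E_{r_v}$, $y\mapsto\lambda_v(y,r_v)(a_y)$, is continuous. Ring operations are coordinatewise. Its topology has as basis the sets $U\cap\overline{\mathbb V}_E$, where $U=\prod_{y\in Y_E}U_y\subseteq\prod_{y\in Y_E}E_y$ satisfies (T.1) there is a compact $Z\subseteq Y_E$ with $U_y=\mathcal O_y$ for all $y\in Y_E\setminus Z$; and (T.2) for every $v\in Y_K$ the set $\bigcup_{y\in Y(E/K,v)}(\{y\}\times\lambda_v(y,r_v)(U_y))$ is open in $Y(E/K,v)\times E_{r_v}$. The set and topology do not depend on the choice of $K,\lambda_v,r_v$. Classical adèles. For a global field $K$, $\mathbb A_K$ is the usual adèle ring with its usual topology. For $K\subseteq L$ in $\mathcal I_E$, $\mathrm{con}_{L/K}:\mathbb A_K\to\mathbb A_L$ sends $(a_v)_{v\in Y_K}$ to $(b_w)_{w\in Y_L}$ with $b_w=a_v$ for all $w\in Y(L/K,v)$. An invariant metric on a metrizable topological ring $R$ is a metric $d$ inducing its topology with $d(x,y)=d(x+z,y+z)$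 for all $x,y,z\in R$. A topological ring isomorphism is a ring isomorphism that is a homeomorphism; a topological subring carries the subspace topology. *)

(* Defs.v *)
From HB Require Import structures.
From mathcomp Require Import all_boot all_order all_algebra.
From mathcomp Require Import ring_quotient separable.
From mathcomp Require Import ring lra.
From mathcomp Require Import all_classical all_reals topology normedtype.
From mathcomp Require Import sequences exp interval_inference.

Set Implicit Arguments.
Unset Strict Implicit.
Unset Printing Implicit Defensive.
Import Order.TTheory GRing.Theory Num.Theory.
Import numFieldNormedType.Exports.
Local Open Scope classical_set_scope.
Local Open Scope quotient_scope.
Local Open Scope ring_scope.

(* Not assumed nontrivial; see av_nontrivial. *)
Record absval (R : realType) (L : fieldType) := AbsVal {
  av :> L -> R;
  av_ge0 : forall x, 0 <= av x;
  av_eq0 : forall x, av x = 0 <-> x = 0;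
  avM : forall x y, av (x * y) = av x * av y;
  avD : forall x y, av (x + y) <= av x + av y }.

Section AbsValTheory.
Context {R : realType} {L : fieldType} (a : absval R L).

Lemma av0 : a 0 = 0. Proof. exact/av_eq0. Qed.

Lemma av1 : a 1 = 1.
Proof.
have a1 : a 1 != 0 by apply/eqP => /av_eq0/eqP; rewrite oner_eq0.
by apply: (mulfI a1); rewrite -avM !mulr1.
Qed.

Lemma avN x : a (- x) = a x.
Proof.
have : a (-1) ^+ 2 = 1 by rewrite expr2 -avM mulrNN mulr1 av1.
move/eqP; rewrite sqrf_eq1 => /orP[/eqP h|/eqP h].
  by rewrite -mulN1r avM h mul1r.
by have := av_ge0 a (-1); rewrite h ler0N1.
Qed.

Lemma av_distC x y : a (x - y) = a (y - x).
Proof. by rewrite -avN opprB. Qed.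

Lemma av_dist x y : `|a x - a y| <= a (x - y).
Proof.
rewrite ler_norml; apply/andP; split.
  rewrite lerNl opprB lerBlDr av_distC.
  by have := avD a (y - x) x; rewrite subrK addrC.
rewrite lerBlDr; by have := avD a (x - y) y; rewrite subrK.
Qed.

Lemma avV x : a x^-1 = (a x)^-1.
Proof.
have [->|x0] := eqVneq x 0; first by rewrite invr0 av0 invr0.
have ax0 : a x != 0 by apply: contra_neq x0 => /av_eq0.
by apply: (mulfI ax0); rewrite -avM !divff// av1.
Qed.

End AbsValTheory.

HB.instance Definition _ (R : realType) (L : fieldType) :=
  gen_eqMixin (absval R L).
HB.instance Definition _ (R : realType) (L : fieldType) :=
  gen_choiceMixin (absval R L).

Section Trivial.
Context (R : realType) (L : fieldType).
Let t (x : L) : R := (x != 0)%:R.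

Let t_ge0 x : 0 <= t x. Proof. exact: ler0n. Qed.

Let t_eq0 x : t x = 0 <-> x = 0.
Proof.
rewrite /t; split=> [/eqP|->]; last by rewrite eqxx.
by rewrite pnatr_eq0 eqb0 negbK => /eqP.
Qed.

Let tM x y : t (x * y) = t x * t y.
Proof. by rewrite /t mulf_eq0 negb_or -natrM mulnb. Qed.

Let tD x y : t (x + y) <= t x + t y.
Proof.
rewrite /t -natrD ler_nat; have [->|_] := eqVneq x 0; first by rewrite add0r.
by case: (x + y != 0).
Qed.

Definition av_trivial : absval R L := AbsVal t_ge0 t_eq0 tM tD.
End Trivial.

Section Comp.
Context {R : realType} {K L : fieldType} (i : {rmorphism K -> L}).
Variable a : absval R L.

Let c_ge0 x : 0 <= a (i x). Proof. exact: av_ge0. Qed.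

Let c_eq0 x : a (i x) = 0 <-> x = 0.
Proof.
split=> [/av_eq0/eqP|->]; last by rewrite rmorph0 av0.
by rewrite fmorph_eq0 => /eqP.
Qed.

Let cM x y : a (i (x * y)) = a (i x) * a (i y).
Proof. by rewrite rmorphM avM. Qed.

Let cD x y : a (i (x + y)) <= a (i x) + a (i y).
Proof. by rewrite rmorphD avD. Qed.

Definition av_comp : absval R K := @AbsVal R K (a \o i) c_ge0 c_eq0 cM cD.
End Comp.

Definition nonarchimedean (R : realType) (L : fieldType) (a : absval R L) :=
  forall x y, a (x + y) <= Num.max (a x) (a y).

Section Completion.
Context {R : realType} {L : fieldType} (a : absval R L).

Definition cauchy_av (u : nat -> L) : Prop := forall e : R, 0 < e ->
  exists N, forall m n, (N <= m)%N -> (N <= n)%N -> a (u m - u n) < e.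

Definition null_av (u : nat -> L) : Prop := forall e : R, 0 < e ->
  exists N, forall n, (N <= n)%N -> a (u n) < e.

Lemma cauchy_av_bounded u : cauchy_av u ->
  exists2 M, 0 < M & forall n, a (u n) <= M.
Proof.
move=> /(_ 1 ltr01)[N hN].
exists (1 + \sum_(i < N.+1) a (u i)).
  by rewrite ltr_pwDl// sumr_ge0// => i _; exact: av_ge0.
move=> n; have [nN|Nn] := ltnP n N.+1.
  rewrite (bigD1 (Ordinal nN))//= addrCA lerDl addr_ge0// sumr_ge0// => i _.
  exact: av_ge0.
rewrite -[u n](subrK (u N)) (le_trans (avD _ _ _))// lerD//.
  by rewrite ltW// hN// ltnW.
rewrite (bigD1 ord_max)//= lerDl sumr_ge0// => i _; exact: av_ge0.
Qed.

Definition cauchy_pred : {pred nat -> L} := fun u => `[< cauchy_av u >].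

Lemma cauchy_subring : subring_closed cauchy_pred.
Proof.
split.
- by apply/asboolP => e e0; exists 0%N => m n _ _; rewrite subrr av0.
- move=> u v /asboolP cu /asboolP cv; apply/asboolP => e e0.
  have e20 : 0 < e / 2 by rewrite divr_gt0.
  have [N1 h1] := cu _ e20; have [N2 h2] := cv _ e20.
  exists (maxn N1 N2) => m n; rewrite !geq_max => /andP[? ?] /andP[? ?].
  have -> : (u - v) m - (u - v) n = (u m - u n) + (v n - v m).
    by rewrite !fctE; ring.
  by rewrite (le_lt_trans (avD _ _ _))// [e]splitr ltrD ?h1 ?h2.
- move=> u v /asboolP cu /asboolP cv; apply/asboolP => e e0.
  have [M M0 hM] := cauchy_av_bounded cu.
  have [M' M'0 hM'] := cauchy_av_bounded cv.
  have e1 : 0 < e / 2 / M' by rewrite !divr_gt0.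
  have e2 : 0 < e / 2 / M by rewrite !divr_gt0.
  have [N1 h1] := cu _ e1; have [N2 h2] := cv _ e2.
  exists (maxn N1 N2) => m n; rewrite !geq_max => /andP[? ?] /andP[? ?].
  have -> : (u * v) m - (u * v) n = (u m - u n) * v m + u n * (v m - v n).
    by rewrite !fctE mulrBl mulrBr addrA subrK.
  rewrite (le_lt_trans (avD _ _ _))// !avM [e]splitr ltrD//.
    rewrite (le_lt_trans (ler_wpM2l (av_ge0 _ _) (hM' _)))// -ltr_pdivlMr//.
    exact: h1.
  rewrite (le_lt_trans (ler_wpM2r (av_ge0 _ _) (hM _)))// mulrC -ltr_pdivlMr//.
  exact: h2.
Qed.

Definition cauchy_seq : Type := {u : nat -> L | u \in cauchy_pred}.
HB.instance Definition _ := [isSub of cauchy_seq for @sval _ _].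
HB.instance Definition _ := [Choice of cauchy_seq by <:].
HB.instance Definition _ :=
  GRing.SubChoice_isSubComNzRing.Build (nat -> L) cauchy_pred cauchy_seq
    cauchy_subring.

Lemma cauchy_seqP (u : cauchy_seq) : cauchy_av (val u).
Proof. exact/asboolP/(valP u). Qed.

Definition null_pred : {pred cauchy_seq} := fun u => `[< null_av (val u) >].

Lemma null_idealr : idealr_closed null_pred.
Proof.
split.
- by apply/asboolP => e e0; exists 0%N => n _ /=; rewrite av0.
- apply/negP => /asboolP /(_ 1 ltr01)[N /(_ N (leqnn _))] /=.
  by rewrite av1 ltxx.
- move=> c u v /asboolP nu /asboolP nv; apply/asboolP => e e0.
  have [M M0 hM] := cauchy_av_bounded (cauchy_seqP c).
  have e1 : 0 < e / 2 / M by rewrite !divr_gt0.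
  have e2 : 0 < e / 2 by rewrite divr_gt0.
  have [N1 h1] := nu _ e1; have [N2 h2] := nv _ e2.
  exists (maxn N1 N2) => n; rewrite !geq_max => /andP[? ?].
  rewrite (le_lt_trans (avD _ _ _))// [e]splitr ltrD ?h2// avM.
  rewrite (le_lt_trans (ler_wpM2r (av_ge0 _ _) (hM _)))// mulrC -ltr_pdivlMr//.
  exact: h1.
Qed.
HB.instance Definition _ := isIdealr.Build cauchy_seq null_pred null_idealr.

(* Cauchy sequences modulo null sequences. *)
Definition completion : Type := {ideal_quot null_pred}.
HB.instance Definition _ := GRing.ComNzRing.on completion.
HB.instance Definition _ := EqQuotient.on completion.

Definition completion_pi (u : cauchy_seq) : completion :=
  \pi_{ideal_quot null_pred} u.

Lemma completion_surj (x : completion) : exists u, x = completion_pi u.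
Proof. by exists (repr x); rewrite /completion_pi reprK. Qed.

Lemma completion_pi_zmod : zmod_morphism completion_pi.
Proof. by move=> u v; rewrite /completion_pi piE. Qed.

Lemma completion_pi_monoid : monoid_morphism completion_pi.
Proof. by split=> [|u v]; rewrite /completion_pi piE. Qed.

HB.instance Definition _ := GRing.isZmodMorphism.Build cauchy_seq completion
  completion_pi completion_pi_zmod.
HB.instance Definition _ := GRing.isMonoidMorphism.Build cauchy_seq completion
  completion_pi completion_pi_monoid.

Lemma completion_pi_eq0 u : completion_pi u = 0 <-> null_av (val u).
Proof.
rewrite -(rmorph0 completion_pi) /completion_pi.
have H : (\pi_{ideal_quot null_pred} u == \pi_{ideal_quot null_pred} 0) =
    (u - 0 \in null_pred).
  by rewrite -Quotient.idealrBE.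
split.
  by move/eqP; rewrite H subr0 => /asboolP.
by move=> nu; apply/eqP; rewrite H subr0; apply/asboolP.
Qed.


Lemma completion_inv_ex (x : completion) : x != 0 -> exists y, y * x = 1.
Proof.
have [u ->] := completion_surj x => /eqP; rewrite completion_pi_eq0 => nu.
have [e e0 he] : exists2 e, 0 < e &
    forall N, exists2 n, (N <= n)%N & e <= a (val u n).
  apply: contrapT => H; apply: nu => e e0; apply: contrapT => H'; apply: H.
  exists e => // N; apply: contrapT => H''; apply: H'; exists N => n Nn.
  by rewrite ltNge; apply/negP => en; apply: H''; exists n.
have e20 : 0 < e / 2 by rewrite divr_gt0.
have [N hN] := cauchy_seqP u e20.
have lbu n : (N <= n)%N -> e / 2 <= a (val u n).
  move=> Nn; have [k Nk ek] := he N.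
  have := avD a (val u k - val u n) (val u n); rewrite subrK.
  have := hN k n Nk Nn; lra.
pose w n := if (n < N)%N then 0 else (val u n)^-1.
have u0 n : (N <= n)%N -> val u n != 0.
  by move=> /lbu; apply: contraTneq => ->; rewrite av0 -ltNge.
have cw : cauchy_av w.
  move=> d d0.
  have d1 : 0 < d * (e / 2 * (e / 2)) by rewrite mulr_gt0// mulr_gt0.
  have [N' hN'] := cauchy_seqP u d1.
  exists (maxn N N') => m n; rewrite !geq_max => /andP[Nm N'm] /andP[Nn N'n].
  rewrite /w !ltnNge Nm Nn /=.
  have -> : (val u m)^-1 - (val u n)^-1 =
      (val u n - val u m) * (val u m * val u n)^-1.
    by field; rewrite !u0.
  rewrite avM avV ltr_pdivrMr; last first.
    by rewrite avM mulr_gt0// (lt_le_trans e20)// lbu.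
  rewrite (lt_le_trans (hN' _ _ N'n N'm))// ler_wpM2l// ?(ltW d0)// avM.
  by rewrite ler_pM ?(ltW e20)// lbu.
have cwb : w \in cauchy_pred by apply/asboolP.
exists (completion_pi (Sub w cwb)).
apply/eqP; rewrite -subr_eq0 -(rmorph1 completion_pi) -rmorphM -rmorphB.
apply/eqP/completion_pi_eq0 => d d0; exists N => n Nn.
rewrite /= !fctE /= /w ltnNge Nn /= mulVf ?u0// subrr av0 //.
Qed.

Definition completion_inv (x : completion) : completion :=
  if x == 0 then 0 else xget 0 [set y | y * x = 1].

Lemma completion_mulVf x : x != 0 -> completion_inv x * x = 1.
Proof.
move=> x0; rewrite /completion_inv (negbTE x0); case: xgetP => //= H.
by have [y] := completion_inv_ex x0; move/H.
Qed.

Lemma completion_invr0 : completion_inv 0 = 0.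
Proof. by rewrite /completion_inv eqxx. Qed.

HB.instance Definition _ := GRing.ComNzRing_isField.Build completion
  completion_mulVf completion_invr0.

Definition completion_norm (x : completion) : R :=
  limn (fun n => a (val (repr x) n)).

Lemma completion_norm_cvg u :
  (fun n => a (val u n)) @ \oo --> completion_norm (completion_pi u).
Proof.
have cvgu (v : cauchy_seq) : cvgn (fun n => a (val v n)).
  apply/cauchy_cvgP/cauchyP => e e0; have [N hN] := cauchy_seqP v e0.
  exists (a (val v N)); exists N => // n Nn; rewrite /= /ball /=.
  by rewrite (le_lt_trans (av_dist _ _ _))// hN.
have nu : null_av (val (u - repr (completion_pi u))).
  by apply/completion_pi_eq0; rewrite rmorphB /= /completion_pi reprK subrr.
rewrite -[X in _ --> X]addr0; apply/cvgrPdist_lt => e e0.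
have e20 : 0 < e / 2 by rewrite divr_gt0.
have [N hN] := nu _ e20.
have /cvgrPdist_lt/(_ _ e20)[N' _ hN'] := cvgu (repr (completion_pi u)).
exists (maxn N N') => // n /=; rewrite geq_max => /andP[Nn N'n].
rewrite addr0 -(subrK (a (val (repr (completion_pi u)) n)) (completion_norm _)).
rewrite -addrA (le_lt_trans (ler_normD _ _))// [e]splitr ltrD//.
  exact: hN'.
by rewrite (le_lt_trans (av_dist _ _ _))// av_distC; exact: hN.
Qed.

Lemma completion_normD x y :
  completion_norm (x + y) <= completion_norm x + completion_norm y.
Proof.
have [u ->] := completion_surj x; have [v ->] := completion_surj y.
rewrite -rmorphD /=; have cuv : (fun n => a (val u n) + a (val v n)) @ \oo -->
    completion_norm (completion_pi u) + completion_norm (completion_pi v).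
  by apply: cvgD; exact: completion_norm_cvg.
apply: (ler_cvg_to (@completion_norm_cvg (u + v)) cuv).
by apply: nearW => n; exact: avD.
Qed.

Lemma completion_norm_pi u (c : R) :
  (fun n => a (val u n)) @ \oo --> c -> completion_norm (completion_pi u) = c.
Proof.
move=> uc; have := @completion_norm_cvg u.
by move/cvg_lim => <- //; move/cvg_lim: uc => ->.
Qed.

Lemma completion_normM x y :
  completion_norm (x * y) = completion_norm x * completion_norm y.
Proof.
have [u ->] := completion_surj x; have [v ->] := completion_surj y.
rewrite -rmorphM /=; apply: completion_norm_pi.
have -> : (fun n => a (val (u * v) n)) = (fun n => a (val u n) * a (val v n)).
  by apply/funext => n; rewrite -avM.
by apply: cvgM; exact: completion_norm_cvg.
Qed.

Lemma completion_norm_eq0 x : completion_norm x = 0 -> x = 0.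
Proof.
have [u ->] := completion_surj x => H; apply/completion_pi_eq0 => e e0.
have := @completion_norm_cvg u; rewrite H => /cvgrPdist_lt/(_ _ e0)[N _ hN].
exists N => n Nn; have := hN n Nn.
by rewrite /= sub0r normrN ger0_norm// av_ge0.
Qed.

Lemma completion_normN x : completion_norm (- x) = completion_norm x.
Proof.
have [u ->] := completion_surj x; rewrite -rmorphN /=.
apply: completion_norm_pi.
have -> : (fun n => a (val (- u) n)) = (fun n => a (val u n)).
  by apply/funext => n; rewrite -[RHS]avN.
exact: completion_norm_cvg.
Qed.

Lemma const_cauchy (c : L) : (fun=> c) \in cauchy_pred.
Proof. by apply/asboolP => e e0; exists 0%N => *; rewrite subrr av0. Qed.

Definition completion_inj (c : L) : completion :=
  completion_pi (Sub (fun=> c) (const_cauchy c)).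

Lemma completion_inj_zmod : zmod_morphism completion_inj.
Proof.
move=> u v; rewrite /completion_inj -rmorphB; congr completion_pi.
exact: val_inj.
Qed.

Lemma completion_inj_monoid : monoid_morphism completion_inj.
Proof.
split=> [|u v].
  rewrite -(rmorph1 completion_pi) /completion_inj; congr completion_pi.
  exact: val_inj.
rewrite /completion_inj -rmorphM; congr completion_pi; apply: val_inj.
by apply/funext => n.
Qed.

HB.instance Definition _ := GRing.isZmodMorphism.Build L completion
  completion_inj completion_inj_zmod.
HB.instance Definition _ := GRing.isMonoidMorphism.Build L completion
  completion_inj completion_inj_monoid.

Lemma completion_norm_inj c : completion_norm (completion_inj c) = a c.
Proof. by apply: completion_norm_pi => /=; exact: (cvg_cst (a c)). Qed.

Lemma completion_norm1 : completion_norm 1 = 1.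
Proof. by rewrite -(rmorph1 completion_inj) completion_norm_inj av1. Qed.

Lemma completion_normB x y : completion_norm (x - y) = completion_norm (y - x).
Proof. by rewrite -completion_normN opprB. Qed.

Lemma completion_norm0 : completion_norm 0 = 0.
Proof. by rewrite -(rmorph0 completion_inj) completion_norm_inj av0. Qed.

Lemma completion_norm_ge0 x : 0 <= completion_norm x.
Proof.
have := completion_normD x (- x).
by rewrite subrr completion_norm0 completion_normN; lra.
Qed.

Lemma completion_norm_eq0P x : completion_norm x = 0 <-> x = 0.
Proof.
by split=> [|->]; [exact: completion_norm_eq0 | exact: completion_norm0].
Qed.

Definition completion_av : absval R completion :=
  AbsVal completion_norm_ge0 completion_norm_eq0P completion_normM
    completion_normD.

Definition completion_dist (x y : completion) : R := completion_av (x - y).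

Let distxx x : completion_dist x x = 0.
Proof. by rewrite /completion_dist subrr av0. Qed.

Let dist_eq0 x y : completion_dist x y = 0 -> x = y.
Proof. by move=> /av_eq0/eqP; rewrite subr_eq0 => /eqP. Qed.

Let dist_sym x y : completion_dist x y = completion_dist y x.
Proof. exact: av_distC. Qed.

Let dist_triangle y x z :
  completion_dist x z <= completion_dist x y + completion_dist y z.
Proof. by have := avD completion_av (x - y) (y - z); rewrite addrA subrK. Qed.

HB.instance Definition _ := isMetric.Build R completion
  distxx dist_eq0 dist_sym dist_triangle.
HB.instance Definition _ := isPointed.Build completion 0.

Lemma completion_distE (x y : completion) : mdist x y = completion_av (x - y).
Proof. by []. Qed.

Lemma completion_pi_near u c e :
  (exists N, forall n, (N <= n)%N -> a (val u n - c) <= e) ->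
  completion_av (completion_pi u - completion_inj c) <= e.
Proof.
move=> [N hN]; rewrite -rmorphB.
apply: (ler_cvg_to (@completion_norm_cvg _) (cvg_cst e)).
by exists N => // n /hN.
Qed.

Lemma completion_dense (x : completion) (e : R) : 0 < e ->
  exists c, completion_av (x - completion_inj c) < e.
Proof.
have [u -> e0] := completion_surj x.
have e20 : 0 < e / 2 by rewrite divr_gt0.
have [N hN] := cauchy_seqP u e20; exists (val u N).
apply: (@le_lt_trans _ _ (e / 2)); last by lra.
by apply: completion_pi_near; exists N => n Nn; rewrite ltW// hN.
Qed.

Lemma completion_complete (F : set_system completion) :
  ProperFilter F -> cauchy F -> cvg F.
Proof.
move=> FF /cauchyP Fc.
pose r n : R := n.+1%:R^-1.
have r0 n : 0 < r n by rewrite invr_gt0 ltr0Sn.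
have /choice[c hc] : forall n, exists c,
    F (ball (completion_inj c : completion) (r n + r n)).
  move=> n; have [x Fx] := Fc _ (r0 n).
  have [c xc] := completion_dense x (r0 n); exists c.
  apply: filterS Fx => y; apply: ball_triangle.
  by rewrite ballEmdist /= completion_distE av_distC.
have cE m n : a (c m - c n) < (r m + r m) + (r n + r n).
  have /filter_ex[y [ym yn]] := @filterI _ F FF _ _ (hc m) (hc n).
  have := ball_triangle ym (ball_sym yn).
  rewrite ballEmdist /= completion_distE -rmorphB.
  by rewrite [X in X < _ -> _]completion_norm_inj.
have rcvg e : 0 < e -> exists N, forall n, (N <= n)%N -> r n < e.
  by move=> e0; have [N _ hN] := near_infty_natSinv_lt (PosNum e0); exists N.
have cc : c \in cauchy_pred.
  apply/asboolP => e e0; have e40 : 0 < e / 4 by rewrite divr_gt0.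
  have [N hN] := rcvg _ e40; exists N => m n /hN rm /hN rn.
  by have := cE m n; lra.
apply/cvg_ex; exists (completion_pi (Sub c cc)).
move=> A /nbhs_ballP[e /= e0 eA].
have e80 : 0 < e / 8 by rewrite divr_gt0.
have [N hN] := rcvg _ e80.
apply: filterS (hc N) => y; rewrite ballEmdist /= completion_distE => cy.
apply: eA; rewrite ballEmdist /= completion_distE.
have : completion_av (completion_pi (Sub c cc) - completion_inj (c N)) <= e / 2.
  apply: completion_pi_near; exists N => n /hN rn.
  by have := cE n N; have := hN _ (leqnn N); rewrite /=; lra.
have := avD completion_av
  (completion_pi (Sub c cc) - completion_inj (c N)) (completion_inj (c N) - y).
rewrite addrA subrK; have := hN _ (leqnn N); lra.
Qed.

HB.instance Definition _ := Uniform_isComplete.Build completion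
  completion_complete.

End Completion.

Section CompletionTheory.
Context {R : realType} {L : fieldType} (a : absval R L).

Lemma completion_nonarchimedean :
  nonarchimedean a -> nonarchimedean (completion_av a).
Proof.
move=> na x y; apply/ler_addgt0Pr => e e0.
have e40 : 0 < e / 4 by rewrite divr_gt0.
have [c hc] := completion_dense x e40; have [d hd] := completion_dense y e40.
have := na c d.
have cE := completion_norm_inj a.
have h1 := avD (completion_av a)
  (x - completion_inj a c + (y - completion_inj a d)) (completion_inj a (c + d)).
have h2 := avD (completion_av a)
  (x - completion_inj a c) (y - completion_inj a d).
have h3 := av_dist (completion_av a) x (completion_inj a c).
have h4 := av_dist (completion_av a) y (completion_inj a d).
have eqxy : x - completion_inj a c + (y - completion_inj a d) +
    completion_inj a (c + d) = x + y.
  by rewrite rmorphD; ring.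
move: h1 h3 h4; rewrite eqxy /= !cE !ler_norml => h1 /andP[h3 _] /andP[h4 _].
move: hc hd h1 h2 h3 h4 => /=.
set X := completion_norm x; set Y := completion_norm y.
move=> hc hd h1 h2 h3 h4.
rewrite !le_max => /orP[h|h].
  have : X <= Num.max X Y by rewrite le_max lexx.
  by lra.
have : Y <= Num.max X Y by rewrite le_max lexx orbT.
by lra.
Qed.

End CompletionTheory.

Section CompletionMap.
Context {R : realType} {K L : fieldType} (f : {rmorphism K -> L}).
Variables (a : absval R K) (b : absval R L).

(* If b (f c) = a c for all c, this is the unique isometric extension of f to
   the completions; otherwise it is a junk value. *)
Definition completion_map : completion a -> completion b :=
  xget (fun=> 0) [set g |
    (forall c, g (completion_inj a c) = completion_inj b (f c)) /\
    (forall x y, mdist (g x) (g y) = mdist x y)].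
End CompletionMap.
Arguments completion_map {R K L} f a b x.

Definition dprod (I : Type) (T : I -> comPzRingType) : Type := forall i, T i.

Section DProd.
Context {I : Type} (T : I -> comPzRingType).
Local Notation P := (dprod T).
HB.instance Definition _ := gen_eqMixin P.
HB.instance Definition _ := gen_choiceMixin P.

Let add (f g : P) : P := fun i => f i + g i.
Let opp (f : P) : P := fun i => - f i.
Let mul (f g : P) : P := fun i => f i * g i.

Let addA : associative add.
Proof.
by move=> f g h; apply: functional_extensionality_dep => ?; exact: addrA.
Qed.
Let addC : commutative add.
Proof. by move=> f g; apply: functional_extensionality_dep => ?; exact: addrC. Qed.
Let add0 : left_id (fun=> 0) add.
Proof. by move=> f; apply: functional_extensionality_dep => ?; exact: add0r. Qed.
Let addN : left_inverse (fun=> 0) opp add.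
Proof. by move=> f; apply: functional_extensionality_dep => ?; exact: addNr. Qed.
HB.instance Definition _ := GRing.isZmodule.Build P addA addC add0 addN.

Let mulA : associative mul.
Proof.
by move=> f g h; apply: functional_extensionality_dep => ?; exact: mulrA.
Qed.
Let mulC : commutative mul.
Proof. by move=> f g; apply: functional_extensionality_dep => ?; exact: mulrC. Qed.
Let mul1 : left_id (fun=> 1) mul.
Proof. by move=> f; apply: functional_extensionality_dep => ?; exact: mul1r. Qed.
Let mulD : left_distributive mul add.
Proof.
by move=> f g h; apply: functional_extensionality_dep => ?; exact: mulrDl.
Qed.
HB.instance Definition _ :=
  GRing.Zmodule_isComPzRing.Build P mulA mulC mul1 mulD.

Lemma dprodD (f g : P) i : (f + g) i = f i + g i. Proof. by []. Qed.
Lemma dprodM (f g : P) i : (f * g) i = f i * g i. Proof. by []. Qed.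
Lemma dprodB (f g : P) i : (f - g) i = f i - g i. Proof. by []. Qed.
Lemma dprod1 i : (1 : P) i = 1. Proof. by []. Qed.
End DProd.

Section Extensions.
Context {K L : fieldType} (i : {rmorphism K -> L}).

Definition finite_ext : Prop := exists s : seq L, forall x : L,
  exists c : 'I_(size s) -> K, x = \sum_j i (c j) * s`_j.

(* Extensions need not be finite, so fieldext's minPoly is not available. *)
Definition minimal_poly (x : L) (p : {poly K}) : Prop :=
  [/\ p \is monic, root (map_poly i p) x
    & forall q : {poly K}, root (map_poly i q) x -> p %| q].

Definition algebraic_ext : Prop := forall x : L, algebraicOver i x.

Definition separable_ext : Prop := forall (x : L) (p : {poly K}),
  minimal_poly x p -> separable_poly p.

Definition normal_ext : Prop := forall (x : L) (p : {poly K}),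
  minimal_poly x p ->
  exists s : seq L, map_poly i p = \prod_(z <- s) ('X - z%:P).

Definition galois_ext : Prop := [/\ algebraic_ext, separable_ext & normal_ext].
End Extensions.

Definition global_field (F : fieldType) : Prop :=
  (exists i : {rmorphism rat -> F}, finite_ext i) \/
  (exists (k : finFieldType) (i : {rmorphism {fraction {poly k}} -> F}),
     finite_ext i).

Record subfield (E : fieldType) := Subfield {
  subfield_set :> set E;
  subfield_closed : divring_closed (mem subfield_set) }.

Section Subfields.
Context {E : fieldType}.

Definition subfield_type (K : subfield E) : Type := {x : E | x \in (K : set E)}.
HB.instance Definition _ (K : subfield E) :=
  [isSub of subfield_type K for @sval _ _].
HB.instance Definition _ (K : subfield E) :=
  [Choice of subfield_type K by <:].
HB.instance Definition _ (K : subfield E) :=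
  GRing.SubChoice_isSubIntegralDomain.Build E (mem (K : set E))
    (subfield_type K) (subfield_closed K).
HB.instance Definition _ (K : subfield E) :=
  [SubIntegralDomain_isSubField of subfield_type K by <:].

Section Inclusion.
Context {K L : subfield E} (KL : K `<=` L).

Definition incl_subfield (x : subfield_type K) : subfield_type L :=
  Sub (val x) (mem_set (KL (set_mem (valP x)))).

Let incl_zmod : zmod_morphism incl_subfield.
Proof. by move=> x y; apply: val_inj. Qed.

Let incl_monoid : monoid_morphism incl_subfield.
Proof. by split=> [|x y]; apply: val_inj. Qed.

HB.instance Definition _ := GRing.isZmodMorphism.Build
  (subfield_type K) (subfield_type L) incl_subfield incl_zmod.
HB.instance Definition _ := GRing.isMonoidMorphism.Build
  (subfield_type K) (subfield_type L) incl_subfield incl_monoid.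
End Inclusion.

Record finite_galois (K : subfield E) := FiniteGalois {
  fg_field :> subfield E;
  fg_sub : K `<=` fg_field;
  fg_finite : finite_ext (incl_subfield fg_sub);
  fg_galois : galois_ext (incl_subfield fg_sub) }.

Record gal (K : subfield E) := Gal {
  gal_fun :> {rmorphism E -> E};
  gal_bij : bijective gal_fun;
  gal_fix : forall x, (K : set E) x -> gal_fun x = x }.
HB.instance Definition _ K := gen_eqMixin (gal K).
HB.instance Definition _ K := gen_choiceMixin (gal K).

(* The left cosets of the Gal(E/L), L/K finite Galois. The topology is generated
   by this family as a subbase; since the intersection of two members is a union
   of members, it is in fact a basis. The same remark applies to adele_basis,
   top_place_basis and Vbar_basis below. *)
Definition krull_basis (K : subfield E) : set (set (gal K)) :=
  [set S | exists (L : finite_galois K) (s : gal K),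
     S = [set t : gal K | forall x, (L : set E) x -> t x = s x]].
HB.instance Definition _ K :=
  isSubBaseTopological.Build (gal K) (@krull_basis K) id.
End Subfields.

Section Places.
Context (R : realType).

Definition av_nontrivial (L : fieldType) (a : absval R L) : Prop :=
  exists2 x, x != 0 & a x != 1.

Definition av_equiv (L : fieldType) (a b : absval R L) : Prop :=
  exists2 s : R, 0 < s & forall x, b x = a x `^ s.

Definition place (L : fieldType) : Type :=
  [set P : set (absval R L) |
    exists2 a, av_nontrivial a & P = [set b | av_equiv a b]].
HB.instance Definition _ L := Choice.on (place L).

Definition lies_over (K L : fieldType) (i : {rmorphism K -> L})
    (w : place L) (v : place K) : Prop :=
  forall a, val w a -> val v (av_comp i a).

(* For algebraic i and nK p in p: the unique absolute value belonging to w and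
   extending nK p, where p is the place of K below w. *)
Definition place_av (K L : fieldType) (nK : place K -> absval R K)
    (i : {rmorphism K -> L}) (w : place L) : absval R L :=
  xget (av_trivial R L) [set a | val w a /\
    exists2 p, lies_over i w p & forall x, a (i x) = nK p x].
End Places.

#[short(type="preTopologicalPzRingType")]
HB.structure Definition PreTopologicalPzRing :=
  {T of Topological T & GRing.PzRing T}.

Section TopologicalRings.

Definition topological_ring (T : preTopologicalPzRingType) : Prop :=
  [/\ continuous (fun p : T * T => p.1 + p.2),
      continuous (fun x : T => - x)
    & continuous (fun p : T * T => p.1 * p.2)].

Definition induces_topology (R : realType) (T : topologicalType)
    (d : T -> T -> R) : Prop :=
  forall (x : T) (A : set T),
    nbhs x A <-> exists2 e, 0 < e & [set y | d x y < e] `<=` A.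

Definition is_metric (R : realType) (T : Type) (d : T -> T -> R) : Prop :=
  [/\ forall x y, d x y = 0 <-> x = y,
      forall x y, d x y = d y x
    & forall x y z, d x z <= d x y + d y z].

Definition metrizable (R : realType) (T : topologicalType) : Prop :=
  exists2 d : T -> T -> R, is_metric d & induces_topology d.

Definition invariant_metric (R : realType) (T : preTopologicalPzRingType)
    (d : T -> T -> R) : Prop :=
  [/\ is_metric d, induces_topology d
    & forall x y z, d x y = d (x + z) (y + z)].

Definition complete_for (R : realType) (T : topologicalType)
    (d : T -> T -> R) : Prop :=
  forall u : nat -> T,
    (forall e, 0 < e ->
      exists N, forall m n, (N <= m)%N -> (N <= n)%N -> d (u m) (u n) < e) ->
    exists l : T, u @ \oo --> l.

Definition set_incl (T : Type) (A B : set T) (AB : A `<=` B) (x : A) : B :=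
  exist _ (val x) (mem_set (AB _ (set_mem (valP x)))).

Definition topological_subring_iso (A V : preTopologicalPzRingType)
    (W : set V) (phi : A -> W) (psi : W -> A) : Prop :=
  [/\ subring_closed (mem W),
      zmod_morphism (set_val \o phi : A -> V),
      monoid_morphism (set_val \o phi : A -> V),
      cancel phi psi /\ cancel psi phi
    & continuous phi /\ continuous psi].
End TopologicalRings.

Section Adeles.
Context {R : realType} {E : fieldType} {F : subfield E}.
Variable nF : place R (subfield_type F) -> absval R (subfield_type F).

Section FiniteLevel.
Variable K : finite_galois F.

Definition fin_place : Type := place R (subfield_type K).

Definition fin_av (v : fin_place) : absval R (subfield_type K) :=
  place_av nF (incl_subfield (fg_sub K)) v.

Definition fin_completion (v : fin_place) : comPzRingType :=
  completion (fin_av v).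

Definition fin_O (v : fin_place) : set (completion (fin_av v)) :=
  [set x | completion_av (fin_av v) x <= 1].
Arguments fin_O : clear implicits.

(* Only finitely many places are archimedean; exempting them explicitly makes
   closure under addition immediate. *)
Definition adeles : set (dprod fin_completion) :=
  [set a | finite_set
    [set v | nonarchimedean (fin_av v) /\ ~ fin_O v (a v)]].

Lemma adeles_subring : subring_closed (mem adeles).
Proof.
have nac v :
    nonarchimedean (fin_av v) -> nonarchimedean (completion_av (fin_av v)).
  exact: completion_nonarchimedean.
pose bad (a : dprod fin_completion) :=
  [set v | nonarchimedean (fin_av v) /\ ~ fin_O v (a v)].
split.
- apply/mem_set; apply: sub_finite_set (finite_set0 _) => v [_] /=.
  by apply; rewrite /fin_O /= completion_norm1.
- move=> a b /set_mem fa /set_mem fb; apply/mem_set.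
  apply: (@sub_finite_set _ _ (bad a `|` bad b)); last first.
    by rewrite finite_setU; split; [exact: fa | exact: fb].
  move=> v [na /= Oab]; apply: contrapT => /not_orP[].
  move=> /not_andP[//|/contrapT Oa] /not_andP[//|/contrapT Ob]; apply: Oab.
  apply: le_trans (nac _ na _ _) _.
  by rewrite ge_max avN; apply/andP.
- move=> a b /set_mem fa /set_mem fb; apply/mem_set.
  apply: (@sub_finite_set _ _ (bad a `|` bad b)); last first.
    by rewrite finite_setU; split; [exact: fa | exact: fb].
  move=> v [na /= Oab]; apply: contrapT => /not_orP[].
  move=> /not_andP[//|/contrapT Oa] /not_andP[//|/contrapT Ob]; apply: Oab.
  rewrite /fin_O /= completion_normM mulr_ile1 //; exact: completion_norm_ge0.
Qed.

Definition adele_ring : Type := {a | a \in adeles}.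
HB.instance Definition _ := [isSub of adele_ring for @sval _ _].
HB.instance Definition _ := [Choice of adele_ring by <:].
HB.instance Definition _ := GRing.SubChoice_isSubComPzRing.Build
  (dprod fin_completion) (mem adeles) adele_ring adeles_subring.

Definition adele_basis : set (set adele_ring) :=
  [set B | exists U : forall v, set (completion (fin_av v)),
    [/\ forall v, open (U v),
        finite_set [set v | nonarchimedean (fin_av v) /\ U v <> fin_O v]
      & B = [set a : adele_ring | forall v, U v (val a v)]]].
HB.instance Definition _ :=
  isSubBaseTopological.Build adele_ring adele_basis id.
End FiniteLevel.

(* The place v below w is unique when it exists; con_prod maps adeles to adeles,
   so the default value 0 in con is never used for global fields. *)
Definition con_prod (K L : finite_galois F) (KL : K `<=` L)
    (a : dprod (@fin_completion K)) : dprod (@fin_completion L) :=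
  fun w => match pselect (exists v, lies_over (incl_subfield KL) w v) with
  | left h => let v := projT1 (cid h) in
      completion_map (incl_subfield KL) (fin_av v) (fin_av w) (a v)
  | right _ => 0
  end.

Definition con (K L : finite_galois F) (KL : K `<=` L)
    (a : adele_ring K) : adele_ring L :=
  insubd 0 (con_prod KL (val a)).

(* F0 is a phantom argument: the topology on the places of E depends on it. *)
Definition top_place (F0 : subfield E) : Type := place R E.
HB.instance Definition _ F0 := Choice.on (top_place F0).
Local Notation Y := (top_place F).

Definition places_over (K : finite_galois F) (v : fin_place K) : set Y :=
  [set y | lies_over (val : subfield_type K -> E) y v].

Definition top_place_basis : set (set Y) :=
  [set S | exists K (v : fin_place K), S = places_over v].
HB.instance Definition _ :=
  isSubBaseTopological.Build Y top_place_basis id.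

Definition top_av (y : Y) : absval R E :=
  place_av nF (val : subfield_type F -> E) y.

Definition top_completion (y : Y) : comPzRingType :=
  completion (top_av y).

Definition top_O (y : Y) : set (completion (top_av y)) :=
  [set x | completion_av (top_av y) x <= 1].
Arguments top_O : clear implicits.

(* s(y) = z *)
Definition gal_place (K : finite_galois F) (s : gal K) (y z : Y) :=
  forall c : E, top_av z (s c) = top_av y c.

Record transition_diagram (K : finite_galois F) (v : fin_place K) :=
  TransitionDiagram {
    td :> places_over v -> places_over v -> gal K;
    td_continuous :
      continuous (fun p : places_over v * places_over v => td p.1 p.2);
    td_id : forall x c, td x x c = c;
    td_place : forall x y, gal_place (td x y) (val x) (val y);
    td_comp : forall x y z c, td y z (td x y c) = td x z c }.

Section Vbar.
Context {K : finite_galois F}.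
Variable lam : forall v : fin_place K, transition_diagram v.
Variable r : forall v : fin_place K, places_over v.

(* The map E_y -> E_(r v) induced by lam v y (r v). *)
Definition to_ref (v : fin_place K) (y : places_over v) :
    completion (top_av (val y)) -> completion (top_av (val (r v))) :=
  completion_map (lam v y (r v)) (top_av (val y)) (top_av (val (r v))).

Definition Vbar : set (dprod top_completion) :=
  [set a |
    (exists2 Z : set Y, compact Z & forall y, ~ Z y -> top_O y (a y)) /\
    (forall v, continuous (fun y : places_over v => @to_ref v y (a (val y))))].

(* Closure under the ring operations is part of the theorem, so the ring
   structure takes a proof of it as an argument. *)
Definition Vbar_ring (hV : subring_closed (mem Vbar)) : Type :=
  {a | a \in Vbar}.
HB.instance Definition _ hV := [isSub of Vbar_ring hV for @sval _ _].
HB.instance Definition _ hV := [Choice of Vbar_ring hV by <:].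
HB.instance Definition _ hV := GRing.SubChoice_isSubComPzRing.Build
  (dprod top_completion) (mem Vbar) (Vbar_ring hV) hV.

Definition Vbar_basis hV : set (set (Vbar_ring hV)) :=
  [set B | exists U : forall y, set (completion (top_av y)),
    [/\ exists2 Z : set Y, compact Z & forall y, ~ Z y -> U y = top_O y,
        forall v, open
          [set p : places_over v * completion (top_av (val (r v))) |
             exists2 u, U (val p.1) u & p.2 = @to_ref v p.1 u]
      & B = [set a : Vbar_ring hV | forall y, U y (val a y)]]].
HB.instance Definition _ hV :=
  isSubBaseTopological.Build (Vbar_ring hV) (@Vbar_basis hV) id.
End Vbar.
End Adeles.
Arguments fin_place R {E F} K.
Arguments top_place R {E} F0.

(* Main.v *)
Require Import Defs.
From mathcomp Require Import all_boot all_order all_algebra.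
From mathcomp Require Import separable polyXY fieldext finfield zify ring lra.
From mathcomp Require Import all_classical all_reals topology normedtype.
From mathcomp Require Import sequences exp interval_inference.

Set Implicit Arguments.
Unset Strict Implicit.
Unset Printing Implicit Defensive.
Import Order.TTheory GRing.Theory Num.Theory.
Import numFieldNormedType.Exports.
Local Open Scope classical_set_scope.
Local Open Scope ring_scope.

(** The proof rests on a description of the topology by uniform estimates. Write
    [V] for the ring. For a finite set [S] of places of [K0] containing the
    archimedean ones and [0 < e <= 1], let [Vnbhd S e a] consist of the [b] with
    [|b_y - a_y| < e] at the places [y] above [S] and [|b_y - a_y| <= 1] at the
    others. These sets form a base of neighbourhoods of [a] ([Vbar_nbhs]): the set
    of places above [S] is compact, and the transported coordinates of [a] vary
    continuously on it, so the radii allowed at its points by a basic open set are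
    bounded below. From this base the ring is topological by the estimates that
    serve for adeles ([V_topological]). It is complete because a Cauchy sequence
    for an invariant metric converges uniformly on the places above each [S], and
    uniform limits are continuous ([V_complete]). It is metrizable because a
    global field has countably many places ([few_places_global]): the supremum of
    the coordinate distances, truncated ever more severely along an enumeration of
    the places of [K0], is a metric ([V_metrizable]).

    An adele [c] of [K] is sent to the family whose coordinate at [y] is the image
    of [c_v] in [E_y], for [v] the place of [K] below [y]. The transported
    coordinates of this family are locally constant, since by the Krull continuity
    of the transition diagrams the restriction to [K] of [lam v y (r v)] depends
    locally constantly on [y] ([lam_locally_constant], [diagonal_Vbar]). The map is
    injective because every place of [K] extends to [E] ([place_above]); it is a
    homeomorphism onto its image because the finite sets of places used in the
    bases of both topologies correspond under going up and down ([finite_res_rel]);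
    and it is compatible with conorms because places restrict transitively.

    For density, the transported coordinates of [a] above [S] are, at a large
    enough finite level, constant up to [e / 2] on the fibres over the places of
    that level; on each fibre a single element of [E] approximates them. At a
    level containing these elements and their conjugates, and so fine that the
    diagrams act on them locally constantly, transporting the elements back gives
    the coordinates of an adele close to [a] ([embed_dense]).

    Three facts of valuation theory carry this. An absolute value extends to every
    algebraic extension ([absval_extension]): a minimal submultiplicative seminorm
    bounded by the given absolute value on the base field is multiplicative. Only
    finitely many places of a finite extension lie over a given place
    ([finite_places_above]): by approximation their number is at most the degree.
    The fibres of [Y_E] are compact ([compact_places_over]): along an ultrafilter
    the absolute value of each element of [E] is eventually constant, because it
    is determined at a finite level, where only finitely many values occur. *)

(** * Polynomial growth and absolute values *)

Section Growth.
Context {R : realType}.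

Lemma bernoulli_ineq (q : R) (m : nat) : 0 <= q -> 1 + (q - 1) *+ m <= q ^+ m.
Proof.
move=> q0; elim: m => [|m IH]; first by rewrite mulr0n addr0 expr0.
rewrite exprS; apply: le_trans (ler_wpM2l q0 IH).
have -> : q * (1 + (q - 1) *+ m) =
    1 + (q - 1) *+ m.+1 + (q - 1) * ((q - 1) *+ m).
  by rewrite mulrS; set t := _ *+ m; ring.
by rewrite lerDl mulrnAr mulrn_wge0 // -expr2 sqr_ge0.
Qed.

Lemma expr_gt_eventually (q B : R) : 1 < q ->
  exists N, forall n, (N <= n)%N -> B < q ^+ n.
Proof.
move=> q1; exists (Num.truncn (B / (q - 1))).+1 => n Nn.
have q10 : 0 < q - 1 by rewrite subr_gt0.
apply: lt_le_trans (bernoulli_ineq n (ltW (lt_trans ltr01 q1))).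
have : B / (q - 1) < n%:R.
  by apply: lt_le_trans (truncnS_gt _) _; rewrite ler_nat.
rewrite ltr_pdivrMr // -mulr_natl; lra.
Qed.

Lemma expr_lt_eventually (q e : R) : 0 <= q -> q < 1 -> 0 < e ->
  exists N, forall n, (N <= n)%N -> q ^+ n < e.
Proof.
move=> q0 q1 e0; have [q00|q00] := eqVneq q 0.
  by exists 1%N => -[//|n] _; rewrite q00 exprS mul0r.
have {}q0 : 0 < q by rewrite lt_neqAle eq_sym q00.
have [|N HN] := @expr_gt_eventually q^-1 e^-1; first by rewrite invf_gt1.
exists N => n /HN; rewrite exprVn ltf_pV2 // posrE ?exprn_gt0 //.
Qed.

(** Absolute values are compared below by estimating [n]-th powers up to a factor
    polynomial in [n]; this lemma then removes the factor. *)
Lemma poly_growth_le1 (q : R) (k : nat) :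
  0 <= q -> (forall n, q ^+ n <= n.+1%:R ^+ k) -> q <= 1.
Proof.
move=> q0 H; rewrite leNgt; apply/negP => q1.
have bern m := bernoulli_ineq m q0.
pose c : R := Num.min 1 (q - 1).
have c0 : 0 < c by rewrite lt_min ltr01 subr_gt0.
have cb m : c * m.+1%:R <= q ^+ m.
  apply: le_trans (bern m); rewrite -[_ *+ m]mulr_natr -natr1 mulrDr mulr1 [leLHS]addrC.
  by rewrite lerD ?ge_min ?lexx // ler_wpM2r // ge_min lexx orbT.
(* By [cb] and the hypothesis at [m * k.+1],
   [(c * (m + 1)) ^ (k + 1) <= q ^ (m * (k + 1)) <= ((k + 1) * (m + 1)) ^ k],
   so [m + 1 <= B] for every [m]. *)
pose B := k.+1%:R ^+ k / c ^+ k.+1.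
have cb2 m : m.+1%:R <= B.
  rewrite /B ler_pdivlMr ?exprn_gt0 //.
  have mm0 : 0 < m.+1%:R ^+ k :> R by rewrite exprn_gt0.
  rewrite -(ler_pM2l mm0) mulrA -exprSr -exprMn -[leRHS]exprMn [_ * c]mulrC.
  apply: (@le_trans _ _ (q ^+ (m * k.+1))).
    by rewrite exprM lerXn2r // nnegrE ?exprn_ge0 // mulr_ge0 // ltW.
  apply: (le_trans (H _)).
  rewrite lerXn2r // ?nnegrE // -natrM ler_nat; lia.
have := cb2 (Num.truncn B); have := truncnS_gt B; lra.
Qed.

Lemma powR_sum_le (m : nat) (t : 'I_m -> R) (s : R) : 0 < s ->
  (forall i, 0 <= t i) ->
  (\sum_i t i) `^ s <= m%:R `^ s * \sum_i t i `^ s.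
Proof.
move=> s0 t0; case: m t t0 => [|m] t t0.
  by rewrite !big_ord0 mulr0 powR0 // gt_eqF.
pose i0 := [arg max_(i > ord0) t i]%O.
have ti0 i : t i <= t i0.
  by rewrite /i0; case: Order.TotalTheory.arg_maxP => // j _; exact.
apply: (@le_trans _ _ ((m.+1%:R * t i0) `^ s)).
  apply: ge0_ler_powR; rewrite ?nnegrE ?(ltW s0) ?sumr_ge0 ?mulr_ge0 //.
  rewrite (@le_trans _ _ (\sum_(i < m.+1) t i0)) ?ler_sum //.
  by rewrite sumr_const card_ord mulr_natl.
rewrite powRM // ler_wpM2l ?powR_ge0 // (bigD1 i0) //= lerDl.
by rewrite sumr_ge0 // => i _; exact: powR_ge0.
Qed.
End Growth.

Section AbsValMore.
Context {R : realType} {L : fieldType}.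
Implicit Types a b : absval R L.

Lemma absval_ext a b : a =1 b -> a = b.
Proof.
case: a b => [f f1 f2 f3 f4] [g g1 g2 g3 g4] /= /funext fg.
by subst g; congr AbsVal; exact: Prop_irrelevance.
Qed.

Lemma av_gt0 a x : x != 0 -> 0 < a x.
Proof. by move=> x0; rewrite lt_neqAle av_ge0 eq_sym andbT; apply: contra_neq x0 => /av_eq0. Qed.

Lemma av_eq0E a x : (a x == 0) = (x == 0).
Proof. by apply/eqP/eqP => [/av_eq0|->] //; exact: av0. Qed.

Lemma avX a x n : a (x ^+ n) = a x ^+ n.
Proof. by elim: n => [|n IH]; rewrite ?expr0 ?av1 // !exprS avM IH. Qed.

Lemma av_sum a (m : nat) (f : 'I_m -> L) : a (\sum_i f i) <= \sum_i a (f i).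
Proof.
elim: m f => [|m IH] f; first by rewrite !big_ord0 av0.
by rewrite !big_ord_recr /= (le_trans (avD _ _ _)) // lerD.
Qed.

Lemma av_nat a n : a n%:R <= n%:R.
Proof.
elim: n => [|n IH]; first by rewrite av0.
by rewrite -natr1 (le_trans (avD _ _ _)) // av1 -natr1 lerD.
Qed.

Lemma natpowR_le_expr (s : R) (n : nat) : 0 < s ->
  n.+1%:R `^ s <= n.+1%:R ^+ (Num.truncn s).+1.
Proof.
move=> s0; rewrite -powR_mulrn // ler_powR //; last by rewrite ltW // truncnS_gt.
by rewrite ler1n.
Qed.

Section Power.
Variables (a : absval R L) (s : R).
Hypothesis s0 : 0 < s.
Hypothesis nat_le : forall n : nat, a n%:R `^ s <= n%:R.
Let f x := a x `^ s.

Let f_ge0 x : 0 <= f x. Proof. exact: powR_ge0. Qed.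
Let f_eq0 x : f x = 0 <-> x = 0.
Proof.
split=> [/powR_eq0_eq0/av_eq0 //|->]; by rewrite /f av0 powR0 ?gt_eqF.
Qed.
Let fM x y : f (x * y) = f x * f y.
Proof. by rewrite /f avM powRM ?av_ge0. Qed.
Let fX x n : f (x ^+ n) = f x ^+ n.
Proof.
elim: n => [|n IH]; last by rewrite !exprS fM IH.
by rewrite !expr0 /f av1 powR1.
Qed.
(** A power [a ^ s] with [s > 1] may violate the triangle inequality, but only if
    it does so on the integers: expanding [(x + y) ^+ n] bounds [f (x + y) ^ n] by
    [(f x + f y) ^ n] up to a factor polynomial in [n]. This is how an absolute
    value is rescaled within its place. *)
Let fD x y : f (x + y) <= f x + f y.
Proof.
have [->|x0] := eqVneq x 0; first by rewrite add0r lerDr.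
have fxy : 0 < f x + f y.
  by rewrite ltr_pwDl // lt_neqAle f_ge0 eq_sym andbT; apply: contra_neq x0 => /f_eq0.
rewrite -[leRHS]mul1r -ler_pdivrMr //.
apply: (@poly_growth_le1 _ _ (Num.truncn s).+1) => [|n].
  by rewrite divr_ge0 // ltW.
rewrite expr_div_n ler_pdivrMr ?exprn_gt0 // -fX.
apply: le_trans (ler_wpM2r (exprn_ge0 _ (ltW fxy)) (natpowR_le_expr _ s0)).
have -> : f ((x + y) ^+ n) = a (\sum_(i < n.+1) x ^+ (n - i) * y ^+ i *+ 'C(n, i)) `^ s.
  by rewrite exprDn.
have := @powR_sum_le _ _ (fun i : 'I_n.+1 => a (x ^+ (n - i) * y ^+ i *+ 'C(n, i)))
   _ s0 (fun i => av_ge0 _ _).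
move=> H; apply: (le_trans _ (le_trans H _)).
  by apply: ge0_ler_powR; rewrite ?nnegrE ?av_ge0 ?(ltW s0) ?sumr_ge0 ?av_sum // => i _; exact: av_ge0.
rewrite ler_wpM2l ?powR_ge0 // exprDn ler_sum // => i _.
rewrite -[X in a X]mulr_natr -/(f _) !fM !fX -[leRHS]mulr_natr ler_wpM2l ?mulr_ge0 ?exprn_ge0 //.
exact: nat_le.
Qed.

Definition av_pow : absval R L := AbsVal f_ge0 f_eq0 fM fD.
End Power.

(** If the integers are bounded by [1], the [n + 1] terms of [(x + y) ^+ n] are
    each at most [max (a x) (a y) ^ n]. *)
Lemma nonarch_nat a : (forall n : nat, a n%:R <= 1) -> nonarchimedean a.
Proof.
move=> H x y; set M := Num.max _ _.
have M0 : 0 <= M by rewrite le_max av_ge0.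
have [M00|M00] := eqVneq M 0.
  have ax : a x <= 0 by rewrite -M00 le_max lexx.
  have ay : a y <= 0 by rewrite -M00 le_max lexx orbT.
  rewrite (le_trans (avD _ _ _)) //; lra.
have {}M0 : 0 < M by rewrite lt_neqAle eq_sym M00.
rewrite -[leRHS]mul1r -ler_pdivrMr //.
apply: (@poly_growth_le1 _ _ 1) => [|n]; first by rewrite divr_ge0 ?av_ge0 ?ltW.
rewrite expr_div_n ler_pdivrMr ?exprn_gt0 // -avX exprDn (le_trans (av_sum _ _)) //.
rewrite expr1 mulr_natl -[X in _ *+ X]card_ord -sumr_const ler_sum // => i _.
rewrite -mulr_natr !avM !avX -[leRHS]mulr1 ler_pM ?mulr_ge0 ?exprn_ge0 ?av_ge0 //.
have -> : M ^+ n = M ^+ (n - i) * M ^+ i by rewrite -exprD subnK // -ltnS.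
by rewrite ler_pM ?exprn_ge0 ?av_ge0 // lerXn2r // ?nnegrE ?av_ge0 ?(ltW M0) // le_max lexx ?orbT.
Qed.

Lemma nonarch_natP a : nonarchimedean a <-> forall n : nat, a n%:R <= 1.
Proof.
split=> [na|]; last exact: nonarch_nat.
elim=> [|n IH]; first by rewrite av0.
by rewrite -natr1 (le_trans (na _ _)) // ge_max IH av1 lexx.
Qed.

Lemma nonarch_sum a (na : nonarchimedean a) (m : nat) (f : 'I_m -> L) (e : R) :
  0 <= e -> (forall i, a (f i) <= e) -> a (\sum_i f i) <= e.
Proof.
move=> e0; elim: m f => [|m IH] f H; first by rewrite big_ord0 av0.
by rewrite big_ord_recr (le_trans (na _ _)) // ge_max IH //= H.
Qed.

End AbsValMore.

(** * Places and their restrictions *)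

Section PlaceBasics.
Context {R : realType}.

Lemma av_equiv_refl (L : fieldType) (a : absval R L) : av_equiv a a.
Proof. by exists 1 => // x; rewrite powRr1 // av_ge0. Qed.

Lemma av_equiv_sym (L : fieldType) (a b : absval R L) :
  av_equiv a b -> av_equiv b a.
Proof.
move=> [s s0 ab]; exists s^-1; first by rewrite invr_gt0.
by move=> x; rewrite ab -powRrM divff ?gt_eqF // powRr1 // av_ge0.
Qed.

Lemma av_equiv_trans (L : fieldType) (a b c : absval R L) :
  av_equiv a b -> av_equiv b c -> av_equiv a c.
Proof.
move=> [s s0 ab] [t t0 bc]; exists (s * t); first by rewrite mulr_gt0.
by move=> x; rewrite bc ab powRrM.
Qed.

Lemma av_equiv_comp (K L : fieldType) (i : {rmorphism K -> L})
    (a b : absval R L) :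
  av_equiv a b -> av_equiv (av_comp i a) (av_comp i b).
Proof. by move=> [s s0 ab]; exists s => // x; exact: ab. Qed.

Lemma av_equiv_nontrivial (L : fieldType) (a b : absval R L) :
  av_equiv a b -> av_nontrivial a -> av_nontrivial b.
Proof.
move=> /av_equiv_sym[s s0 ab] [x x0 ax]; exists x => //.
by apply: contra_neq ax => bx; rewrite ab bx powR1.
Qed.

Lemma place_nontrivial (L : fieldType) (w : place R L) a :
  val w a -> av_nontrivial a.
Proof.
case: w => P /= /set_mem[b nb ->] ab; exact: av_equiv_nontrivial nb.
Qed.

Lemma place_equiv (L : fieldType) (w : place R L) a b :
  val w a -> val w b -> av_equiv a b.
Proof.
case: w => P /= /set_mem[c _ ->] ca cb.
by apply: av_equiv_trans cb; exact: av_equiv_sym.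
Qed.

Lemma place_closed (L : fieldType) (w : place R L) a b :
  val w a -> av_equiv a b -> val w b.
Proof.
case: w => P /= /set_mem[c _ ->] ca; exact: av_equiv_trans.
Qed.

Lemma place_inhabited (L : fieldType) (w : place R L) : exists a, val w a.
Proof.
by case: w => P /= /set_mem[c _ ->]; exists c; exact: av_equiv_refl.
Qed.

Lemma place_eq (L : fieldType) (w w' : place R L) a :
  val w a -> val w' a -> w = w'.
Proof.
move=> wa wa'; apply/val_inj/seteqP; split=> b wb.
  exact: place_closed wa' (place_equiv wa wb).
exact: place_closed wa (place_equiv wa' wb).
Qed.

Definition place_of (L : fieldType) (a : absval R L) (na : av_nontrivial a) :
    place R L :=
  exist _ [set b | av_equiv a b] (mem_set (ex_intro2 _ _ a na erefl)).

Lemma place_ofP (L : fieldType) (a : absval R L) (na : av_nontrivial a) :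
  val (place_of na) a.
Proof. exact: av_equiv_refl. Qed.

Lemma lies_overI (K L : fieldType) (i : {rmorphism K -> L})
    (w : place R L) (v : place R K) a :
  val w a -> val v (av_comp i a) -> lies_over i w v.
Proof.
move=> wa va b wb; apply: place_closed va _.
by apply: av_equiv_comp; exact: place_equiv wb.
Qed.

Lemma lies_over_uniq (K L : fieldType) (i : {rmorphism K -> L})
    (w : place R L) v v' :
  lies_over i w v -> lies_over i w v' -> v = v'.
Proof.
by have [a wa] := place_inhabited w => /(_ _ wa) va /(_ _ wa); exact: place_eq.
Qed.

Lemma lies_over_mid (K L M : fieldType) (i : {rmorphism K -> L})
    (j : {rmorphism L -> M}) (k : {rmorphism K -> M}) (w : place R M) v u :
  (forall x, k x = j (i x)) ->
  lies_over j w v -> lies_over k w u -> lies_over i v u.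
Proof.
have [a wa] := place_inhabited w.
move=> kE /(_ _ wa) va /(_ _ wa) ua; apply: lies_overI va _.
by move: ua; congr (val u _); apply: absval_ext => x /=; rewrite kE.
Qed.

(** Otherwise the leading term would exceed all the others. *)
Lemma nonarch_root_le1 (L : fieldType) (a : absval R L) (p : {poly L}) x :
  nonarchimedean a -> p != 0 -> root p x ->
  (forall i, a p`_i <= 1) -> a (lead_coef p) = 1 -> a x <= 1.
Proof.
move=> na p0 /rootP px pc pl; rewrite leNgt; apply/negP => x1.
have x0 := lt_trans ltr01 x1.
move: px; rewrite horner_coef; case sp: (size p) => [|n].
  by move/eqP: sp; rewrite size_poly_eq0 (negbTE p0).
rewrite big_ord_recr /=.
have -> : p`_n = lead_coef p by rewrite lead_coefE sp.
case: n sp => [|n] sp.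
  rewrite big_ord0 add0r expr0 mulr1 => l0; move: pl.
  by rewrite l0 av0; lra.
move=> /eqP; rewrite addrC addr_eq0 => /eqP/(congr1 a).
rewrite avN avM pl mul1r avX => H.
have : a (\sum_(i < n.+1) p`_i * x ^+ i) <= a x ^+ n.
  apply: nonarch_sum => // [|i]; first by rewrite exprn_ge0 // av_ge0.
  rewrite avM avX -[leRHS]mul1r ler_pM ?exprn_ge0 ?av_ge0 //.
  by rewrite ler_weXn2l // ?(ltW x1) // -ltnS.
by rewrite -H leNgt ltr_eXn2l // ltnSn.
Qed.

(** Were the restriction trivial, every element and its inverse would be integral
    over the base field, hence of absolute value [1]. *)
Lemma av_comp_nontrivial (K L : fieldType) (i : {rmorphism K -> L})
    (a : absval R L) :
  algebraic_ext i -> av_nontrivial a -> av_nontrivial (av_comp i a).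
Proof.
move=> alg [x x0 /eqP ax]; apply: contrapT => nt.
have triv c : c != 0 -> a (i c) = 1.
  by move=> c0; apply: contrapT => /eqP h; apply: nt; exists c.
have triv1 c : a (i c) <= 1.
  by have [->|/triv -> //] := eqVneq c 0; rewrite rmorph0 av0.
have na : nonarchimedean a.
  by apply/nonarch_natP => n; rewrite -(rmorph_nat i).
have le1 y : a y <= 1.
  have [p p0 py] := alg y; apply: (nonarch_root_le1 na _ py).
  - by rewrite map_poly_eq0.
  - by move=> j; rewrite coef_map; exact: triv1.
  - by rewrite lead_coef_map; apply: triv; rewrite lead_coef_eq0.
apply: ax; apply/le_anti; rewrite le1 /=.
by have := le1 x^-1; rewrite avV invf_le1 // av_gt0.
Qed.

Lemma place_below (K L : fieldType) (i : {rmorphism K -> L}) (w : place R L) :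
  algebraic_ext i -> exists v, lies_over i w v.
Proof.
move=> alg; have [a wa] := place_inhabited w.
exists (place_of (av_comp_nontrivial alg (place_nontrivial wa))).
exact: lies_overI wa (place_ofP _).
Qed.

Section PlaceAv.
Context {K L : fieldType} (i : {rmorphism K -> L}).
Variable nK : place R K -> absval R K.
Hypotheses (alg : algebraic_ext i) (nK_in : forall p, val p (nK p)).

(** The defining property of [place_av], whose definition falls back on a default
    value: any [a] in [w] restricts to a power of [nK p], and rescaling [a] by the
    inverse exponent [s] gives an absolute value, because on the integers [a ^ s]
    agrees with [nK p]. *)
Lemma place_av_spec (w : place R L) : val w (place_av nK i w) /\
  exists2 p, lies_over i w p & forall x, place_av nK i w (i x) = nK p x.
Proof.
rewrite /place_av; case: xgetP => [a _ //|H]; exfalso.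
have [a wa] := place_inhabited w; have [p wp] := place_below w alg.
have [s s0 aE] := place_equiv (wp _ wa) (nK_in p).
have an (n : nat) : a n%:R `^ s <= n%:R.
  by have := aE n%:R; rewrite /= rmorph_nat => <-; exact: av_nat.
apply: (H (av_pow s0 an)); split; last by exists p => // x; rewrite aE.
by apply: place_closed wa _; exists s.
Qed.

Lemma place_av_in w : val w (place_av nK i w).
Proof. by have [] := place_av_spec w. Qed.

Lemma place_avE w p : lies_over i w p -> forall x, place_av nK i w (i x) = nK p x.
Proof.
have [_ [q wq H]] := place_av_spec w => wp x.
by rewrite H (lies_over_uniq wp wq).
Qed.

Lemma av_equiv_eq (a b : absval R L) : av_equiv a b ->
  av_nontrivial (av_comp i a) -> (forall x, a (i x) = b (i x)) -> a = b.
Proof.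
move=> [s s0 ab] [x x0 /= ax] H; apply: absval_ext => y; rewrite ab.
suff -> : s = 1 by rewrite powRr1 // av_ge0.
have ai0 : 0 < a (i x) by rewrite av_gt0 // fmorph_eq0.
have := ab (i x); rewrite -H => /(congr1 (@ln R)); rewrite ln_powR => /eqP.
rewrite -subr_eq0 -{1}[ln _]mul1r -mulrBl mulf_eq0 subr_eq0 eq_sym ln_eq0 //.
by rewrite (negbTE ax) orbF => /eqP.
Qed.

Lemma place_av_uniq w p a : val w a -> lies_over i w p ->
  (forall x, a (i x) = nK p x) -> place_av nK i w = a.
Proof.
move=> wa wp aE; apply: av_equiv_eq.
- exact: place_equiv (place_av_in w) wa.
- apply: (@place_nontrivial _ p); exact: wp (place_av_in w).
- by move=> x; rewrite aE (place_avE wp).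
Qed.
End PlaceAv.
End PlaceBasics.

(** * Finitely many extensions of a place *)

Section LinearDependence.
Context {K L : fieldType} (i : {rmorphism K -> L}).

Lemma linear_dependence (s : seq L) (m : nat) (x : 'I_m -> L) :
  (forall y : L, exists c : 'I_(size s) -> K, y = \sum_j i (c j) * s`_j) ->
  (size s < m)%N ->
  exists2 u : 'rV[K]_m, u != 0 & \sum_k i (u 0 k) * x k = 0.
Proof.
move=> spans sm.
have /choice[C hC] : forall k, exists c : 'I_(size s) -> K,
    x k = \sum_j i (c j) * s`_j by move=> k; exact: spans.
pose M := \matrix_(k < m, j < size s) C k j.
have : kermx M != 0.
  rewrite kermx_eq0 /row_free; apply: contraTneq sm => <-.
  by rewrite -leqNgt rank_leq_col.
case/rowV0Pn => u /sub_kermxP uM u0; exists u => //.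
under eq_bigr => k _ do rewrite hC mulr_sumr.
rewrite exchange_big big1 //= => j _.
have /matrixP/(_ 0 j) := uM; rewrite !mxE => uM0.
under eq_bigr => k _ do rewrite mulrA.
rewrite -mulr_suml; apply/eqP; rewrite mulf_eq0; apply/orP; left; apply/eqP.
move/(congr1 i): uM0; rewrite rmorph0 rmorph_sum => {2}<-.
by apply: eq_bigr => k _; rewrite rmorphM mxE.
Qed.

Lemma finite_ext_algebraic : finite_ext i -> algebraic_ext i.
Proof.
move=> [s spans] x.
have [u u0 ux] := linear_dependence (fun k : 'I_(size s).+1 => x ^+ k) spans (ltnSn _).
pose p := \poly_(k < (size s).+1) u 0 (inord k).
have pk (k : 'I_(size s).+1) : p`_k = u 0 k.
  by rewrite coef_poly ltn_ord inord_val.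
exists p.
  apply: contraNneq u0 => p0; apply/eqP/rowP => k.
  by rewrite -pk p0 coef0 mxE.
apply/rootP; rewrite (@horner_coef_wide _ (size s).+1); last first.
  by rewrite size_map_poly size_poly.
by rewrite -[RHS]ux; apply: eq_bigr => k _; rewrite coef_map /= pk.
Qed.
End LinearDependence.

Section Approximation.
Context {R : realType} {K L : fieldType} (i : {rmorphism K -> L}).
Variable b : absval R K.
Hypothesis nb : av_nontrivial b.

Definition extends (a : absval R L) := forall c, a (i c) = b c.

Let uniformizer : exists2 c, c != 0 & 1 < b c.
Proof.
have [c c0 bc] := nb; have [h|h|/esym/eqP h] := ltgtP 1 (b c).
- by exists c.
- by exists c^-1; rewrite ?invr_neq0 // avV invf_gt1 // av_gt0.
- by move: bc; rewrite (eqP h) eqxx.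
Qed.

(** The absolute value [a] extending [b] can be read off from its open unit ball:
    comparing powers of [x] with powers of the base element [c] locates [a x]. *)
Lemma extends_lt1 (a1 a2 : absval R L) : extends a1 -> extends a2 ->
  (forall x, a1 x < 1 -> a2 x < 1) -> a1 = a2.
Proof.
move=> e1 e2 H; have [c c0 bc] := uniformizer.
have le21 x : a2 x <= a1 x.
  rewrite leNgt; apply/negP => lt12.
  have x0 : x != 0 by apply: contraTneq lt12 => ->; rewrite !av0 ltxx.
  have a10 : 0 < a1 x by rewrite av_gt0.
  have b0 : 0 < b c by rewrite av_gt0.
  have q1 : 1 < a2 x / a1 x by rewrite ltr_pdivlMr // mul1r.
  have [n /(_ n (leqnn _)) hn] := expr_gt_eventually (b c) q1.
  have y0 : 0 < a1 x ^+ n by rewrite exprn_gt0.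
  (* The factor [c ^+ M] moves [x ^+ n] above [1], so that the least [k] with
     [a1 (x ^+ n * c ^+ M) < b c ^+ k] is a positive natural number. Then [z] has
     [a1 z < 1], while [a2 z >= 1] since [a2 (x ^+ n)] exceeds [a1 (x ^+ n)] by
     more than one factor [b c]. *)
  have [M /(_ M (leqnn _)) hM] := expr_gt_eventually (a1 x ^+ n)^-1 bc.
  have y1 : 1 < a1 x ^+ n * b c ^+ M by rewrite mulrC -ltr_pdivrMr // mul1r.
  have exk : exists k, a1 x ^+ n * b c ^+ M < b c ^+ k.
    have [k /(_ k (leqnn _)) hk] := expr_gt_eventually (a1 x ^+ n * b c ^+ M) bc.
    by exists k.
  have := ex_minnP exk => -[k hk mink].
  have k0 : (0 < k)%N.
    by rewrite lt0n; apply: contraTneq hk => ->; rewrite expr0 -leNgt ltW.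
  have hk1 : b c ^+ k <= b c * (a1 x ^+ n * b c ^+ M).
    rewrite -(prednK k0) exprS ler_wpM2l ?av_ge0 // leNgt; apply/negP => /mink.
    by rewrite leqNgt prednK // leqnn.
  pose z := x ^+ n * i c ^+ M / i c ^+ k.
  have bk0 : 0 < b c ^+ k by rewrite exprn_gt0.
  have /H : a1 z < 1.
    by rewrite /z !avM avV !avX e1 ltr_pdivrMr // mul1r.
  rewrite /z !avM avV !avX e2 ltr_pdivrMr // mul1r ltNge => /negP; apply.
  apply: (le_trans hk1); rewrite mulrA ler_wpM2r ?exprn_ge0 ?av_ge0 //.
  by rewrite -ler_pdivlMr // -expr_div_n ltW.
apply: absval_ext => x; have [->|x0] := eqVneq x 0; first by rewrite !av0.
apply/le_anti; rewrite le21 andbT.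
by have := le21 x^-1; rewrite !avV lef_pV2 // posrE av_gt0.
Qed.

Lemma separate2 (a1 a2 : absval R L) : extends a1 -> extends a2 -> a1 <> a2 ->
  exists2 x, 1 < a1 x & a2 x < 1.
Proof.
move=> e1 e2 ne.
have [x x1 x2] : exists2 x, a1 x < 1 & 1 <= a2 x.
  apply: contrapT => H; apply: ne; apply: extends_lt1 => // x x1.
  by rewrite ltNge; apply/negP => x2; apply: H; exists x.
have [y y2 y1] : exists2 y, a2 y < 1 & 1 <= a1 y.
  apply: contrapT => H; apply/ne/esym; apply: extends_lt1 => // y y2.
  by rewrite ltNge; apply/negP => y1; apply: H; exists y.
have x0 : x != 0 by apply: contraTneq x2 => ->; rewrite av0 -ltNge.
exists (y / x); rewrite avM avV.
  by rewrite ltr_pdivlMr ?av_gt0 // mul1r (lt_le_trans x1).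
by rewrite ltr_pdivrMr ?av_gt0 // mul1r (lt_le_trans y2).
Qed.

(** By induction on [bs]: [y] separates [a] from [bs], and [z] separates [a] from
    the new element [a1]. If [a1 y <= 1] then [y ^+ n * z] works for [n] large;
    otherwise [z * y ^+ n / (1 + y ^+ n)] does, as it tends to [z] where [y] is
    large and to [0] where [y] is small. *)
Lemma separate (a : absval R L) (bs : seq (absval R L)) : extends a ->
  (forall a', a' \in bs -> extends a' /\ a <> a') ->
  exists2 x, 1 < a x & forall a', a' \in bs -> a' x < 1.
Proof.
move=> ea; elim: bs => [|a1 bs IH] H.
  have [c c0 bc] := uniformizer; exists (i c) => //; by rewrite ea.
have [|y ay bsy] := IH; first by move=> a' h; apply: H; rewrite inE h orbT.
have [e1 ne1] := H a1 (mem_head _ _).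
have [z az a1z] := separate2 ea e1 ne1.
have eventually (P : absval R L -> nat -> Prop) :
    (forall a', a' \in bs -> exists N, forall n, (N <= n)%N -> P a' n) ->
    exists N, forall n, (N <= n)%N -> forall a', a' \in bs -> P a' n.
  elim: (bs) => [|a2 s IHs] Hs; first by exists 0%N.
  have [N1 h1] := Hs _ (mem_head _ _).
  have [a' h|N2 h2] := IHs; first by apply: Hs; rewrite inE h orbT.
  exists (maxn N1 N2) => n; rewrite geq_max => /andP[n1 n2] a'.
  by rewrite inE => /orP[/eqP ->|]; [exact: h1|exact: h2].
have z0 : z != 0 by apply: contraTneq az => ->; rewrite av0 -leNgt.
have ltV (a' : absval R L) : 0 < 1 + a' z by rewrite ltr_pwDl ?av_ge0.
have [N hN] : exists N, forall n, (N <= n)%N ->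
    forall a', a' \in bs -> a' y ^+ n < (1 + a' z)^-1.
  apply: (eventually (fun a' n => a' y ^+ n < (1 + a' z)^-1)) => a' h.
  by apply: expr_lt_eventually; rewrite ?av_ge0 ?bsy ?invr_gt0.
have [a1y|a1y] := lerP (a1 y) 1.
  exists (y ^+ N * z).
    rewrite avM avX; apply: lt_le_trans az _.
    by rewrite ler_peMl ?av_ge0 // exprn_ege1 // ltW.
  move=> a'; rewrite inE avM avX => /orP[/eqP ->|h].
    by rewrite (le_lt_trans _ a1z) // ler_piMl ?av_ge0 // exprn_ile1 ?av_ge0.
  have := hN N (leqnn _) _ h; rewrite -[X in _ < X]div1r ltr_pdivlMr //.
  apply: le_lt_trans; rewrite ler_wpM2l ?exprn_ge0 ?av_ge0 //; lra.
have [N1 hN1] := expr_gt_eventually (1 + (a z - 1)^-1) ay.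
have [N2 hN2] := expr_gt_eventually (1 + (1 - a1 z)^-1) a1y.
pose n := maxn N (maxn N1 N2).
have {}hN a' h := hN n (leq_maxl _ _) a' h.
have {}hN1 := hN1 n (leq_trans (leq_maxl _ _) (leq_maxr _ _)).
have {}hN2 := hN2 n (leq_trans (leq_maxr _ _) (leq_maxr _ _)).
have big1 (a' : absval R L) : 1 < a' y ^+ n -> 0 < a' (1 + y ^+ n).
  move=> a'y; have := av_dist a' (y ^+ n) (- 1).
  by rewrite opprK avX avN av1 [y ^+ n + 1]addrC ler_norml; lra.
have ya : 1 < a y ^+ n.
  by apply: lt_trans hN1; rewrite ltrDl invr_gt0 subr_gt0.
have ya1 : 1 < a1 y ^+ n.
  by apply: lt_trans hN2; rewrite ltrDl invr_gt0 subr_gt0.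
exists (z * y ^+ n / (1 + y ^+ n)).
  rewrite !avM avV avX ltr_pdivlMr ?big1 // mul1r.
  have H1 : 1 < (a z - 1) * a y ^+ n.
    rewrite mulrC -ltr_pdivrMr ?subr_gt0 // mul1r (lt_trans _ hN1) //; lra.
  by have := avD a 1 (y ^+ n); rewrite av1 avX; lra.
move=> a'; rewrite inE !avM avV avX => /orP[/eqP ->|h].
  rewrite ltr_pdivrMr ?big1 // mul1r.
  have H1 : 1 < (1 - a1 z) * a1 y ^+ n.
    rewrite mulrC -ltr_pdivrMr ?subr_gt0 // mul1r (lt_trans _ hN2) //; lra.
  have := av_dist a1 (y ^+ n) (- 1).
  by rewrite opprK avX avN av1 [y ^+ n + 1]addrC ler_norml; lra.
have := hN _ h; rewrite -[X in _ < X]div1r ltr_pdivlMr // => H1.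
have H2 := av_dist a' 1 (- y ^+ n).
rewrite opprK av1 avN avX ler_norml in H2.
have H3 : 0 <= a' y ^+ n * a' z by rewrite mulr_ge0 ?exprn_ge0 ?av_ge0.
have H4 : 0 <= a' y ^+ n by rewrite exprn_ge0 ?av_ge0.
by rewrite ltr_pdivrMr; lra.
Qed.

(** If [y] is large at [a] and small at [bs], then [y ^+ n / (1 + y ^+ n)] tends
    to [1] at [a] and to [0] at [bs]. *)
Lemma approx_delta (a : absval R L) (bs : seq (absval R L)) (e : R) :
  0 < e -> extends a ->
  (forall a', a' \in bs -> extends a' /\ a <> a') ->
  exists2 x, a (x - 1) < e & forall a', a' \in bs -> a' x < e.
Proof.
move=> e0 ea H; have [y ay bsy] := separate ea H.
have [N1 hN1] := expr_gt_eventually (1 + e^-1) ay.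
have [n n1 hn] : exists2 n, (N1 <= n)%N &
    forall a', a' \in bs -> a' y ^+ n < (1 + e^-1)^-1.
  elim: (bs) bsy => [|a2 s IH] bsy; first by exists N1.
  have [a' h|n n1 hn] := IH; first by apply: bsy; rewrite inE h orbT.
  have [|N hN] := @expr_lt_eventually _ (a2 y) (1 + e^-1)^-1 (av_ge0 _ _)
     (bsy _ (mem_head _ _)).
    by rewrite invr_gt0 addr_gt0 ?invr_gt0.
  exists (maxn n N) => [|a']; first by rewrite (leq_trans n1) ?leq_maxl.
  rewrite inE => /orP[/eqP ->|h]; first by rewrite hN // leq_maxr.
  apply: le_lt_trans (hn _ h); apply: ler_wiXn2l; rewrite ?av_ge0 ?leq_maxl //.
  by rewrite ltW // bsy // inE h orbT.
have {}hN1 := hN1 n n1.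
have ei : 0 < e^-1 by rewrite invr_gt0.
have H1 : 0 < a (1 + y ^+ n) /\ e^-1 < a (1 + y ^+ n).
  have := av_dist a (y ^+ n) (- 1).
  by rewrite opprK avX avN av1 [y ^+ n + 1]addrC ler_norml; lra.
exists (y ^+ n / (1 + y ^+ n)).
  have -> : y ^+ n / (1 + y ^+ n) - 1 = - (1 + y ^+ n)^-1.
    have : 1 + y ^+ n != 0 by rewrite -(av_eq0E a) gt_eqF //; case: H1.
    by move: (y ^+ n) => t t0; field.
  by rewrite avN avV invf_plt ?posrE; case: H1.
move=> a' h; have {}hn := hn _ h.
have t0 : 0 <= a' y ^+ n by rewrite exprn_ge0 ?av_ge0.
have H2 := av_dist a' 1 (- y ^+ n).
rewrite opprK av1 avN avX ler_norml in H2.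
have tt : a' y ^+ n * (1 + e^-1) < 1.
  have e1 : 0 < 1 + e^-1 by rewrite addr_gt0.
  by rewrite -(ltr_pdivlMr _ _ e1) div1r.
have te : a' y ^+ n < e * (1 - a' y ^+ n).
  rewrite mulrC -ltr_pdivrMr //; lra.
have t1 : 0 <= a' y ^+ n * e^-1 by rewrite mulr_ge0 ?(ltW ei).
have d0 : 0 < a' (1 + y ^+ n) by lra.
rewrite avM avV avX ltr_pdivrMr // (lt_le_trans te) // ler_wpM2l ?(ltW e0) //; lra.
Qed.

(** Elements close to [1] at one of the absolute values and to [0] at the others
    are linearly independent over [K]: in a relation, the term with the largest
    coefficient would dominate at its own absolute value. *)
Lemma extensions_le_dim (s : seq L)
    (spans : forall x : L, exists c : 'I_(size s) -> K, x = \sum_j i (c j) * s`_j)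
    (m : nat) (A : 'I_m -> absval R L) :
  injective A -> (forall k, extends (A k)) -> (m <= size s)%N.
Proof.
move=> injA eA; rewrite leqNgt; apply/negP => sm.
(* Small enough for [(m - 1) * e < 1 - e]. *)
pose e : R := m.+1%:R^-1.
have e0 : 0 < e by rewrite invr_gt0.
have /choice[x hx] : forall k, exists x, A k (x - 1) < e /\
    forall j, j != k -> A j x < e.
  move=> k; have [|x x1 x2] := @approx_delta (A k)
     [seq A j | j <- enum 'I_m & j != k] e e0 (eA k).
    move=> a' /mapP[j]; rewrite mem_filter => /andP[jk _] ->; split=> //.
    by move/injA => kj; rewrite kj eqxx in jk.
  exists x; split=> // j jk; apply: x2; apply: map_f.
  by rewrite mem_filter jk mem_enum.
have [u u0 ux] := linear_dependence x spans sm.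
have m0 : (0 < m)%N by exact: leq_trans sm.
pose k0 := [arg max_(k > Ordinal m0) b (u 0 k)]%O.
have bk k : b (u 0 k) <= b (u 0 k0).
  by rewrite /k0; case: Order.TotalTheory.arg_maxP => // j _; exact.
have bk0 : 0 < b (u 0 k0).
  have [k uk] : exists k, u 0 k != 0.
    apply: contrapT => H; move/eqP: u0; apply; apply/rowP => k; rewrite mxE.
    by apply/eqP/negPn/negP => uk; apply: H; exists k.
  exact: lt_le_trans (av_gt0 b uk) (bk k).
have [xk0 xk] : A k0 (x k0 - 1) < e /\ forall k, k != k0 -> A k0 (x k) < e.
  by split=> [|k kk]; [case: (hx k0) | case: (hx k) => _; apply; rewrite eq_sym].
have : b (u 0 k0) * A k0 (x k0) <= \sum_(k | k != k0) b (u 0 k0) * e.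
  move/eqP: ux; rewrite (bigD1 k0) //= addr_eq0 => /eqP/(congr1 (A k0)).
  rewrite avN avM eA => ->.
  apply: (@le_trans _ _ (\sum_(k | k != k0) A k0 (i (u 0 k) * x k))).
    elim/big_ind2 : _ => [|y1 y2 z1 z2 h1 h2|//]; first by rewrite av0.
    by rewrite (le_trans (avD _ _ _)) // lerD.
  by apply: ler_sum => k kk; rewrite avM eA ler_pM ?av_ge0 // ltW // xk.
rewrite -mulr_sumr ler_pM2l // sumr_const.
have -> : #|[pred k : 'I_m | k != k0]| = m.-1.
  by rewrite cardC1 card_ord.
have := av_dist (A k0) (x k0) 1; rewrite av1 ler_norml.
have : e *+ m.+1 = 1 by rewrite -mulr_natl divff.
rewrite -{1}(prednK m0) !mulrS; lra.
Qed.

End Approximation.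

Section FinitePlaces.
Context {R : realType}.

Lemma infinite_set_inj (T : Type) (A : set T) : infinite_set A ->
  exists2 f : nat -> T, injective f & forall n, A (f n).
Proof.
move=> /infiniteP/card_leP[f].
exists (fun n => val (f (exist _ n (mem_set I)))) => [m n /val_inj fmn|n].
  by have /= := inj (mem_set I) (mem_set I) fmn => -[].
by case: (f _) => x /= /set_mem.
Qed.

Lemma finite_places_above (K L : fieldType) (i : {rmorphism K -> L})
    (v : place R K) : finite_ext i ->
  finite_set [set w : place R L | lies_over i w v].
Proof.
move=> fin; have alg := finite_ext_algebraic fin; have [s spans] := fin.
apply: contrapT => /infinite_set_inj[f injf fv].
pose nK (p : place R K) := projT1 (cid (place_inhabited p)).
have nKin p : val p (nK p) by rewrite /nK; case: cid.
pose A (k : 'I_(size s).+1) := place_av nK i (f k).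
suff : ((size s).+1 <= size s)%N by rewrite ltnn.
apply: (extensions_le_dim (place_nontrivial (nKin v)) spans (A := A)).
  move=> j k Ajk; apply/val_inj/injf; apply: (@place_eq _ _ _ _ (A j)).
    exact: place_av_in.
  by rewrite Ajk; exact: place_av_in.
by move=> k c; exact: (place_avE alg nKin (fv k)).
Qed.
End FinitePlaces.

(** * Extending an absolute value to an algebraic extension *)

Section InfLemmas.
Context {R : realType}.
Implicit Types (S T : set R) (t : R).

Lemma inf_le S a : (forall a, S a -> 0 <= a) -> S a -> inf S <= a.
Proof. by move=> S0 Sa; apply: ge_inf => //; exists 0 => ? /S0. Qed.

Lemma le_inf_add S T t : S !=set0 -> T !=set0 ->
  (forall a b, S a -> T b -> t <= a + b) -> t <= inf S + inf T.
Proof.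
move=> S0 T0 H; rewrite -lerBlDr; apply: lb_le_inf => // a Sa.
by rewrite lerBlDr addrC -lerBlDr; apply: lb_le_inf => // b Tb; rewrite lerBlDr addrC; exact: H.
Qed.

Lemma le_inf_mul S T t : S !=set0 -> T !=set0 ->
  (forall a, S a -> 0 <= a) -> (forall b, T b -> 0 <= b) ->
  (forall a b, S a -> T b -> t <= a * b) -> t <= inf S * inf T.
Proof.
move=> S0 T0 Sp Tp H.
have iS : 0 <= inf S by apply: lb_le_inf.
have iT : 0 <= inf T by apply: lb_le_inf.
have step a : S a -> t <= a * inf T.
  move=> Sa; have [a0|a0] := eqVneq a 0.
    by have [b Tb] := T0; have := H a b Sa Tb; rewrite a0 !mul0r.
  have a1 : 0 < a by rewrite lt_neqAle eq_sym a0 Sp.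
  rewrite mulrC -ler_pdivrMr //; apply: lb_le_inf => // b Tb.
  by rewrite ler_pdivrMr // mulrC H.
have [b0|b0] := eqVneq (inf T) 0.
  by have [a Sa] := S0; have := step a Sa; rewrite b0 !mulr0.
have b1 : 0 < inf T by rewrite lt_neqAle eq_sym b0.
rewrite -ler_pdivrMr //; apply: lb_le_inf => // a Sa.
by rewrite ler_pdivrMr // step.
Qed.
End InfLemmas.

Section Extension.
Context {R : realType} {K E : fieldType} (i : {rmorphism K -> E}).
Variable b : absval R K.

(** The number [al] bounds the growth rate of the powers of [x], measured by
    coordinates on some finite family; leaving the family free to vary makes such
    bounds multiply and add. Their infimum is a spectral radius of [x]. *)
Definition power_bound (x : E) (al : R) := exists (J : finType) (s : J -> E) (C : R),
  0 <= C /\ forall n, exists2 c : J -> K, x ^+ n = \sum_j i (c j) * s j &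
                       forall j, b (c j) <= C * al ^+ n.

Lemma power_boundM x y al be : 0 <= al -> 0 <= be ->
  power_bound x al -> power_bound y be -> power_bound (x * y) (al * be).
Proof.
move=> al0 be0 [J [s [C [C0 hx]]]] [J' [s' [C' [C'0 hy]]]].
exists (J * J')%type, (fun p => s p.1 * s' p.2), (C * C').
split=> [|n]; first by rewrite mulr_ge0.
have [c cE cb] := hx n; have [d dE db] := hy n.
exists (fun p => c p.1 * d p.2) => [|[j k]].
  rewrite exprMn cE dE mulr_suml -(pair_bigA _ (fun j k => i (c j * d k) * (s j * s' k))) /=.
  apply: eq_bigr => j _; rewrite mulr_sumr; apply: eq_bigr => k _.
  by rewrite rmorphM mulrACA.
by rewrite avM exprMn mulrACA ler_pM ?av_ge0.
Qed.

Lemma power_boundD x y al be : 0 <= al -> 0 <= be ->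
  power_bound x al -> power_bound y be -> power_bound (x + y) (al + be).
Proof.
move=> al0 be0 [J [s [C [C0 hx]]]] [J' [s' [C' [C'0 hy]]]].
exists (J * J')%type, (fun p => s p.1 * s' p.2), (C * C').
split=> [|n]; first by rewrite mulr_ge0.
have /choice[c hc] : forall n, exists c : J -> K,
    x ^+ n = \sum_j i (c j) * s j /\ forall j, b (c j) <= C * al ^+ n.
  by move=> m; have [c] := hx m; exists c.
have /choice[d hd] : forall n, exists c : J' -> K,
    y ^+ n = \sum_j i (c j) * s' j /\ forall j, b (c j) <= C' * be ^+ n.
  by move=> m; have [e] := hy m; exists e.
exists (fun p => \sum_(k < n.+1) c (n - k)%N p.1 * d k p.2 * 'C(n, k)%:R).
  rewrite exprDn.
  under [RHS]eq_bigr => p _ do rewrite rmorph_sum mulr_suml.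
  rewrite [RHS]exchange_big /=; apply: eq_bigr => k _.
  have [-> _] := hc (n - k)%N; have [-> _] := hd k.
  rewrite mulr_suml -(pair_bigA _ (fun j l => i (c (n - k)%N j * d k l * 'C(n, k)%:R) * (s j * s' l))) /=.
  rewrite -mulr_natl mulr_sumr; apply: eq_bigr => j _.
  rewrite !mulr_sumr; apply: eq_bigr => l _.
  by rewrite !rmorphM rmorph_nat; ring.
move=> p; rewrite (le_trans (av_sum _ _)) // exprDn mulr_sumr ler_sum // => k _.
rewrite !avM -[X in _ <= _ * X]mulr_natr mulrA ler_pM ?mulr_ge0 ?av_ge0 ?av_nat //.
rewrite mulrACA ler_pM ?av_ge0 //.
  by have [_] := hc (n - k)%N; apply.
by have [_] := hd k; apply.
Qed.

(** The powers of [x] are those of [x ^+ 2] times [1] or [x]; the constant [C / al]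
    accounts for the odd ones. *)
Lemma power_bound_sqr x al : 0 < al ->
  power_bound (x ^+ 2) (al ^+ 2) -> power_bound x al.
Proof.
move=> al0 [J [s [C [C0 hx]]]].
exists (bool * J)%type, (fun p : bool * J => x ^+ (p.1 : nat) * s p.2),
  (C + C / al).
have Ca0 : 0 <= C / al by rewrite divr_ge0 // ltW.
split=> [|n]; first by rewrite addr_ge0.
have [c cE cb] := hx n./2.
exists (fun p : bool * J => if p.1 == odd n then c p.2 else 0) => [|[e j] /=].
  rewrite -(pair_bigA _ (fun e j => i (if e == odd n then c j else 0) * (x ^+ (e : bool) * s j))) /=.
  rewrite (bigD1 (odd n)) //= eqxx [X in _ + X]big1 ?addr0; last first.
    by move=> e /negbTE ->; rewrite big1 // => j _; rewrite rmorph0 mul0r.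
  under eq_bigr => j _ do rewrite mulrCA.
  by rewrite -mulr_sumr -cE -exprM mul2n -exprD odd_double_half.
case: ifP => [/eqP _|_]; last by rewrite av0 mulr_ge0 ?addr_ge0 ?exprn_ge0 // ltW.
apply: (le_trans (cb j)); rewrite -exprM mul2n -{2}(odd_double_half n) exprD mulrA.
rewrite ler_wpM2r ?exprn_ge0 ?(ltW al0) //; case: (odd n) => /=.
  by rewrite expr1 mulrDl divfK ?gt_eqF // lerDr mulr_ge0 // ltW.
by rewrite expr0 mulr1 lerDl.
Qed.

Lemma power_bound_cst c al : b c <= al -> power_bound (i c) al.
Proof.
move=> bc; exists unit, (fun=> 1), 1; split=> // n.
exists (fun=> c ^+ n) => [|_]; first by rewrite big_const card_unit /= addr0 mulr1 rmorphXn.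
by rewrite mul1r avX lerXn2r // ?nnegrE ?av_ge0 // (le_trans (av_ge0 _ _) bc).
Qed.

(** Reduced modulo an annihilating polynomial, multiplication by [x] acts on
    coordinates by a fixed matrix [A], whose entries sum to [S] in absolute value. *)
Lemma power_bound_algebraic x : algebraicOver i x ->
  exists2 al, 0 < al & power_bound x al.
Proof.
move=> [p p0 px]; pose d := (size p).-1.
have span (g : {poly K}) : (map_poly i g).[x] = \sum_(k < d) i (g %% p)`_k * x ^+ k.
  rewrite {1}(divp_eq g p) rmorphD rmorphM hornerD hornerM /= (rootP px) mulr0 add0r.
  rewrite (@horner_coef_wide _ d) ?size_map_poly.
    by apply: eq_bigr => k _; rewrite coef_map.
  by rewrite -ltnS /d prednK ?ltn_modp // lt0n size_poly_eq0.
pose A (j k : 'I_d) := ('X^(j.+1) %% p)`_k.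
pose S := \sum_(j < d) \sum_(k < d) b (A j k).
pose C0 := \sum_(k < d) b (1 %% p)`_k.
have S0 : 0 <= S by apply: sumr_ge0 => j _; apply: sumr_ge0 => k _; exact: av_ge0.
have C00 : 0 <= C0 by apply: sumr_ge0 => j _; exact: av_ge0.
exists (S + 1); first by rewrite ltr_wpDl.
exists 'I_d, (fun k : 'I_d => x ^+ k), C0; split=> //.
elim=> [|n [c cE cb]].
  exists (fun k : 'I_d => (1 %% p)`_k) => [|k].
    by rewrite -span rmorph1 hornerC.
  by rewrite expr0 mulr1 /C0 (bigD1 k) //= lerDl sumr_ge0 // => j _; exact: av_ge0.
exists (fun k => \sum_j c j * A j k) => [|k].
  rewrite exprS cE mulr_sumr.
  under [RHS]eq_bigr => k _ do rewrite rmorph_sum mulr_suml.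
  rewrite [RHS]exchange_big /=; apply: eq_bigr => j _.
  rewrite mulrCA -exprS.
  have := span 'X^(j.+1); rewrite map_polyXn hornerXn => ->.
  by rewrite mulr_sumr; apply: eq_bigr => k _; rewrite rmorphM mulrA.
rewrite exprS mulrCA (le_trans (av_sum _ _)) //.
apply: (@le_trans _ _ (S * (C0 * (S + 1) ^+ n))); last first.
  by rewrite ler_wpM2r ?mulr_ge0 ?exprn_ge0 ?addr_ge0 // lerDl.
rewrite mulr_suml ler_sum // => j _; rewrite avM mulrC ler_pM ?av_ge0 //.
by rewrite (bigD1 k) //= lerDl sumr_ge0 // => l _; exact: av_ge0.
Qed.

(** A nonzero vector has no representations with arbitrarily small coordinates,
    even on a linearly dependent family. This keeps the spectral radius of [1]
    from being less than [1], hence the seminorm from being zero. *)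
Lemma coordinate_lower_bound (m : nat) (s : nat -> E) (u : E) : u != 0 ->
  exists2 de : R, 0 < de & forall c : nat -> K,
    u = \sum_(j < m) i (c j) * s j -> exists2 j : nat, (j < m)%N & de <= b (c j).
Proof.
elim: m u => [|m IH] u u0.
  by exists 1 => // c; rewrite big_ord0 => uE; rewrite uE eqxx in u0.
have [[d sE]|nsp] := pselect (exists d : nat -> K, s m = \sum_(j < m) i (d j) * s j).
  (* Substituting for [s m] turns the coordinates into [c m * d j + c j]. One of
     these is at least [de], so [c m] or [c j] is at least [de / (B + 1)], where
     [B] bounds the [d j]. *)
  have [de de0 hde] := IH u u0.
  pose B := 1 + \sum_(j < m) b (d j).
  have B1 : 1 <= B by rewrite lerDl sumr_ge0 // => j _; exact: av_ge0.
  have B0 := lt_le_trans ltr01 B1.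
  exists (de / (B + 1)) => [|c uE]; first by rewrite divr_gt0 // addr_gt0.
  have [|j jm dej] := hde (fun j => c m * d j + c j).
    rewrite uE big_ord_recr /= sE mulr_sumr addrC -big_split /=.
    by apply: eq_bigr => j _; rewrite rmorphD rmorphM mulrDl mulrA.
  have dB : b (d j) <= B.
    rewrite /B (bigD1 (Ordinal jm)) //= addrCA lerDl addr_ge0 // sumr_ge0 // => l _.
    exact: av_ge0.
  have [cm|cm] := lerP (de / (B + 1)) (b (c m)); first by exists m.
  exists j; first by rewrite ltnS ltnW.
  have e1 := avD b (c m * d j) (c j); rewrite avM in e1.
  have e2 : b (c m) * b (d j) <= de / (B + 1) * B by rewrite ler_pM ?av_ge0 // ltW.
  have e3 : de = de / (B + 1) * B + de / (B + 1).
    by field; rewrite gt_eqF // addr_gt0.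
  lra.
(* Now [s m] is independent of the others, so all representations of [u] share
   the coordinate at [s m]. *)
have [[c0 [c0m c0E]]|nc] := pselect (exists c0 : nat -> K, c0 m != 0 /\
    u = \sum_(j < m.+1) i (c0 j) * s j).
  exists (b (c0 m)) => [|c uE]; first exact: av_gt0.
  exists m => //; have -> // : c m = c0 m.
  apply/eqP; rewrite -subr_eq0; apply: contrapT => /negP cm.
  apply: nsp; exists (fun j => (c0 j - c j) / (c m - c0 m)).
  have icm : i (c m - c0 m) != 0 by rewrite fmorph_eq0.
  apply: (mulfI icm); rewrite mulr_sumr.
  have : i (c m - c0 m) * s m = \sum_(j < m) i (c0 j - c j) * s j.
    move/eqP: uE; rewrite c0E !big_ord_recr /= eq_sym -subr_eq0 opprD addrACA.
    rewrite -mulrBl -rmorphB addrC addr_eq0 => /eqP ->.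
    rewrite -sumrB -sumrN; apply: eq_bigr => j _.
    by rewrite rmorphB mulrBl opprB.
  move=> ->; apply: eq_bigr => j _.
  by rewrite rmorphM fmorphV mulrA [in RHS]mulrA [X in _ = X / _ * _]mulrC mulfK.
have [de de0 hde] := IH u u0; exists de => // c uE.
have cm : c m = 0 by apply/eqP/negPn/negP => cm; apply: nc; exists c.
have [|j jm dej] := hde c; last by exists j => //; rewrite ltnS ltnW.
by rewrite uE big_ord_recr /= cm rmorph0 mul0r addr0.
Qed.

Lemma power_bound1 al : 0 < al -> power_bound 1 al -> 1 <= al.
Proof.
move=> al0 [J [s [C [C0 h]]]]; rewrite leNgt; apply/negP => al1.
have [n0|n0] := posnP #|J|.
  have [c] := h 0%N; rewrite expr1n big1 => [/eqP|j]; first by rewrite oner_eq0.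
  by have := fintype0 j n0.
have [j0] : exists j0 : J, true by move/card_gt0P: n0 => [j _]; exists j.
move=> _.
have [de de0 hde] := @coordinate_lower_bound #|J|
  (fun k => s (nth j0 (enum J) k)) 1 (oner_neq0 E).
have [|N hN] := @expr_lt_eventually _ al (de / (C + 1)) (ltW al0) al1.
  by rewrite divr_gt0 // ltr_wpDl.
have [c cE cb] := h N.
have [|j _] := hde (fun k => c (nth j0 (enum J) k)).
  rewrite -(expr1n _ N) cE (reindex (@enum_val J J)) /=; last first.
    by apply: onW_bij; exact: enum_val_bij.
  by apply: eq_bigr => k _; rewrite (enum_val_nth j0).
apply/negP; rewrite -ltNge; apply: le_lt_trans (cb _) _.
have := hN N (leqnn _); rewrite ltr_pdivlMr ?ltr_wpDl // => lt1.
by apply: le_lt_trans lt1; rewrite mulrC ler_wpM2l ?exprn_ge0 ?(ltW al0) // lerDl.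
Qed.

Definition seminorm (N : E -> R) := [/\ forall x, 0 <= N x,
  forall x y, N (x + y) <= N x + N y,
  forall x y, N (x * y) <= N x * N y,
  forall x, N x ^+ 2 <= N (x ^+ 2) &
  1 <= N 1 /\ forall c, N (i c) <= b c].

Lemma seminorm_exists : algebraic_ext i -> exists N, seminorm N.
Proof.
move=> alg; pose S x := [set al : R | 0 < al /\ power_bound x al].
have Sp x al : S x al -> 0 <= al by case=> /ltW.
have S0 x : S x !=set0 by have [al] := power_bound_algebraic (alg x); exists al.
exists (fun x => inf (S x)); split=> [x|x y|x y|x|].
- by apply: lb_le_inf => // al /Sp.
- apply: le_inf_add => // al be [al0 hx] [be0 hy].
  apply: inf_le => //; first exact: Sp.
  by split; [rewrite addr_gt0 | apply: power_boundD; rewrite ?ltW].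
- apply: le_inf_mul => //; [exact: Sp|exact: Sp|move=> al be [al0 hx] [be0 hy]].
  apply: inf_le => //; first exact: Sp.
  by split; [rewrite mulr_gt0 | apply: power_boundM; rewrite ?ltW].
- apply: lb_le_inf => // al [al0 hx].
  have := sqr_sqrtr (ltW al0) => alE.
  have s0 : 0 < Num.sqrt al by rewrite sqrtr_gt0.
  rewrite -alE lerXn2r ?nnegrE ?(ltW s0) //.
    by apply: lb_le_inf => // be /Sp.
  apply: inf_le; first exact: Sp.
  by split=> //; apply: power_bound_sqr; rewrite ?alE.
- split; first by apply: lb_le_inf => // al [al0]; exact: power_bound1.
  move=> c; apply/ler_addgt0Pr => e e0; apply: inf_le; first exact: Sp.
  split; first by rewrite ltr_wpDl ?av_ge0.
  by apply: power_bound_cst; rewrite lerDl ltW.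
Qed.

(** Infima are taken twice below: over a chain of seminorms, and over a decreasing
    sequence of functions whose members satisfy the multiplicative axioms only
    relative to later members. Hence the indices [l] in the hypotheses. *)
Lemma seminorm_inf (I : Type) (t : I -> E -> R) (i0 : I) :
  (forall k x, 0 <= t k x) ->
  (forall j k, exists l, forall x, t l x <= t j x /\ t l x <= t k x) ->
  (forall k x y, t k (x + y) <= t k x + t k y) ->
  (forall k, exists l, forall x y, t l (x * y) <= t k x * t k y) ->
  (forall k, exists l, forall x, t l x ^+ 2 <= t k (x ^+ 2)) ->
  (forall k, 1 <= t k 1) -> (forall c, t i0 (i c) <= b c) ->
  seminorm (fun x => inf (range (t^~ x))).
Proof.
move=> t0 tdir tD tM tX t1 tb.
have T0 x : range (t^~ x) !=set0 by exists (t i0 x), i0.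
have Tp x y : range (t^~ x) y -> 0 <= y by move=> [k _ <-].
have le k x : inf (range (t^~ x)) <= t k x by apply: inf_le; [exact: Tp|exists k].
split=> [x|x y|x y|x|].
- by apply: lb_le_inf => // _ [k _ <-].
- apply: le_inf_add => // _ _ [j _ <-] [k _ <-].
  have [l hl] := tdir j k; apply: (le_trans (le l _)); apply: (le_trans (tD _ _ _)).
  by apply: lerD; [have [] := hl x|have [] := hl y].
- apply: le_inf_mul => //; [exact: Tp|exact: Tp|move=> _ _ [j _ <-] [k _ <-]].
  have [l hl] := tdir j k; have [l' hl'] := tM l.
  apply: (le_trans (le l' _)); apply: (le_trans (hl' _ _)).
  by apply: ler_pM => //; [have [] := hl x|have [] := hl y].
- apply: lb_le_inf => // _ [k _ <-]; have [l hl] := tX k.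
  apply: le_trans (hl _); rewrite lerXn2r ?nnegrE //.
  by apply: lb_le_inf => // _ [j _ <-].
- split; first by apply: lb_le_inf => // _ [k _ <-].
  by move=> c; exact: le_trans (le i0 _) (tb c).
Qed.

Lemma minimal_seminorm : algebraic_ext i ->
  exists2 N, seminorm N & forall M, seminorm M -> (forall x, M x <= N x) -> M = N.
Proof.
move=> alg; have [N0 hN0] := seminorm_exists alg.
pose T := {N : E -> R | seminorm N}.
pose le (N M : T) := `[< forall x, sval M x <= sval N x >].
have [|||A Atot|[N hN] Nmin] := @Zorn T le.
- by move=> N; apply/asboolP.
- move=> N M P /asboolP NM /asboolP MP; apply/asboolP => x.
  exact: le_trans (MP x) (NM x).
- move=> [N hN] [M hM] /asboolP /= NM /asboolP /= MN; apply: eq_exist; apply/funext => x.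
  by apply/le_anti; rewrite NM MN.
- have [[N AN]|nA] := pselect (A !=set0); last first.
    by exists (exist _ N0 hN0) => N AN; exfalso; apply: nA; exists N.
  pose I := {M : T | A M}.
  pose t (M : I) := sval (sval M).
  have hM : seminorm (fun x => inf (range (t^~ x))).
    have tS (M : I) : seminorm (t M) by exact: svalP (sval M).
    apply: (@seminorm_inf I t (exist _ N AN)).
    + by move=> k x; have [] := tS k.
    + move=> [j Aj] [k Ak]; have [/asboolP h|/asboolP h] := Atot j k Aj Ak.
        by exists (exist _ k Ak) => x; split; [exact: h|].
      by exists (exist _ j Aj) => x; split; [|exact: h].
    + by move=> k x y; have [] := tS k.
    + by move=> k; exists k => x y; have [] := tS k.
    + by move=> k; exists k => x; have [] := tS k.
    + by move=> k; have [_ _ _ _ []] := tS k.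
    + by move=> c; have [_ _ _ _ [_]] := tS (exist _ N AN); apply.
  exists (exist _ _ hM) => M AM; apply/asboolP => x /=.
  apply: inf_le; last by exists (exist _ M AM).
  by move=> _ [[P AP] _ <-] /=; have [h _ _ _ _] := svalP P; exact: h.
exists N => // M hM MN.
by have /(congr1 sval) := Nmin (exist _ M hM) (introT (asboolP _) MN).
Qed.

(** As in the proof that the Berkovich spectrum of a Banach algebra is nonempty:
    for [f] nonzero, [x |-> inf_k N (x f^(2^k)) / N f ^ (2^k)] is a seminorm below
    the minimal one [N], hence equal to it, whence [N x * N f <= N (x f)]. So [N]
    is multiplicative. *)
Lemma absval_extension : algebraic_ext i ->
  exists a : absval R E, forall c, a (i c) = b c.
Proof.
move=> alg; have [N hN Nmin] := minimal_seminorm alg.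
have [N0 ND NM NX [N1 Nb]] := hN.
have N1E : N 1 = 1 by apply/le_anti; rewrite N1 -(rmorph1 i) -(av1 b) Nb.
have Ngt0 f : f != 0 -> 0 < N f.
  move=> f0; rewrite lt_neqAle N0 andbT eq_sym; apply/eqP => Nf.
  by have := NM f f^-1; rewrite mulfV // Nf mul0r leNgt (lt_le_trans ltr01).
have NXn f k : N (f ^+ (2 ^ k)) = N f ^+ (2 ^ k).
  elim: k => [|k IH]; first by rewrite expn0 !expr1.
  rewrite expnSr !exprM -IH; apply/le_anti; rewrite NX andbT expr2 -expr2.
  by rewrite [X in N X]expr2 [leRHS]expr2 NM.
have NMeq x f : f != 0 -> N x * N f <= N (x * f).
  move=> f0; have Nf := Ngt0 _ f0.
  pose t k x := N (x * f ^+ (2 ^ k)) / N f ^+ (2 ^ k).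
  have Nfk k : 0 < N f ^+ (2 ^ k) by rewrite exprn_gt0.
  have tS k y : t k.+1 y <= t k y.
    rewrite /t expnSr muln2 -addnn !exprD ler_pdivrMr ?mulr_gt0 //.
    rewrite [leRHS]mulrA divfK ?gt_eqF // [X in N X]mulrA -[X in _ <= _ * X]NXn; exact: NM.
  have tle j k y : (j <= k)%N -> t k y <= t j y.
    move=> /subnK <-; elim: (k - j)%N => [|n IH] //.
    by rewrite addSn (le_trans (tS _ _)).
  have t0le y : t 0%N y <= N y.
    by rewrite /t expn0 !expr1 ler_pdivrMr.
  have ht : seminorm (fun x => inf (range (t^~ x))).
    apply: (@seminorm_inf _ t 0%N).
    - by move=> k y; rewrite divr_ge0 // ltW.
    - by move=> j k; exists (maxn j k) => y; split; apply: tle; rewrite ?leq_maxl ?leq_maxr.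
    - by move=> k y z; rewrite /t -mulrDl [X in N X]mulrDl ler_wpM2r ?invr_ge0 ?(ltW (Nfk k)).
    - move=> k; exists k.+1 => y z.
      rewrite /t expnSr muln2 -addnn !exprD [X in N X]mulrACA [leRHS]mulrACA -invfM.
      by rewrite ler_wpM2r ?invr_ge0 ?mulr_ge0 ?(ltW (Nfk k)).
    - move=> k; exists k => y.
      apply: le_trans (tS k _); rewrite /t expnSr !exprM expr_div_n -exprMn.
      by rewrite ler_wpM2r ?invr_ge0 ?sqr_ge0.
    - by move=> k; rewrite /t mul1r NXn divff ?gt_eqF.
    - by move=> c; exact: le_trans (t0le _) (Nb c).
  have tN : (fun x => inf (range (t^~ x))) = N.
    apply: Nmin => // y; apply: le_trans (t0le y).
    by apply: inf_le => [_ [k _ <-]|]; [rewrite divr_ge0 // ltW | exists 0%N].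
  have : N x <= t 0%N x.
    rewrite -[in leLHS]tN; apply: inf_le => [_ [k _ <-]|]; last by exists 0%N.
    by rewrite divr_ge0 // ltW.
  by rewrite /t expn0 !expr1 ler_pdivlMr.
have NME x y : N (x * y) = N x * N y.
  have [->|y0] := eqVneq y 0; last by apply/le_anti; rewrite NM NMeq.
  have N00 : N 0 = 0 by apply/le_anti; rewrite N0 andbT -(rmorph0 i) -(av0 b) Nb.
  by rewrite mulr0 N00 mulr0.
have Neq0 x : N x = 0 <-> x = 0.
  split=> [Nx|->]; last by apply/le_anti; rewrite N0 andbT -(rmorph0 i) -(av0 b) Nb.
  by apply/eqP/negPn/negP => /Ngt0; rewrite Nx ltxx.
exists (AbsVal N0 Neq0 NME ND) => c /=.
have [->|c0] := eqVneq c 0; first by rewrite rmorph0 av0; apply/Neq0.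
apply/le_anti; rewrite Nb /=.
have := Nb c^-1; rewrite fmorphV avV.
have -> : N (i c)^-1 = (N (i c))^-1.
  have Nc : N (i c) != 0 by rewrite gt_eqF // Ngt0 // fmorph_eq0.
  by apply: (mulfI Nc); rewrite -NME !divff // fmorph_eq0.
by rewrite lef_pV2 // posrE ?av_gt0 // Ngt0 // fmorph_eq0.
Qed.
End Extension.

(** * Finite Galois subextensions *)

Section Polynomials.

Lemma dvdp_split_root (E : fieldType) (g q : {poly E}) (s : seq E) :
  g %| q -> q %= \prod_(z <- s) ('X - z%:P) -> (1 < size g)%N ->
  exists2 z, z \in s & root g z.
Proof.
move=> gq qs; rewrite (eqp_dvdr _ qs) in gq.
have [m gm] := dvdp_prod_XsubC gq; rewrite (eqp_size gm).
case E1: (mask m s) => [|z s']; first by rewrite big_nil size_poly1.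
move=> _; exists z; first by apply: (mem_mask (m := m)); rewrite E1 mem_head.
by rewrite (eqp_root gm) root_prod_XsubC E1 mem_head.
Qed.

(** At [w], the polynomial [sub_annihilant p q] takes the value of the resultant
    of [p (X + w)] and [q], so these two have a common factor, and a common root
    because [q] splits. *)
Lemma sub_annihilant_root (F E : fieldType) (f : {rmorphism F -> E})
    (p q : {poly F}) (s : seq E) (w : E) :
  p != 0 -> q != 0 -> map_poly f q %= \prod_(z <- s) ('X - z%:P) ->
  root (map_poly f (sub_annihilant p q)) w ->
  exists x y, [/\ root (map_poly f p) x, root (map_poly f q) y & w = x - y].
Proof.
move=> p0 q0 qs; pose g : {rmorphism {poly F} -> E} := horner_eval w \o map_poly f.
rewrite -[root _ w]/(g _ == 0) /sub_annihilant map_resultant; last 2 first.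
- rewrite lead_coef_poly_XaY /= /horner_eval /= map_polyC hornerC fmorph_eq0.
  by rewrite lead_coef_eq0.
- rewrite lead_coef_map_inj; [|exact: polyC_inj|by []].
  by rewrite /= /horner_eval /= map_polyC hornerC fmorph_eq0 lead_coef_eq0.
have gC (u : {poly F}) : map_poly g u^:P = map_poly f u.
  rewrite -map_poly_comp; apply: eq_map_poly => c /=.
  by rewrite /horner_eval /= map_polyC hornerC.
have gX : g 'X = w by rewrite /g /= /horner_eval /= map_polyX hornerX.
have -> : map_poly g (poly_XaY p) = map_poly f p \Po ('X + w%:P).
  by rewrite /poly_XaY map_comp_poly gC rmorphD; congr (_ \Po (_ + _));
    [exact: map_polyX|apply: etrans (map_polyC _ _) (congr1 polyC gX)].
rewrite gC.
rewrite resultant_eq0 => /(dvdp_split_root (dvdp_gcdr _ _) qs)[y ys].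
rewrite root_gcd => /andP[py qy]; exists (y + w), y; split=> //.
  by move: py; rewrite root_comp !hornerE.
by rewrite addrAC subrr add0r.
Qed.

(** As for differences, with [p (X * w)] in place of [p (X + w)]. *)
Lemma div_annihilant_root (F E : fieldType) (f : {rmorphism F -> E})
    (p q : {poly F}) (s : seq E) (w : E) :
  p != 0 -> q != 0 -> map_poly f q %= \prod_(z <- s) ('X - z%:P) -> w != 0 ->
  root (map_poly f q) 0 = false ->
  root (map_poly f (div_annihilant p q)) w ->
  exists x y, [/\ root (map_poly f p) x, root (map_poly f q) y & w = x / y].
Proof.
move=> p0 q0 qs w0 q00.
pose g : {rmorphism {poly F} -> E} := horner_eval w \o map_poly f.
rewrite -[root (map_poly f (div_annihilant p q)) w]/(g _ == 0) /div_annihilant map_resultant; last 2 first.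
- have s2 : (1 < size (('X * 'X%:P)%R : {poly {poly F}}))%N.
    by rewrite size_XmulC ?polyX_eq0.
  rewrite lead_coef_comp // rmorphM rmorphXn mulf_neq0 ?expf_neq0 //.
    rewrite lead_coef_map_inj; [|exact: polyC_inj|by []].
    by rewrite /= /horner_eval /= map_polyC hornerC fmorph_eq0 lead_coef_eq0.
  by rewrite lead_coefM lead_coefX lead_coefC mul1r /= /horner_eval /= map_polyX hornerX.
- rewrite lead_coef_map_inj; [|exact: polyC_inj|by []].
  by rewrite /= /horner_eval /= map_polyC hornerC fmorph_eq0 lead_coef_eq0.
have gC (u : {poly F}) : map_poly g u^:P = map_poly f u.
  rewrite -map_poly_comp; apply: eq_map_poly => c /=.
  by rewrite /horner_eval /= map_polyC hornerC.
have gX : g 'X = w by rewrite /g /= /horner_eval /= map_polyX hornerX.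
have -> : map_poly g (poly_XmY p) = map_poly f p \Po ('X * w%:P).
  by rewrite /poly_XmY map_comp_poly gC rmorphM; congr (_ \Po (_ * _));
    [exact: map_polyX|apply: etrans (map_polyC _ _) (congr1 polyC gX)].
rewrite gC.
rewrite resultant_eq0 => /(dvdp_split_root (dvdp_gcdr _ _) qs)[y ys].
rewrite root_gcd => /andP[py qy]; exists (y * w), y; split=> //.
  by move: py; rewrite root_comp !hornerE.
by rewrite mulrAC divff ?mul1r //; apply: contraFneq q00 => <-.
Qed.

Lemma minimal_poly_exists (K L : fieldType) (i : {rmorphism K -> L}) x :
  algebraicOver i x -> exists p, minimal_poly i x p.
Proof.
move=> [p0 p00 p0x].
pose P n := `[< exists p : {poly K}, [/\ p != 0, root (map_poly i p) x & size p = n] >].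
have exP : exists n, P n by exists (size p0); apply/asboolP; exists p0.
have [n /asboolP[p [p1 px sp]] nmin] := ex_minnP exP.
exists ((lead_coef p)^-1 *: p); split.
- by rewrite monicE lead_coefZ mulVf // lead_coef_eq0.
- by rewrite map_polyZ rootZ // fmorph_eq0 invr_eq0 lead_coef_eq0.
move=> q qx; rewrite dvdpZl ?invr_eq0 ?lead_coef_eq0 //.
apply/modp_eq0P/eqP/negPn/negP => r0.
have rx : root (map_poly i (q %% p)) x.
  move: qx; rewrite {1}(divp_eq q p) rmorphD rmorphM /root hornerD hornerM /=.
  by rewrite (rootP px) mulr0 add0r.
have : (n <= size (q %% p)%R)%N by apply: nmin; apply/asboolP; exists (q %% p).
by rewrite -sp leqNgt ltn_modp p1.
Qed.

Lemma root_map_comp (K L M : fieldType) (i : {rmorphism K -> L})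
    (j : {rmorphism L -> M}) (k : {rmorphism K -> M}) (p : {poly K}) x :
  (forall c, k c = j (i c)) ->
  root (map_poly k p) (j x) = root (map_poly i p) x.
Proof.
move=> kE; rewrite -(fmorph_root j) -map_poly_comp; congr root.
by apply: eq_map_poly => c; rewrite kE.
Qed.

Lemma minimal_poly_comp (K L M : fieldType) (i : {rmorphism K -> L})
    (j : {rmorphism L -> M}) (k : {rmorphism K -> M}) (p : {poly K}) x :
  (forall c, k c = j (i c)) ->
  minimal_poly i x p <-> minimal_poly k (j x) p.
Proof.
move=> kE; have H q := root_map_comp q x kE.
by split=> -[pm px pmin]; split=> [//||q]; rewrite ?H // -?H //; move=> h; apply: pmin; rewrite ?H // -H.
Qed.

End Polynomials.

Section FiniteExt.

Lemma finite_extP (K L : fieldType) (i : {rmorphism K -> L}) :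
  finite_ext i <-> exists (J : finType) (s : J -> L), forall x : L,
    exists c : J -> K, x = \sum_j i (c j) * s j.
Proof.
split=> [[s H]|[J [s H]]]; first by exists 'I_(size s), (fun j : 'I_(size s) => s`_j).
pose t := [seq s j | j <- enum J].
have st : size t = #|J| by rewrite size_map -cardE.
exists t => x; have [c ->] := H x.
exists (fun k => c (enum_val (cast_ord st k))).
rewrite (reindex (@enum_val J J)) /=; last by apply: onW_bij; exact: enum_val_bij.
rewrite (reindex (cast_ord st)) /=; last first.
  by exists (cast_ord (esym st)) => k _; rewrite ?cast_ordK ?cast_ordKV.
apply: eq_bigr => k _; congr (_ * _).
have [j0 _] : exists j : J, true by exists (enum_val (cast_ord st k)).
rewrite (nth_map j0) ?(enum_val_nth j0) //= -cardE -st //.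
Qed.

Lemma finite_ext_trans (K L M : fieldType) (i : {rmorphism K -> L})
    (j : {rmorphism L -> M}) (k : {rmorphism K -> M}) :
  (forall c, k c = j (i c)) -> finite_ext i -> finite_ext j -> finite_ext k.
Proof.
move=> kE /finite_extP[I [s hs]] /finite_extP[J [t ht]].
apply/finite_extP; exists (I * J)%type, (fun p => j (s p.1) * t p.2) => x.
have [c ->] := ht x.
have /choice[d hd] : forall l, exists d : I -> K, c l = \sum_m i (d m) * s m.
  by move=> l; exact: hs.
exists (fun p => d p.2 p.1).
rewrite -(pair_bigA _ (fun m l => k (d l m) * (j (s m) * t l))) /= exchange_big /=.
apply: eq_bigr => l _; rewrite hd rmorph_sum mulr_suml; apply: eq_bigr => m _.
by rewrite rmorphM kE mulrA.
Qed.

End FiniteExt.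

Section Subfields.
Context {E : fieldType}.
Implicit Types K L M : subfield E.

Lemma subfield1 M : (M : set E) 1.
Proof. by apply/set_mem; have [] := Defs.subfield_closed M. Qed.
Lemma subfieldB M x y : (M : set E) x -> (M : set E) y -> (M : set E) (x - y).
Proof.
move=> /mem_set hx /mem_set hy; apply/set_mem.
by have [_ h _] := Defs.subfield_closed M; exact: h.
Qed.
Lemma subfieldV M x y : (M : set E) x -> (M : set E) y -> (M : set E) (x / y).
Proof.
move=> /mem_set hx /mem_set hy; apply/set_mem.
by have [_ _ h] := Defs.subfield_closed M; exact: h.
Qed.
Lemma subfield0 M : (M : set E) 0.
Proof. by rewrite -(subrr 1); apply: subfieldB; exact: subfield1. Qed.
Lemma subfieldD M x y : (M : set E) x -> (M : set E) y -> (M : set E) (x + y).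
Proof.
move=> hx hy; rewrite -[y]opprK; apply: subfieldB => //.
by rewrite -sub0r; apply: subfieldB => //; exact: subfield0.
Qed.
Lemma subfieldM M x y : (M : set E) x -> (M : set E) y -> (M : set E) (x * y).
Proof.
move=> hx hy; rewrite -[y]invrK; apply: subfieldV => //.
by rewrite -div1r; apply: subfieldV => //; exact: subfield1.
Qed.

Definition sf_in M x (Mx : (M : set E) x) : subfield_type M := Sub x (mem_set Mx).

Lemma sf_val M (x : subfield_type M) : (M : set E) (val x).
Proof. exact: set_mem (valP x). Qed.

Lemma val_incl K L (KL : K `<=` L) (x : subfield_type K) :
  val x = val (incl_subfield KL x).
Proof. by []. Qed.

(** The range of the embedding into [E] of the abstract extension by [z]. *)
Lemma adjoin_root M z : algebraicOver (val : subfield_type M -> E) z ->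
  exists (M' : subfield E) (MM' : M `<=` M'),
    [/\ (M' : set E) z, finite_ext (incl_subfield MM') &
      forall N : subfield E, M `<=` N -> (N : set E) z -> M' `<=` N].
Proof.
move=> [p p0 pz].
pose T := subFExtend (val : {rmorphism subfield_type M -> E}) z p.
pose j : {rmorphism T -> E} := subfx_inj.
have jE (q : {poly subfield_type M}) :
    j (subfx_eval _ z p q) = (map_poly val q).[z] by exact: subfx_inj_eval.
have clos : divring_closed (mem (range j)).
  split; first by apply/mem_set; exists 1 => //; rewrite rmorph1.
    move=> x y /set_mem[u _ <-] /set_mem[v _ <-]; apply/mem_set.
    by exists (u - v) => //; rewrite rmorphB.
  move=> x y /set_mem[u _ <-] /set_mem[v _ <-]; apply/mem_set.
  by exists (u / v) => //; rewrite fmorph_div.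
pose M' := Subfield clos.
have M'P x : (M' : set E) x <-> exists q : {poly subfield_type M}, x = (map_poly val q).[z].
  split=> [[u _ <-]|[q ->]]; last by exists (subfx_eval _ z p q).
  by have [q ->] := subfxE u; exists q.
have MM' : M `<=` M'.
  move=> x Mx; apply/M'P; exists (sf_in Mx)%:P.
  by rewrite map_polyC hornerC.
exists M', MM'; split.
- by apply/M'P; exists 'X; rewrite map_polyX hornerX.
- have M'z (k : nat) : (M' : set E) (z ^+ k).
    by apply/M'P; exists 'X^k; rewrite map_polyXn hornerXn.
  apply/finite_extP; exists 'I_(size p), (fun k : 'I_(size p) => sf_in (M'z k)) => x.
  have /M'P[q xq] := sf_val x.
  exists (fun k : 'I_(size p) => (q %% p)`_k); apply: val_inj; rewrite xq rmorph_sum.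
  rewrite {1}(divp_eq q p) rmorphD rmorphM hornerD hornerM /= (rootP pz) mulr0 add0r.
  have sz : (size (map_poly (val : {rmorphism subfield_type M -> E}) (q %% p)) <= size p)%N.
    by rewrite size_map_poly ltnW // ltn_modpN0.
  rewrite (horner_coef_wide _ sz).
  by apply: eq_bigr => k _; rewrite coef_map.
- move=> N MN Nz x /M'P[q ->].
  rewrite horner_coef; elim/big_ind : _ => [|x1 x2|k _];
    [exact: subfield0|exact: subfieldD|].
  apply: subfieldM; first by rewrite coef_map; exact/MN/sf_val.
  elim: (k : nat) => [|m IH]; first by rewrite expr0; exact: subfield1.
  by rewrite exprS; exact: subfieldM.
Qed.

Lemma algebraicOver_up K M (KM : K `<=` M) z :
  algebraicOver (val : subfield_type K -> E) z ->
  algebraicOver (val : subfield_type M -> E) z.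
Proof.
move=> [p p0 pz]; exists (map_poly (incl_subfield KM) p).
  by rewrite map_poly_eq0.
by rewrite -map_poly_comp.
Qed.

Lemma finite_ext_id K (KK : K `<=` K) : finite_ext (incl_subfield KK).
Proof.
exists [:: 1] => x; exists (fun=> x); rewrite big_ord1 /= mulr1.
exact: val_inj.
Qed.

Lemma adjoin_seq K (zs : seq E) :
  (forall z, z \in zs -> algebraicOver (val : subfield_type K -> E) z) ->
  exists (M : subfield E) (KM : K `<=` M),
    [/\ forall z, z \in zs -> (M : set E) z, finite_ext (incl_subfield KM) &
      forall N : subfield E, K `<=` N ->
        (forall z, z \in zs -> (N : set E) z) -> M `<=` N].
Proof.
elim: zs => [|z zs IH] alg.
  by exists K, (@subset_refl _ K); split=> //; exact: finite_ext_id.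
have [|M [KM [Mzs finM Mmin]]] := IH.
  by move=> y yzs; apply: alg; rewrite inE yzs orbT.
have [|M' [MM' [M'z finM' M'min]]] := @adjoin_root M z.
  by apply: (algebraicOver_up KM); apply: alg; rewrite mem_head.
exists M', (subset_trans KM MM'); split.
- move=> y; rewrite inE => /orP[/eqP -> //|yzs]; exact/MM'/Mzs.
- by apply: finite_ext_trans finM finM' => c; exact: val_inj.
- move=> N KN Nzs; apply: M'min; last by apply: Nzs; rewrite mem_head.
  by apply: Mmin => // y yzs; apply: Nzs; rewrite inE yzs orbT.
Qed.

Context {F : subfield E}.
Hypothesis E_galois : galois_ext (val : subfield_type F -> E).
Local Notation iF := (val : subfield_type F -> E).

Lemma minimal_poly_split x : exists (p : {poly subfield_type F}) (s : seq E),
  minimal_poly iF x p /\ map_poly iF p = \prod_(z <- s) ('X - z%:P).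
Proof.
have [alg _ nor] := E_galois; have [p px] := minimal_poly_exists (alg x).
by have [s ps] := nor _ _ px; exists p, s.
Qed.

Lemma conjugates_in_base (M : subfield E) c : F `<=` M -> (F : set E) c ->
  exists q : {poly subfield_type F}, [/\ q != 0,
    root (map_poly iF q) c & forall w, root (map_poly iF q) w -> (M : set E) w].
Proof.
move=> FM Fc; exists ('X - (sf_in Fc)%:P); rewrite polyXsubC_eq0.
rewrite map_polyXsubC root_XsubC /=; split=> // w.
by rewrite root_XsubC => /eqP ->; exact: FM.
Qed.

(** The conjugates of a difference or quotient are differences or quotients of
    conjugates, as the resultants annihilating [x - y] and [x / y] show. So if [M]
    is generated by a set stable under conjugation, all conjugates of its elements
    lie in [M], that is, [M] is normal over [F]. *)
Lemma conjugates_in_closed (M : subfield E) : F `<=` M ->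
  divring_closed (mem [set x : E | exists q : {poly subfield_type F}, [/\ q != 0,
    root (map_poly iF q) x & forall w, root (map_poly iF q) w -> (M : set E) w]]).
Proof.
move=> FM.
have cst c := @conjugates_in_base M c FM.
have good y : (exists q : {poly subfield_type F}, [/\ q != 0,
    root (map_poly iF q) y & forall w, root (map_poly iF q) w -> (M : set E) w]) ->
   exists (q : {poly subfield_type F}) (s : seq E), [/\ minimal_poly iF y q,
    map_poly iF q = \prod_(z <- s) ('X - z%:P)
    & forall w, root (map_poly iF q) w -> (M : set E) w].
  move=> [q [q0 qy qM]]; have [p [s [py ps]]] := minimal_poly_split y.
  exists p, s; split=> // w pw; apply: qM.
  have [_ _ /(_ q qy)/dvdpP[r ->]] := py.
  by rewrite rmorphM rootM pw orbT.
split.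
- by apply/mem_set/cst; exact: subfield1.
- move=> x y /set_mem[p [p0 px pM]] /set_mem/good[q [s [[qm qy _] qs qM]]].
  have q0 := monic_neq0 qm.
  apply/mem_set; exists (sub_annihilant p q); split.
  + exact: sub_annihilant_neq0.
  + by apply/rootP/map_sub_annihilantP => //; exact/rootP.
  + move=> w /(sub_annihilant_root p0 q0 (s := s)).
    rewrite qs eqpxx => /(_ isT)[x' [y' [x'p y'q ->]]].
    by apply: subfieldB; [exact: pM|apply: qM; rewrite qs].
- move=> x y /set_mem[p [p0 px pM]] /set_mem/good[q [s [[qm qy qmin] qs qM]]].
  have q0 := monic_neq0 qm; apply/mem_set.
  have [->|y0] := eqVneq y 0; first by rewrite invr0 mulr0; apply/cst/subfield0.
  have q00 : root q 0 = false.
    apply: contraNF y0 => /factor_theorem[r rE].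
    move: qy; rewrite rE rmorphM rootM => /orP[ry|rX]; last first.
      have : root (map_poly (val : {rmorphism subfield_type F -> E}) ('X - 0%:P)) y by exact: rX.
      by rewrite map_polyXsubC root_XsubC rmorph0.
    have r0 : r != 0 by apply: contraNneq q0 => r0; rewrite rE r0 mul0r.
    have := dvdp_leq r0 (qmin _ ry).
    by rewrite rE size_Mmonic ?monicXsubC // size_XsubC addn2 ltnn.
  exists (div_annihilant p q); split.
  + by apply: div_annihilant_neq0 => //; rewrite -rootE q00.
  + by apply/rootP/map_div_annihilantP => //; exact/rootP.
  + move=> w rw; have [->|w0] := eqVneq w 0; first exact: subfield0.
    have [||x' [y' [x'p y'q ->]]] := @div_annihilant_root _ _ _ p q s w p0 q0 _ w0 _ rw.
    * by rewrite qs eqpxx.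
    * by rewrite -(rmorph0 (val : {rmorphism subfield_type F -> E})) fmorph_root.
    by apply: subfieldV; [exact: pM|exact: qM].
Qed.

Lemma lift_roots (M : subfield E) (p : {poly subfield_type M}) (s : seq E) :
  map_poly val p = \prod_(z <- s) ('X - z%:P) ->
  (forall z, z \in s -> (M : set E) z) ->
  exists s', p = \prod_(z <- s') ('X - z%:P).
Proof.
move=> ps sM.
have [s' s'E] : exists s' : seq (subfield_type M), s = [seq val z | z <- s'].
  elim: (s) sM => [|z t IH] tM; first by exists [::].
  have [y yt|t' ->] := IH; first by apply: tM; rewrite inE yt orbT.
  by exists (sf_in (tM _ (mem_head _ _)) :: t').
exists s'; apply: (map_poly_inj (val : {rmorphism subfield_type M -> E})).
rewrite ps s'E big_map rmorph_prod; apply: eq_bigr => z _.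
exact/esym/map_polyXsubC.
Qed.

(** Adjoin all the conjugates of the given elements. *)
Lemma fg_containing (xs : seq E) :
  exists L : finite_galois F, forall x, x \in xs -> (L : set E) x.
Proof.
have [alg sep nor] := E_galois.
have [zs [xzs zsP]] : exists zs : seq E, {subset xs <= zs} /\
    forall z, z \in zs -> exists p, [/\ p != 0, root (map_poly iF p) z &
      forall w, root (map_poly iF p) w -> w \in zs].
  elim: (xs) => [|x ys [zs [yzs zsP]]]; first by exists [::].
  have [p [s [[pm px _] ps]]] := minimal_poly_split x; exists (s ++ zs); split.
    move=> y; rewrite inE mem_cat => /orP[/eqP ->|/yzs ->]; last by rewrite orbT.
    by move: px; rewrite ps root_prod_XsubC => ->.
  move=> z; rewrite mem_cat => /orP[zs'|/zsP[q [q0 qz qzs]]].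
    exists p; rewrite ps root_prod_XsubC monic_neq0 //; split=> // w.
    by rewrite root_prod_XsubC mem_cat => ->.
  by exists q; split=> // w /qzs; rewrite mem_cat orbC => ->.
have [M [FM [Mzs fin Mmin]]] := @adjoin_seq F zs (fun z _ => alg z).
have inM (x : subfield_type M) : exists q : {poly subfield_type F}, [/\ q != 0,
    root (map_poly iF q) (val x)
    & forall w, root (map_poly iF q) w -> (M : set E) w].
  apply: (Mmin (Subfield (conjugates_in_closed FM))) (sf_val x) => [c Fc|].
    exact: conjugates_in_base.
  by move=> z /zsP[p [p0 pz pzs]]; exists p; split=> // w /pzs; exact: Mzs.
have gal : galois_ext (incl_subfield FM).
  split=> [x|x p|x p].
  - have [p p0 px] := alg (val x); exists p => //.
    by rewrite -(root_map_comp _ _ (val_incl FM)).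
  - by move/(minimal_poly_comp _ _ (val_incl FM)); exact: sep.
  - move/(minimal_poly_comp _ _ (val_incl FM)) => px; have [s ps] := nor _ _ px.
    apply: (@lift_roots M _ s) => [|z zs'].
      by rewrite -ps -map_poly_comp; apply: eq_map_poly.
    have [q [q0 qx qM]] := inM x; apply: qM.
    have [_ _ /(_ q qx)/dvdpP[r ->]] := px.
    by rewrite rmorphM rootM /= ps root_prod_XsubC zs' orbT.
by exists (FiniteGalois fin gal) => x /xzs; exact: Mzs.
Qed.

Lemma fg_contains_ext (K : finite_galois F) (xs : seq E) :
  exists L : finite_galois F, K `<=` L /\ forall x, x \in xs -> (L : set E) x.
Proof.
have [s sP] := fg_finite K.
have [L hL] := fg_containing ([seq val z | z <- s] ++ xs).
exists L; split=> [x Kx|x xxs]; last by apply: hL; rewrite mem_cat xxs orbT.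
have [c /(congr1 val)] := sP (sf_in Kx); rewrite rmorph_sum /= => ->.
elim/big_ind : _ => [|y z|j _]; [exact: subfield0|exact: subfieldD|].
apply: subfieldM; first exact/(fg_sub L)/sf_val.
by apply: hL; rewrite mem_cat map_f // mem_nth.
Qed.

Lemma fg_compositum (K L : finite_galois F) :
  exists M : finite_galois F, K `<=` M /\ L `<=` M.
Proof.
have [s sP] := fg_finite L.
have [M [KM sM]] := fg_contains_ext K [seq val z | z <- s].
exists M; split=> // x Lx.
have [c /(congr1 val)] := sP (sf_in Lx); rewrite rmorph_sum /= => ->.
elim/big_ind : _ => [|y z|j _]; [exact: subfield0|exact: subfieldD|].
apply: subfieldM; first exact/(fg_sub M)/sf_val.
by apply: sM; rewrite map_f // mem_nth.
Qed.

(** A minimal polynomial over [K] divides the one over [F], and so inherits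
    separability and splitting. *)
Lemma fg_relative (K L : finite_galois F) (KL : K `<=` L) :
  finite_ext (incl_subfield KL) /\ galois_ext (incl_subfield KL).
Proof.
have iE c : incl_subfield (fg_sub L) c = incl_subfield KL (incl_subfield (fg_sub K) c).
  exact: val_inj.
have [alg sep nor] := fg_galois L.
have minK x q : minimal_poly (incl_subfield KL) x q ->
    exists2 p, minimal_poly (incl_subfield (fg_sub L)) x p &
      q %| map_poly (incl_subfield (fg_sub K)) p.
  move=> [qm qx qmin]; have [p [pm px pmin]] := minimal_poly_exists (alg x).
  exists p => //; apply: qmin.
  by rewrite -map_poly_comp; move: px; congr (is_true (root _ x)); apply: eq_map_poly => c; exact: iE.
split.
  have [s sP] := fg_finite L; exists s => x; have [c ->] := sP x.
  by exists (fun j => incl_subfield (fg_sub K) (c j)); apply: eq_bigr => j _; congr (_ * _); exact: iE.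
split=> [x|x q /minK[p px qp]|x q qx].
- have [p p0 px] := alg x; exists (map_poly (incl_subfield (fg_sub K)) p).
    by rewrite map_poly_eq0.
  by rewrite -map_poly_comp; move: px; congr (is_true (root _ x)); apply: eq_map_poly => c; exact: iE.
- by apply: dvdp_separable qp _; rewrite separable_map; exact: sep px.
- have [p px qp] := minK _ _ qx; have [s ps] := nor _ _ px.
  have : map_poly (incl_subfield KL) q %| \prod_(z <- s) ('X - z%:P).
    rewrite -ps [map_poly (incl_subfield (fg_sub L)) p](_ : _ =
      map_poly (incl_subfield KL) (map_poly (incl_subfield (fg_sub K)) p)).
      by rewrite dvdp_map.
    by rewrite -map_poly_comp; apply: eq_map_poly => c; exact: iE.
  move=> /dvdp_prod_XsubC[m qm]; exists (mask m s); apply/eqP.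
  rewrite -eqp_monic // ?monic_prod_XsubC //.
  by have [qmon _ _] := qx; rewrite map_monic.
Qed.

Definition fg_over (K L : finite_galois F) (KL : K `<=` L) : finite_galois K :=
  FiniteGalois (fg_relative KL).1 (fg_relative KL).2.

End Subfields.

(** * The places of a global field *)

Section QuotientField.
Context {R : realType} {Q : fieldType} {D : Type} (f : D -> Q).
Hypothesis f_frac : forall x, exists n d, f d != 0 /\ x = f n / f d.

Lemma av_equiv_on_frac (a b : absval R Q) (c : R) : 0 < c ->
  (forall n, f n != 0 -> b (f n) = a (f n) `^ c) -> av_equiv a b.
Proof.
move=> c0 H; exists c => // x; have [n [d [d0 ->]]] := f_frac x.
rewrite !avM !avV powRM ?invr_ge0 ?av_ge0 // (H d) //.
rewrite -[X in _ * X `^ _]powR_inv1 ?av_ge0 // -powRrM mulN1r powRN.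
have [n0|n0] := eqVneq (f n) 0; last by rewrite H.
by rewrite n0 !av0 powR0 ?gt_eqF // !mul0r.
Qed.

(** The exponent is the ratio of the logarithms of [b P] and [a P]. Each uniqueness
    statement for nonarchimedean places below is an instance: for the prime [p] of [rat], for a prime
    polynomial, and for the variable at the infinite place. *)
Lemma av_equiv_on_powers (a b : absval R Q) (P : Q) :
  (a P < 1 /\ b P < 1 \/ 1 < a P /\ 1 < b P) -> P != 0 ->
  (forall n, f n != 0 -> exists j : nat, a (f n) = a P ^+ j /\ b (f n) = b P ^+ j) ->
  av_equiv a b.
Proof.
move=> side P0 H.
have aP : 0 < a P := av_gt0 a P0; have bP : 0 < b P := av_gt0 b P0.
pose c := ln (b P) / ln (a P).
have lna : ln (a P) != 0.
  by rewrite ln_eq0 //; case: side => -[h _]; [rewrite lt_eqF|rewrite gt_eqF].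
have c0 : 0 < c.
  rewrite /c; case: side => -[a1 b1].
    by rewrite -mulrNN -invrN divr_gt0 // oppr_gt0 ln_lt0 ?a1 ?b1 ?aP ?bP.
  by rewrite divr_gt0 // ln_gt0.
apply: (av_equiv_on_frac c0) => n /H[j [-> ->]].
have -> : b P = a P `^ c by rewrite /powR (gt_eqF aP) /c divfK // lnK ?posrE.
have pX (x : R) : 0 <= x -> x ^+ j = x `^ j%:R by move=> x0; rewrite powR_mulrn.
by rewrite (pX _ (powR_ge0 _ _)) (pX _ (ltW aP)) powRAC.
Qed.
End QuotientField.

Section NonarchEqual.
Context {R : realType} {L : fieldType} (a : absval R L).
Hypothesis na : nonarchimedean a.

Lemma nonarch_addl x y : a y < a x -> a (x + y) = a x.
Proof.
move=> yx; apply/le_anti/andP; split.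
  by rewrite (le_trans (na _ _)) // ge_max lexx ltW.
have := na (x + y) (- y); rewrite addrK avN le_max => /orP[//|].
by rewrite leNgt yx.
Qed.

End NonarchEqual.

Section Rational.
Context {R : realType}.
Implicit Types a b : absval R rat.

Lemma rat_natfrac (x : rat) : exists n d : nat * bool,
  (-1) ^+ d.2 * d.1%:R != 0 :> rat /\
  x = ((-1) ^+ n.2 * n.1%:R) / ((-1) ^+ d.2 * d.1%:R).
Proof.
exists (`|numq x|%N, numq x < 0), (`|denq x|%N, false) => /=.
rewrite expr0 mul1r !natr_absz normr_denq intr_eq0 denq_neq0; split=> //.
by rewrite -{1}[x]divq_num_den -{1}[numq x]mulr_sign_norm rmorphM rmorph_sign.
Qed.

Let signed (n : nat * bool) : rat := (-1) ^+ n.2 * n.1%:R.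

Let av_signed a n : a (signed n) = a n.1%:R.
Proof.
by case: n => n [] /=; rewrite /signed /= ?expr1 ?mulN1r ?avN ?expr0 ?mul1r.
Qed.

(** Expand [m] in base [n]: at most [k] digits, each of absolute value at most [n]. *)
Lemma nat_digits_le a (n m k : nat) : (1 < n)%N -> (m < n ^ k)%N ->
  a m%:R <= (k * n)%:R * Num.max 1 (a n%:R) ^+ k.
Proof.
move=> n1; set M := Num.max 1 _.
have M1 : 1 <= M by rewrite le_max lexx.
have M0 : 0 <= M := le_trans ler01 M1.
elim: k m => [|k IH] m.
  by rewrite expn0 ltnS leqn0 => /eqP ->; rewrite av0 mul0n mul0r.
rewrite expnS => mlt; rewrite {1}(divn_eq m n) natrD natrM.
apply: (le_trans (avD _ _ _)); rewrite avM mulSn addnC natrD mulrDl.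
apply: lerD.
  rewrite exprSr mulrA ler_pM ?av_ge0 //; last by rewrite /M le_max lexx orbT.
  by apply: IH; rewrite ltn_divLR 1?mulnC // ltnW.
apply: (le_trans (av_nat _ _)); rewrite -[leLHS]mulr1 ler_pM ?exprn_ege1 //.
by rewrite ler_nat ltnW // ltn_mod ltnW.
Qed.

(** Apply the bound by digits to [m ^ N], which has about [N * t] digits in base
    [n], and take [N]-th roots. *)
Lemma nat_av_le a (m n : nat) : (0 < m)%N -> (1 < n)%N ->
  a m%:R <= Num.max 1 (a n%:R) `^ (ln m%:R / ln n%:R).
Proof.
move=> m0 n1; set M := Num.max 1 _; set t := _ / _.
have M1 : 1 <= M by rewrite le_max lexx.
have M0 : 0 < M := lt_le_trans ltr01 M1.
have lnn : 0 < ln (n%:R : R) by rewrite ln_gt0 // ltr1n.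
have t0 : 0 <= t by rewrite divr_ge0 ?(ltW lnn) // ln_ge0 // ler1n.
have Mt : 0 < M `^ t by rewrite powR_gt0.
rewrite -[leRHS]mul1r -ler_pdivrMr //.
(* The digit bound for [m ^ N.+1] is at most [C * N.+2] times the [N.+1]-st power
   of [M `^ t], and [C <= 2 ^ (truncn C).+1 <= N.+2 ^ (truncn C).+1]. *)
pose C := (t + 1) * n%:R * M.
have C0 : 0 <= C by rewrite !mulr_ge0 ?addr_ge0 // ltW.
apply: (@poly_growth_le1 _ _ (Num.truncn C).+2) => [|N].
  by rewrite divr_ge0 ?av_ge0 ?ltW.
case: N => [|N]; first by rewrite expr0 expr1n.
apply: (@le_trans _ _ (C * N.+2%:R)); last first.
  rewrite [leRHS]exprSr ler_wpM2r //.
  apply: le_trans (ltW (truncnS_gt C)) _.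
  rewrite -natrX ler_nat (leq_trans (ltnW (ltn_expl _ (ltnSn 1)))) //.
  by rewrite leq_exp2r.
rewrite expr_div_n ler_pdivrMr ?exprn_gt0 // -avX -natrX.
pose k := (Num.truncn (N.+1%:R * t)).+1.
have kt : N.+1%:R * t < k%:R by exact: truncnS_gt.
have kt1 : k%:R <= N.+1%:R * t + 1.
  by rewrite /k -[X in X <= _]natr1 lerD2r truncn_le // mulr_ge0.
have mk : (m ^ N.+1 < n ^ k)%N.
  rewrite -(ltr_nat R) !natrX -ltr_ln ?posrE ?exprn_gt0 ?ltr0n ?(ltnW n1) //.
  rewrite !lnXn ?ltr0n ?(ltnW n1) // -[X in X < _]mulr_natl -[X in _ < X]mulr_natl.
  by rewrite -ltr_pdivrMr // -mulrA.
apply: (le_trans (nat_digits_le a n1 mk)); rewrite -/M.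
have -> : C * N.+2%:R * M `^ t ^+ N.+1 =
   ((t + 1) * N.+2%:R * n%:R) * (M * M `^ t ^+ N.+1) by rewrite /C; ring.
rewrite natrM ler_pM ?mulr_ge0 ?exprn_ge0 ?(ltW M0) //.
  rewrite ler_wpM2r // (le_trans kt1) // -[N.+2%:R]natr1.
  have : 0 <= N.+1%:R :> R by []. 
  by move: (N.+1%:R : R) t0 => x t0 x0; lra.
rewrite -!powR_mulrn ?powR_ge0 ?(ltW M0) // -powRrM -{2}[M]powRr1 ?(ltW M0) //.
rewrite -powRD ?(gt_eqF M0) ?implybT //.
by rewrite ler_powR // addrC [t * _]mulrC.
Qed.

(** Comparing [n] and [2] in both directions shows that [ln (a n) / ln n] has the
    same value for all [n]. *)
Lemma rat_arch_powR a : ~ nonarchimedean a ->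
  exists2 s : R, 0 < s & forall n : nat, (0 < n)%N -> a n%:R = n%:R `^ s.
Proof.
move=> arch.
have [n0 an0] : exists n0 : nat, 1 < a n0%:R.
  apply: contrapT => H; apply/arch/nonarch_natP => n; rewrite leNgt; apply/negP => h.
  by apply: H; exists n.
have n01 : (0 < n0)%N by rewrite lt0n; apply: contraTneq an0 => ->; rewrite av0 ltr10.
have an (n : nat) : (1 < n)%N -> 1 < a n%:R.
  move=> n1; rewrite ltNge; apply/negP => an1.
  have := nat_av_le a n01 n1; rewrite max_l //.
  rewrite powR1 => h.
  by have := lt_le_trans an0 h; rewrite ltxx.
have ln0 (n : nat) : (1 < n)%N -> 0 < ln (n%:R : R).
  by move=> n1; rewrite ln_gt0 // ltr1n.
exists (ln (a 2%:R) / ln 2%:R); first by rewrite divr_gt0 ?ln0 // ln_gt0 // an.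
move=> n n0'; case: n n0' => [//|[_|n _]]; first by rewrite av1 powR1.
have le (m k : nat) : (1 < m)%N -> (1 < k)%N -> ln (a m%:R) <= ln m%:R / ln k%:R * ln (a k%:R).
  move=> m1 k1; have := nat_av_le a (ltnW m1) k1; rewrite max_r ?(ltW (an _ k1)) //.
  by rewrite -ler_ln ?posrE ?powR_gt0 ?(lt_trans ltr01) ?an // ln_powR.
have l1 := le n.+2 2%N isT isT; have l2 := le 2%N n.+2 isT isT.
have l3 := ln0 n.+2 isT; have l4 := ln0 2%N isT.
have a0 : 0 < a n.+2%:R by rewrite (lt_trans ltr01) ?an.
rewrite /powR pnatr_eq0 /= -[LHS](lnK (_ : _ \is Num.pos)) ?posrE //.
congr expR; apply/le_anti/andP; split.
  by rewrite (le_trans l1) // mulrAC [leRHS]mulrAC [X in X / _ <= _]mulrC.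
by move: l2; rewrite mulrAC ler_pdivlMr // => l2; rewrite mulrAC ler_pdivrMr // [leRHS]mulrC.
Qed.

Lemma rat_arch_unique a b :
  ~ nonarchimedean a -> ~ nonarchimedean b -> av_equiv a b.
Proof.
move=> /rat_arch_powR[s s0 aE] /rat_arch_powR[t t0 bE].
apply: (av_equiv_on_frac (f := signed) rat_natfrac (c := t / s)).
  by rewrite divr_gt0.
move=> [n e]; rewrite /signed /= mulf_eq0 negb_or pnatr_eq0 => /andP[_ n0].
rewrite -/(signed (n, e)) !av_signed /= aE ?lt0n // bE ?lt0n //.
by rewrite -powRrM mulrCA divff ?mulr1 // gt_eqF.
Qed.

(** The least positive integer of absolute value less than [1]. *)
Lemma rat_nonarch_prime a : nonarchimedean a -> av_nontrivial a ->
  exists p : nat, [/\ (1 < p)%N, a p%:R < 1 &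
    forall n : nat, (0 < n)%N -> (n < p)%N -> a n%:R = 1].
Proof.
move=> na [x x0 ax]; have /nonarch_natP nle := na.
have exn : exists n : nat, (0 < n)%N && (a n%:R < 1).
  apply: contrapT => H.
  have a1 (n : nat) : (0 < n)%N -> a n%:R = 1.
    move=> n0; apply/le_anti; rewrite nle leNgt; apply/negP => h.
    by apply: H; exists n; rewrite n0.
  have [n [d [d0 xE]]] := rat_natfrac x; move/eqP: ax; apply.
  move: x0; rewrite xE mulf_eq0 invr_eq0 negb_or => /andP[n0 _].
  rewrite -/(signed n) -/(signed d) avM avV !av_signed !a1 ?divr1 // lt0n.
    by apply: contraNneq d0 => ->; rewrite mulr0.
  by apply: contraNneq n0 => ->; rewrite mulr0.
have [p /andP[p0 ap] pmin] := ex_minnP exn; exists p; split=> //.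
  by case: p p0 ap {pmin} => [//|[|//]] _; rewrite av1 ltxx.
move=> n n0 np; apply/le_anti; rewrite nle leNgt; apply/negP => h.
by have := pmin n; rewrite n0 h leqNgt np => /(_ isT).
Qed.

(** Dividing by [p] as long as the remainder vanishes: an integer with nonzero
    remainder has the absolute value of that remainder, which is [1]. *)
Lemma rat_nonarch_unique a b (p : nat) :
  nonarchimedean a -> nonarchimedean b -> (1 < p)%N ->
  a p%:R < 1 -> b p%:R < 1 ->
  (forall n : nat, (0 < n)%N -> (n < p)%N -> a n%:R = 1 /\ b n%:R = 1) ->
  av_equiv a b.
Proof.
move=> na nb p1 ap bp H.
have p0 : p%:R != 0 :> rat by rewrite pnatr_eq0 -lt0n ltnW.
apply: (av_equiv_on_powers (f := signed) rat_natfrac (P := p%:R)) => //.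
  by left.
have pow (n : nat) : (0 < n)%N ->
    exists j : nat, a n%:R = a p%:R ^+ j /\ b n%:R = b p%:R ^+ j.
  have [m] := ubnP n; elim: m n => // m IH n nm n0.
  have [r0|r0] := posnP (n %% p); last first.
    exists 0%N; rewrite !expr0.
    have unitc (c : absval R rat) : nonarchimedean c -> c p%:R < 1 ->
        c (n %% p)%:R = 1 -> c n%:R = 1.
      move=> nc cp cr; rewrite (divn_eq n p) natrD natrM addrC nonarch_addl //.
      rewrite cr avM (le_lt_trans _ cp) // ler_piMl ?av_ge0 //.
      by have /nonarch_natP := nc; apply.
    have [ar br] := H _ r0 (ltn_pmod _ (ltnW p1)).
    by split; apply: unitc.
  have [q nE] : exists q, n = (q * p)%N.
    by exists (n %/ p)%N; rewrite {1}(divn_eq n p) r0 addn0.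
  have q0 : (0 < q)%N by move: n0; rewrite nE muln_gt0 => /andP[].
  have [|j [aq bq]] := IH q _ q0.
    rewrite -ltnS (leq_trans _ nm) // ltnS nE -{1}(muln1 q).
    by rewrite ltn_pmul2l.
  by exists j.+1; rewrite nE natrM !avM aq bq !exprSr.
move=> [n e]; rewrite /signed /= mulf_eq0 negb_or pnatr_eq0 => /andP[_ n0].
by rewrite -/(signed (n, e)) !av_signed; apply: pow; rewrite lt0n.
Qed.
End Rational.

Section FunctionField.
Context {R : realType} {k : finFieldType}.
Local Notation Q := {fraction {poly k}}.
Local Notation f := (@tofrac {poly k} : {rmorphism {poly k} -> Q}).
Implicit Types a b : absval R Q.

Lemma fraction_quotient (A : idomainType) (x : {fraction A}) :
  exists n d : A, tofrac d != 0 /\ x = tofrac n / tofrac d.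
Proof.
elim/quotW: x => r; exists (\n_r), (\d_r).
have d0 : tofrac (\d_r) != 0 by rewrite tofrac_eq0; exact: denom_ratioP.
split=> //; apply: (mulIf d0); rewrite divfK //.
apply/eqP; rewrite !piE /equivf /FracField.mulf /=.
by rewrite !numden_Ratio ?mulf_neq0 ?oner_neq0 ?denom_ratioP // !mulr1 mulrC.
Qed.

(** The nonzero elements of a finite field are roots of unity. *)
Lemma av_constant a (c : k) : c != 0 -> a (f c%:P) = 1.
Proof.
move=> c0; have H : a (f c%:P) ^+ #|k|.-1 = 1.
  apply: (mulfI (x := a (f c%:P))); first by rewrite gt_eqF // av_gt0 // tofrac_eq0 polyC_eq0.
  rewrite -exprS prednK ?mulr1; last by rewrite (cardD1 0).
  by rewrite -avX -rmorphXn -polyC_exp expf_card.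
apply/eqP; rewrite -(@pexpr_eq1 _ _ #|k|.-1) ?av_ge0 ?H //.
by rewrite (cardD1 0) (cardD1 1) !inE oner_neq0.
Qed.

Lemma av_constant_le1 a (c : k) : a (f c%:P) <= 1.
Proof.
by have [->|/av_constant -> //] := eqVneq c 0; rewrite polyC0 rmorph0 av0.
Qed.

Lemma function_field_nonarch a : nonarchimedean a.
Proof.
apply/nonarch_natP => n.
by rewrite -(rmorph_nat f) -(rmorph_nat (@polyC k)); exact: av_constant_le1.
Qed.

Lemma av_polyE a (p : {poly k}) :
  f p = \sum_(i < size p) f (p`_i)%:P * f 'X ^+ i.
Proof.
rewrite -{1}[p]coefK poly_def rmorph_sum; apply: eq_bigr => i _.
by rewrite -mul_polyC rmorphM rmorphXn.
Qed.

(** If ['X] is large, a polynomial has the absolute value of its leading term. *)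
Lemma function_field_infinity_unique a b :
  1 < a (f 'X) -> 1 < b (f 'X) -> av_equiv a b.
Proof.
move=> aX bX.
have deg (c : absval R Q) p : 1 < c (f 'X) -> p != 0 ->
    c (f p) = c (f 'X) ^+ (size p).-1.
  move=> cX p0; rewrite av_polyE //; have sp : (0 < size p)%N by rewrite size_poly_gt0.
  rewrite -(prednK sp) big_ord_recr /= addrC.
  have lead : c (f (p`_(size p).-1)%:P * f 'X ^+ (size p).-1) = c (f 'X) ^+ (size p).-1.
    by rewrite avM avX av_constant ?mul1r // -lead_coefE lead_coef_eq0.
  rewrite nonarch_addl //; first exact: function_field_nonarch.
  rewrite lead; case: (size p).-1 => [|n].
    by rewrite big_ord0 av0 expr0.
  apply: (@le_lt_trans _ _ (c (f 'X) ^+ n)); last by rewrite ltr_eXn2l.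
  apply: nonarch_sum; [exact: function_field_nonarch|by rewrite exprn_ge0 ?av_ge0|].
  move=> i; rewrite avM avX -[leRHS]mul1r ler_pM ?exprn_ge0 ?av_ge0 ?av_constant_le1 //.
  by rewrite ler_weXn2l ?(ltW cX) // -ltnS.
apply: (av_equiv_on_powers (f := f) (@fraction_quotient _) (P := f 'X)).
- by right.
- by rewrite tofrac_eq0 polyX_eq0.
- move=> p; rewrite tofrac_eq0 => p0; exists (size p).-1; split; exact: deg.
Qed.

Lemma function_field_integral a p : a (f 'X) <= 1 -> a (f p) <= 1.
Proof.
move=> aX; rewrite av_polyE //; apply: nonarch_sum => // [|i].
  exact: function_field_nonarch.
by rewrite avM avX mulr_ile1 ?exprn_ge0 ?av_ge0 ?av_constant_le1 // exprn_ile1 ?av_ge0.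
Qed.

(** A polynomial of least degree among those of absolute value less than [1]. *)
Lemma function_field_prime a : av_nontrivial a -> a (f 'X) <= 1 ->
  exists P : {poly k}, [/\ P != 0, a (f P) < 1 &
    forall p : {poly k}, p != 0 -> (size p < size P)%N -> a (f p) = 1].
Proof.
move=> [x x0 /eqP ax] aX.
have le1 p := function_field_integral p aX.
pose S n := `[< exists p : {poly k}, [/\ p != 0, a (f p) < 1 & size p = n] >].
have exS : exists n, S n.
  apply: contrapT => H.
  have a1 p : p != 0 -> a (f p) = 1.
    move=> p0; apply/le_anti; rewrite le1 leNgt; apply/negP => h.
    by apply: H; exists (size p); apply/asboolP; exists p.
  have [n [d [d0 xE]]] := fraction_quotient x; apply: ax.
  move: x0; rewrite xE mulf_eq0 invr_eq0 negb_or => /andP[n0 _].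
  rewrite avM avV (a1 d) ?(a1 n) ?invr1 ?mulr1 //; first by rewrite tofrac_eq0 in n0.
  by rewrite tofrac_eq0 in d0.
have [n /asboolP[P [P0 aP sP]] nmin] := ex_minnP exS.
exists P; split=> // p p0 sp; apply/le_anti; rewrite le1 leNgt; apply/negP => h.
have : (n <= size p)%N by apply: nmin; apply/asboolP; exists p.
by rewrite leqNgt -sP sp.
Qed.

Lemma function_field_finite_unique a b (P : {poly k}) : P != 0 ->
  a (f 'X) <= 1 -> b (f 'X) <= 1 -> a (f P) < 1 -> b (f P) < 1 ->
  (forall p : {poly k}, p != 0 -> (size p < size P)%N -> a (f p) = 1 /\ b (f p) = 1) ->
  av_equiv a b.
Proof.
move=> P0 aX bX aP bP H.
have sP1 : (1 < size P)%N.
  rewrite ltnNge; apply/negP => /size1_polyC PE; move: P0 aP.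
  by rewrite PE polyC_eq0 => /av_constant ->; rewrite ltxx.
apply: (av_equiv_on_powers (f := f) (@fraction_quotient _) (P := f P)).
- by left.
- by rewrite tofrac_eq0.
move=> p; rewrite tofrac_eq0; have [m] := ubnP (size p).
elim: m p => // m IH p pm p0.
have [r0|r0] := eqVneq (p %% P) 0; last first.
  exists 0%N; rewrite !expr0.
  have unitc (c : absval R Q) : c (f 'X) <= 1 -> c (f P) < 1 ->
      c (f (p %% P)) = 1 -> c (f p) = 1.
    move=> cX cP cr; rewrite (divp_eq p P) rmorphD rmorphM addrC nonarch_addl //.
      exact: function_field_nonarch.
    rewrite cr avM (le_lt_trans _ cP) // ler_piMl ?av_ge0 //.
    exact: function_field_integral.
  have [ar br] := H _ r0 (ltn_modpN0 _ P0).
  by split; apply: unitc.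
have [q pE] : exists q, p = q * P.
  by exists (p %/ P); rewrite {1}(divp_eq p P) r0 addr0.
have q0 : q != 0 by apply: contraNneq p0 => q0; rewrite pE q0 mul0r.
have [|j [aq bq]] := IH q _ q0.
  rewrite -ltnS (leq_trans _ pm) // ltnS pE size_mul //.
  by case: (size P) sP1 => [|[|n]] //= _; rewrite !addnS /= ltnS leq_addr.
by exists j.+1; rewrite pE rmorphM !avM aq bq !exprSr.
Qed.
End FunctionField.

Section PlacesOfGlobalFields.
Context {R : realType}.

Definition arch_place (L : fieldType) (v : place R L) :=
  exists2 a, val v a & ~ nonarchimedean a.

Definition few_places (L : fieldType) :=
  countable [set: place R L] /\ finite_set [set v : place R L | arch_place v].

Lemma place_rep (L : fieldType) (v : place R L) : {a | val v a}.
Proof. exact/cid/place_inhabited. Qed.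

(** Restriction of places has finite fibres, and preserves being archimedean since
    that is visible on the integers. *)
Lemma few_places_ext (K L : fieldType) (i : {rmorphism K -> L}) :
  finite_ext i -> few_places K -> few_places L.
Proof.
move=> fin [cK fK]; have alg := finite_ext_algebraic fin.
have fib v := @finite_places_above R K L i v fin; split.
  apply: (@sub_countable _ _ _ (\bigcup_(v in [set: place R K])
    [set w : place R L | lies_over i w v])).
    apply: subset_card_le => w _; have [v wv] := place_below w alg.
    by exists v.
  by apply: bigcup_countable => // v _; exact: finite_set_countable.
apply: (@sub_finite_set _ _ (\bigcup_(v in [set v : place R K | arch_place v])
    [set w : place R L | lies_over i w v])).
  move=> w [a wa na]; have [v wv] := place_below w alg.
  exists v => //; exists (av_comp i a); first exact: wv.
  move=> /nonarch_natP h; apply/na/nonarch_natP => n.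
  by rewrite -(rmorph_nat i); exact: h.
by apply: bigcup_finite => // v _.
Qed.

(** A nonarchimedean place is determined by its prime; the archimedean ones all
    coincide, and are given the label [0]. *)
Lemma few_places_rat : few_places rat.
Proof.
pose av (v : place R rat) := projT1 (place_rep v).
have avP v : val v (av v) by rewrite /av; case: place_rep.
have av_inj v w : av_equiv (av v) (av w) -> v = w.
  by move=> h; apply: (@place_eq _ _ _ _ (av w)) => //; exact: place_closed h.
have pE v : exists p : nat, (~ nonarchimedean (av v) /\ p = 0%N) \/
   [/\ nonarchimedean (av v), (1 < p)%N, av v p%:R < 1 &
    forall n : nat, (0 < n)%N -> (n < p)%N -> av v n%:R = 1].
  have [na|na] := pselect (nonarchimedean (av v)); last by exists 0%N; left.
  have [p [h1 h2 h3]] := rat_nonarch_prime na (place_nontrivial (avP v)).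
  by exists p; right.
have /choice[p hp] := pE; split.
  apply/countable_injP; exists p => v w _ _ pvw; apply: av_inj.
  case: (hp v) (hp w) => [[nv pv]|[nv pv av1 hv]] [[nw pw]|[nw pw aw1 hw]].
  - exact: rat_arch_unique.
  - by rewrite -pvw pv in pw.
  - by rewrite pvw pw in pv.
  - apply: (@rat_nonarch_unique _ _ _ (p v)) => //; first by rewrite pvw.
    by move=> n n0 np; rewrite hv // hw // -pvw.
have [[v0 hv0]|h] := pselect (exists v : place R rat, arch_place v); last first.
  by apply: sub_finite_set (finite_set0 _) => v hv; apply: h; exists v.
apply: sub_finite_set (finite_set1 v0) => v [a va na].
have [a0 va0 na0] := hv0; apply: (@place_eq _ _ _ _ a) => //.
exact: place_closed va0 (rat_arch_unique na0 na).
Qed.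

(** Here the label is a polynomial, [0] standing for the infinite place. *)
Lemma few_places_function_field (k : finFieldType) :
  few_places {fraction {poly k}}.
Proof.
pose f := @tofrac {poly k}.
pose av (v : place R {fraction {poly k}}) := projT1 (place_rep v).
have avP v : val v (av v) by rewrite /av; case: place_rep.
have av_inj v w : av_equiv (av v) (av w) -> v = w.
  by move=> h; apply: (@place_eq _ _ _ _ (av w)) => //; exact: place_closed h.
have pE v : exists P : {poly k}, (1 < av v (f 'X) /\ P = 0) \/
   [/\ av v (f 'X) <= 1, P != 0, av v (f P) < 1 &
    forall p : {poly k}, p != 0 -> (size p < size P)%N -> av v (f p) = 1].
  have [X1|X1] := ltP 1 (av v (f 'X)); first by exists 0; left.
  have [P [h1 h2 h3]] := function_field_prime (place_nontrivial (avP v)) X1.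
  by exists P; right.
have /choice[P hP] := pE; split.
  apply/countable_injP; exists (choice.pickle \o P) => v w _ _.
  move/(pcan_inj choice.pickleK) => pvw; apply: av_inj.
  case: (hP v) (hP w) => [[nv pv]|[nv pv av1 hv]] [[nw pw]|[nw pw aw1 hw]].
  - exact: function_field_infinity_unique.
  - by rewrite -pvw pv eqxx in pw.
  - by rewrite pvw pw eqxx in pv.
  - apply: (@function_field_finite_unique _ _ _ _ (P v)) => //; first by rewrite pvw.
    by move=> n n0 np; rewrite hv // hw // -pvw.
apply: sub_finite_set (finite_set0 _) => v [a _]; apply.
exact: function_field_nonarch.
Qed.

Lemma few_places_global (F : fieldType) : global_field F -> few_places F.
Proof.
case=> [[i fin]|[k [i fin]]]; apply: few_places_ext fin _.
  exact: few_places_rat.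
exact: few_places_function_field.
Qed.
End PlacesOfGlobalFields.

(** * Maps between completions, local bases and estimates *)

Section CompletionMaps.
Context {R : realType}.

Section Spec.
Context {K L : fieldType} (f : {rmorphism K -> L}).
Variables (a : absval R K) (b : absval R L).
Hypothesis fE : forall c, b (f c) = a c.

Let image_cauchy (u : cauchy_seq a) : (fun n => f (val u n)) \in cauchy_pred b.
Proof.
apply/asboolP => e e0; have [N hN] := cauchy_seqP u e0; exists N => m n Nm Nn.
by rewrite -rmorphB fE; exact: hN.
Qed.

Let image (u : cauchy_seq a) : cauchy_seq b :=
  exist (fun w => w \in cauchy_pred b) (fun n => f (val u n)) (image_cauchy u).

Let g (x : completion a) : completion b := completion_pi (image (repr x)).

Let g_pi (u : cauchy_seq a) (u' : cauchy_seq b) :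
  (forall n, val u' n = f (val u n)) -> g (completion_pi u) = completion_pi u'.
Proof.
move=> u'E; apply/eqP; rewrite -subr_eq0 -rmorphB; apply/eqP/completion_pi_eq0.
have nu : null_av a (val (u - repr (completion_pi u))).
  by apply/completion_pi_eq0; rewrite rmorphB /= /completion_pi reprK subrr.
move=> e e0; have [N hN] := nu e e0; exists N => n Nn.
by rewrite /= !fctE /= u'E av_distC -rmorphB fE; exact: hN.
Qed.

Let g_isom x y : mdist (g x) (g y) = mdist x y.
Proof.
have [u ->] := completion_surj x; have [v ->] := completion_surj y.
rewrite (@g_pi u (image u)) // (@g_pi v (image v)) // !completion_distE -!rmorphB /=.
apply: completion_norm_pi.
have := @completion_norm_cvg _ _ a (u - v).
suff -> : (fun n => a (val (u - v) n)) = (fun n => b (val (image u - image v) n)) by [].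
by apply/funext => n; rewrite /= !fctE /= -rmorphB fE.
Qed.

Let spec (h : completion a -> completion b) :=
    (forall c, h (completion_inj a c) = completion_inj b (f c)) /\
    (forall x y, mdist (h x) (h y) = mdist x y).

Let spec_unique h h' : spec h -> spec h' -> h = h'.
Proof.
move=> [h1 h2] [h'1 h'2]; apply/funext => x; apply/eqP.
rewrite -subr_eq0; apply/eqP/(@av_eq0 _ _ (completion_av b)).
apply/le_anti; rewrite av_ge0 andbT; apply/ler_addgt0Pr => e e0; rewrite add0r.
have e20 : 0 < e / 2 by rewrite divr_gt0.
have [c hc] := completion_dense x e20.
pose p := completion_inj b (f c).
have H1 : completion_av b (h x - p) < e / 2.
  by rewrite /p -(h1 c) -completion_distE h2 completion_distE.
have H2 : completion_av b (h' x - p) < e / 2.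
  by rewrite /p -(h'1 c) -completion_distE h'2 completion_distE.
have := avD (completion_av b) (h x - p) (p - h' x).
rewrite addrA subrK [X in _ <= _ + X]av_distC => /le_trans; apply.
by rewrite [leRHS]splitr lerD // ltW.
Qed.

(** Since [completion_map] is chosen by its properties, existence must be shown:
    apply [f] termwise to Cauchy sequences. *)
Lemma completion_map_spec : spec (completion_map f a b).
Proof.
rewrite /completion_map; case: xgetP => [h _ //|H]; exfalso.
apply: (H g); split; last exact: g_isom.
by move=> c; exact: g_pi.
Qed.

Lemma completion_map_inj c :
  completion_map f a b (completion_inj a c) = completion_inj b (f c).
Proof. by have [] := completion_map_spec. Qed.

Lemma completion_map_unique h : (forall c, h (completion_inj a c) = completion_inj b (f c)) ->
  (forall x y, mdist (h x) (h y) = mdist x y) -> completion_map f a b = h.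
Proof. by move=> h1 h2; apply: spec_unique => //; exact: completion_map_spec. Qed.

Let gE : completion_map f a b = g.
Proof. by apply: completion_map_unique => // c; exact: g_pi. Qed.

Lemma completion_mapB : {morph completion_map f a b : x y / x - y}.
Proof.
move=> x y; rewrite gE.
have [u ->] := completion_surj x; have [v ->] := completion_surj y.
rewrite -rmorphB (@g_pi u (image u)) // (@g_pi v (image v)) // -rmorphB.
by apply: g_pi => n; rewrite /= !fctE /= rmorphB.
Qed.

Lemma completion_mapM : {morph completion_map f a b : x y / x * y}.
Proof.
move=> x y; rewrite gE.
have [u ->] := completion_surj x; have [v ->] := completion_surj y.
rewrite -rmorphM (@g_pi u (image u)) // (@g_pi v (image v)) // -rmorphM.
by apply: g_pi => n; rewrite /= !fctE /= rmorphM.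
Qed.

Lemma completion_map0 : completion_map f a b 0 = 0.
Proof. by rewrite -(subrr 0) completion_mapB subrr. Qed.

Lemma completion_map1 : completion_map f a b 1 = 1.
Proof.
by rewrite -(rmorph1 (completion_inj a)) completion_map_inj !rmorph1.
Qed.

Lemma completion_map_av x : completion_av b (completion_map f a b x) = completion_av a x.
Proof.
have [_ h] := completion_map_spec; have := h x 0.
by rewrite completion_map0 !completion_distE !subr0.
Qed.

Lemma completion_map_injective : injective (completion_map f a b).
Proof.
move=> x y xy; apply/eqP; rewrite -subr_eq0; apply/eqP/(@av_eq0 _ _ (completion_av a)).
by rewrite -completion_map_av completion_mapB xy subrr av0.
Qed.
End Spec.

Lemma completion_map_comp (K L M : fieldType) (f : {rmorphism K -> L})
    (g : {rmorphism L -> M}) (h : {rmorphism K -> M})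
    (a : absval R K) (b : absval R L) (c : absval R M) :
  (forall x, b (f x) = a x) -> (forall x, c (g x) = b x) ->
  (forall x, h x = g (f x)) ->
  forall x : completion a,
    completion_map h a c x = completion_map g b c (completion_map f a b x).
Proof.
move=> fE gE hE x.
have hcE y : c (h y) = a y by rewrite hE gE fE.
rewrite (@completion_map_unique _ _ h a c hcE
  (fun x => completion_map g b c (completion_map f a b x))) // => [y|y z].
  by rewrite !completion_map_inj // hE.
have [_ h1] := completion_map_spec gE; have [_ h2] := completion_map_spec fE.
by rewrite h1 h2.
Qed.

Lemma completion_map_id (L : fieldType) (f : {rmorphism L -> L}) (a : absval R L) :
  (forall x, f x = x) -> forall x : completion a, completion_map f a a x = x.
Proof.
move=> fE x; rewrite (@completion_map_unique _ _ f a a _ id) // => y; by rewrite fE.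
Qed.

Lemma completion_ball (L : fieldType) (a : absval R L) (x y : completion a) (e : R) :
  ball x e y <-> completion_av a (x - y) < e.
Proof. by rewrite ballEmdist /= completion_distE. Qed.

Lemma completion_nbhsP (L : fieldType) (a : absval R L) (x : completion a) (A : set (completion a)) :
  nbhs x A <-> exists2 e : R, 0 < e & forall y, completion_av a (x - y) < e -> A y.
Proof.
split=> [/nbhs_ballP[e e0 eA]|[e e0 eA]].
  by exists e => // y xy; apply: eA; exact/completion_ball.
by apply/nbhs_ballP; exists e => // y /completion_ball; exact: eA.
Qed.

Lemma completion_seq_complete (L : fieldType) (a : absval R L)
    (u : nat -> completion a) :
  (forall e : R, 0 < e -> exists N, forall m n, (N <= m)%N -> (N <= n)%N ->
     completion_av a (u m - u n) < e) ->
  exists l, forall e : R, 0 < e -> exists N, forall n, (N <= n)%N ->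
     completion_av a (u n - l) < e.
Proof.
move=> cu.
have : cvg (u @ \oo).
  apply/cauchy_cvgP/cauchyP => e e0; have [N hN] := cu e e0.
  exists (u N); exists N => // n Nn; apply/completion_ball; exact: hN.
move=> ul; exists (lim (u @ \oo)) => e e0.
have /ul : nbhs (lim (u @ \oo)) (fun y => completion_av a (lim (u @ \oo) - y) < e).
  by apply/completion_nbhsP; exists e.
by case=> N _ hN; exists N => n Nn; rewrite av_distC; exact: hN.
Qed.

Lemma completion_nonarchP (L : fieldType) (a : absval R L) :
  nonarchimedean (completion_av a) <-> nonarchimedean a.
Proof.
split; last exact: completion_nonarchimedean.
move=> /nonarch_natP H; apply/nonarch_natP => n.
have := H n; rewrite -(rmorph_nat (completion_inj a)).
by rewrite [X in X <= _]completion_norm_inj.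
Qed.

End CompletionMaps.

(** Identifies the neighbourhoods in a topology generated by a subbase [D]. It
    suffices to compare single members of [D] with the candidate base [N], because
    [N] is filtered and so absorbs the finite intersections. *)
Lemma subbase_nbhs (T : Type) (D : set (set T)) (N : T -> set (set T)) :
  (forall B x, D B -> B x -> exists2 W, N x W & W `<=` B) ->
  (forall x, N x !=set0) ->
  (forall x V W, N x V -> N x W -> exists2 U, N x U & U `<=` V `&` W) ->
  (forall x W, N x W -> exists2 B, D B & B x /\ B `<=` W) ->
  forall x A, nbhs_of_open
    [set \bigcup_(i in D') i | D' in subset^~ (finI_from D id)] x A <->
    exists2 W, N x W & W `<=` A.
Proof.
move=> DN N0 NI ND x A; split=> [[_ [[D' D'D <-] [G D'G Gx] GA]]|[W NW WA]].
  have [S SD GE] := D'D _ D'G.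
  have fin (s : seq (set T)) : (forall B, B \in s -> D B /\ B x) ->
      exists2 W, N x W & forall y B, W y -> B \in s -> B y.
    elim: s => [|B s IH] sD; first by have [W NW] := N0 x; exists W.
    have [|V NV VS] := IH; first by move=> C Cs; apply: sD; rewrite inE Cs orbT.
    have [DB Bx] := sD B (mem_head _ _); have [W NW WB] := DN B x DB Bx.
    have [U NU UVW] := NI _ _ _ NV NW; exists U => // y C /UVW[Vy Wy].
    by rewrite inE => /orP[/eqP ->|]; [exact: WB|exact: VS].
  have [W NW WS] := fin (finmap.enum_fset S)
    (fun B BS => conj (set_mem (SD B BS)) (eq_ind_r (fun G => G x) Gx GE B BS)).
  by exists W => // y Wy; apply: GA; exists G => //; rewrite -GE => B BS; exact: WS Wy BS.
have [B DB [Bx BW]] := ND _ _ NW.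
exists B; split=> //; last exact: subset_trans WA.
exists [set B]; last by rewrite bigcup_set1.
move=> _ ->; exists (finmap.fset1 B); first by move=> C; rewrite finmap.in_fset1 => /eqP ->; exact: mem_set.
by rewrite set_fset1 bigcap_set1.
Qed.

Lemma finite_pos {R : realType} (T : choiceType) (S : set T) (Q : T -> R -> Prop) :
  finite_set S -> (forall y e e', 0 < e' -> e' <= e -> Q y e -> Q y e') ->
  (forall x, S x -> exists2 e, 0 < e & Q x e) ->
  exists2 e, 0 < e & forall y, S y -> Q y e.
Proof.
move=> /finite_seqP[s ->] Qmono; elim: s => [|x s IH] Qex; first by exists 1.
have [|e e0 es] := IH; first by move=> y ys; apply: Qex; rewrite /= inE ys orbT.
have [e' e'0 ex] := Qex x (mem_head _ _).
exists (Num.min e e'); first by rewrite lt_min e0.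
move=> y; rewrite /= inE => /orP[/eqP ->|ys].
  by apply: Qmono ex; rewrite ?lt_min ?e0 // ge_min lexx orbT.
by apply: Qmono (es _ ys); rewrite ?lt_min ?e0 // ge_min lexx.
Qed.

Lemma add_halves_lt {R : realFieldType} (e p q s d : R) :
  p < d / 2 -> q <= e - d + s -> s < d / 2 -> p + q < e.
Proof. by lra. Qed.

Lemma mul_small_lt {R : realFieldType} (e d M M' p q s t : R) :
  0 <= p -> 0 <= q -> 0 <= s -> 0 <= t -> p < d -> q < d -> d <= 1 ->
  s <= M -> t <= M' -> d * (M + M' + 1) <= e -> p * q + p * t + s * q < e.
Proof.
move=> p0 q0 s0 t0 pd qd d1 sM tM de; apply: lt_le_trans de.
have d0 : 0 <= d := le_trans p0 (ltW pd).
have h1 : p * q <= p by rewrite ler_piMr // ltW // (lt_le_trans qd).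
have h2 : p * t <= d * M' by rewrite ler_pM // ltW.
have h3 : s * q <= M * d by rewrite ler_pM // ltW.
by lra.
Qed.

Lemma three_thirds_lt {R : realFieldType} (e p q s t : R) :
  p <= e / 3 -> q < e / 3 -> s <= e / 3 -> t <= p + q + s -> t < e.
Proof. by lra. Qed.

Lemma mul_difference (A : comPzRingType) (a b a' b' : A) :
  a' * b' - a * b = (a' - a) * (b' - b) + (a' - a) * b + a * (b' - b).
Proof. by ring. Qed.

Lemma truncate_subadd {R : realFieldType} (p q : R) : 0 <= p -> 0 <= q ->
  (if 1 < p + q then 1 else p + q) <=
  (if 1 < p then 1 else p) + (if 1 < q then 1 else q).
Proof.
by move=> p0 q0; case: (ltrP 1 p); case: (ltrP 1 q); case: (ltrP 1 (p + q)) => *; lra.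
Qed.

Lemma set_type_nbhs (T : topologicalType) (A : set T) (x : A) (U : set A) :
  nbhs x U <-> exists2 B, nbhs (val x) B & forall z : A, B (val z) -> U z.
Proof.
split=> [[_ [[W oW <-] Wx WU]]|[B]].
  by exists W => [|z Wz]; [move: oW; rewrite openE; exact|exact: WU].
rewrite nbhsE => -[W [oW Wx] WB] BU; exists (set_val @^-1` W); split.
- by exists W.
- exact: Wx.
- by move=> z Wz; apply: BU; exact: WB.
Qed.


(** * The space of places of the infinite extension *)

Section PlacesOfE.
Context {R : realType} {E : fieldType} {F : subfield E}.
Variable nF : place R (subfield_type F) -> absval R (subfield_type F).
Hypothesis E_galois : galois_ext (val : subfield_type F -> E).
Hypothesis nF_in : forall p : place R (subfield_type F), val p (nF p).
Local Notation Y := (top_place R F).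
Implicit Types (K L M : finite_galois F) (x y z : Y).

Lemma alg_base : algebraic_ext (val : subfield_type F -> E).
Proof. by have [] := E_galois. Qed.

Lemma alg_top K : algebraic_ext (val : subfield_type K -> E).
Proof. move=> x; apply: (algebraicOver_up (fg_sub K)); exact: alg_base. Qed.

Lemma alg_fin K : algebraic_ext (incl_subfield (fg_sub K)).
Proof. by have [] := fg_galois K. Qed.

Lemma alg_rel K L (KL : K `<=` L) : algebraic_ext (incl_subfield KL).
Proof. by have [_ []] := fg_relative KL. Qed.

Arguments alg_top : clear implicits.
Arguments alg_fin : clear implicits.
Arguments alg_rel {K L} KL.

Lemma fin_av_in K (v : fin_place R K) : val v (fin_av nF v).
Proof. exact: (place_av_in (alg_fin K) nF_in). Qed.

Lemma top_av_in y : val y (top_av nF y).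
Proof. exact: (place_av_in alg_base nF_in). Qed.

Definition res K y : fin_place R K := projT1 (cid (place_below y (alg_top K))).

Lemma resP K y : places_over (res K y) y.
Proof. by rewrite /res; case: cid. Qed.

Arguments resP : clear implicits.

Lemma res_uniq K y (v : fin_place R K) : places_over v y -> res K y = v.
Proof. exact/lies_over_uniq/resP. Qed.

Lemma places_overE K (v : fin_place R K) y : places_over v y <-> res K y = v.
Proof. by split=> [/res_uniq //|<-]; exact: resP. Qed.

Lemma res_rel K L (KL : K `<=` L) y :
  lies_over (incl_subfield KL) (res L y) (res K y).
Proof.
apply: (@lies_over_mid R _ _ _ (incl_subfield KL)
  (val : {rmorphism subfield_type L -> E}) (val : {rmorphism subfield_type K -> E}) y).
- exact: val_incl.
- exact: resP.
- exact: resP.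
Qed.

Arguments res_rel {K L} KL y.

Lemma res_coarser K L y z : K `<=` L -> res L y = res L z -> res K y = res K z.
Proof.
move=> KL yz; apply: lies_over_uniq (res_rel KL y) _.
by rewrite yz; exact: res_rel.
Qed.

Lemma top_av_res K y c : top_av nF y (val c) = fin_av nF (res K y) c.
Proof.
have [p yp] := place_below y alg_base.
have rp : lies_over (incl_subfield (fg_sub K)) (res K y) p.
  exact: lies_over_mid (val_incl (fg_sub K)) (resP K y) yp.
rewrite /fin_av (place_av_uniq (alg_fin K) nF_in
  (a := av_comp (val : {rmorphism subfield_type K -> E}) (top_av nF y)) _ rp) //.
  exact/resP/top_av_in.
by move=> x; exact: (place_avE alg_base nF_in yp).
Qed.

Lemma fin_av_rel K L (KL : K `<=` L) (w : fin_place R L) (v : fin_place R K) c :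
  lies_over (incl_subfield KL) w v ->
  fin_av nF w (incl_subfield KL c) = fin_av nF v c.
Proof.
move=> wv; have [p wp] := place_below w (alg_fin L).
have vp : lies_over (incl_subfield (fg_sub K)) v p.
  by apply: lies_over_mid wv wp => x; exact: val_inj.
rewrite [in RHS]/fin_av (place_av_uniq (alg_fin K) nF_in
  (a := av_comp (incl_subfield KL) (fin_av nF w)) _ vp) //.
  exact/wv/fin_av_in.
move=> x; rewrite -(place_avE (alg_fin L) nF_in wp) /=; congr (fin_av nF w _).
exact: val_inj.
Qed.

Lemma nonarch_res K y :
  nonarchimedean (top_av nF y) <-> nonarchimedean (fin_av nF (res K y)).
Proof.
have H (n : nat) : top_av nF y n%:R = fin_av nF (res K y) n%:R.
  by rewrite -top_av_res rmorph_nat.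
by split=> /nonarch_natP h; apply/nonarch_natP => n; rewrite ?H // -H.
Qed.

Lemma place_above K (v : fin_place R K) : exists y : Y, res K y = v.
Proof.
have [a aE] := absval_extension (fin_av nF v) (alg_top K).
have na : av_nontrivial a.
  have [c c0 vc] := place_nontrivial (fin_av_in v).
  by exists (val c); rewrite ?fmorph_eq0 // aE.
exists (place_of na); apply: res_uniq; apply: lies_overI (place_ofP na) _.
have -> : av_comp (val : {rmorphism subfield_type K -> E}) a = fin_av nF v.
  by apply: absval_ext => c; exact: aE.
exact: fin_av_in.
Qed.

(** Pass through a compositum [M]: going up to [M] has finite fibres, and going
    down to [L] is a map. *)
Lemma finite_res_rel K L (S : set (fin_place R K)) : finite_set S ->
  finite_set [set v : fin_place R L | exists2 y : Y, S (res K y) & res L y = v].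
Proof.
move=> finS; have [M [KM LM]] := fg_compositum E_galois K L.
pose below (w : fin_place R M) : fin_place R L := projT1 (cid (place_below w (alg_rel LM))).
pose T := \bigcup_(v in S) [set w : fin_place R M | lies_over (incl_subfield KM) w v].
apply: (@sub_finite_set _ _ (below @` T)); last first.
  apply/finite_image/bigcup_finite => // v _.
  by apply: finite_places_above; have [] := fg_relative KM.
move=> _ [y Sy <-]; exists (res M y); first by exists (res K y) => //; exact: res_rel.
apply: lies_over_uniq (res_rel LM y).
by rewrite /below; case: cid.
Qed.

Lemma nbhs_place y (A : set Y) :
  nbhs y A <-> exists K, forall z, res K z = res K y -> A z.
Proof.
pose N y : set (set Y) := [set W | exists K, W = places_over (res K y)].
have : nbhs y A <-> exists2 W, N y W & W `<=` A.
  apply: (@subbase_nbhs Y (@top_place_basis R E F) N).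
  - move=> _ x [K [v ->]] xv; exists (places_over (res K x)); first by exists K.
    by move=> z; rewrite (res_uniq xv).
  - by move=> x; have [K _] := fg_containing E_galois [::]; exists (places_over (res K x)), K.
  - move=> x _ _ [K ->] [L ->]; have [M [KM LM]] := fg_compositum E_galois K L.
    exists (places_over (res M x)); first by exists M.
    move=> z /places_overE zx; split; apply/places_overE.
      exact: res_coarser KM zx.
    exact: res_coarser LM zx.
  - move=> x _ [K ->]; exists (places_over (res K x)); last by split=> //; exact: resP.
    by exists K, (res K x).
move=> ->; split=> [[_ [K ->] KA]|[K KA]].
  by exists K => z /places_overE; exact: KA.
by exists (places_over (res K y)); [exists K|move=> z /places_overE; exact: KA].
Qed.

Lemma open_places_over K (v : fin_place R K) : open (places_over v).
Proof.
rewrite openE => y yv; apply/nbhs_place; exists K => z.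
by rewrite (res_uniq yv) => zy; apply/places_overE.
Qed.

Lemma nbhs_subtype (A : set Y) (x : A) (U : set A) :
  nbhs x U <-> exists K, forall z : A, res K (val z) = res K (val x) -> U z.
Proof.
split=> [[_ [[W oW <-] Wx WU]]|[K KU]].
  have /nbhs_place[K KW] : nbhs (val x) W by move: oW; rewrite openE; apply.
  by exists K => z zx; apply: WU; exact: KW.
exists (set_val @^-1` (places_over (res K (val x)))); split.
- by exists (places_over (res K (val x))) => //; exact: open_places_over.
- exact: resP.
- by move=> z /places_overE zx; exact: KU.
Qed.

(** An ultrafilter containing a finite union of fibres contains one of them. *)
Lemma ultra_fibre (T : eqType) (U : set_system Y) (f : Y -> T) (A : set Y) :
  UltraFilter U -> U A -> finite_set (f @` A) -> exists t, U [set y | f y = t].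
Proof.
move=> UU UA /finite_seqP[s sE]; apply: contrapT => H.
have UC t : U [set y | f y <> t].
  have [h|//] := in_ultra_setVsetC [set y | f y = t] UU.
  by exfalso; apply: H; exists t.
have Us : U [set y | f y \notin s].
  elim: (s) => [|t s' IH]; first by apply: filterS filterT.
  apply: filterS (filterI (UC t) IH) => y [yt ys'] /=.
  by rewrite inE negb_or ys' andbT; apply/eqP.
have [y [Ay ys]] := filter_ex (filterI UA Us).
by move/negP: ys; apply; have : [set` s] (f y) by rewrite -sE; exists y.
Qed.

(** Along an ultrafilter [U] on the fibre, the place below at each level [L] is
    eventually constant, as it ranges over a finite set. Hence so is the absolute
    value of each element [c] of [E], which is computed at a level containing [c].
    The resulting function [a] satisfies the axioms of an absolute value, because
    each axiom involves finitely many elements, and its place is the limit. *)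
Lemma compact_places_over K (v : fin_place R K) : compact (places_over v : set Y).
Proof.
rewrite compact_ultra => U UU Uv.
have fibre L : exists w : fin_place R L, U [set y | res L y = w].
  apply: (ultra_fibre UU Uv).
  apply: sub_finite_set (finite_res_rel L (finite_set1 v)).
  by move=> _ [y /res_uniq yv <-]; exists y.
pose w L := projT1 (cid (fibre L)).
have Uw L : U [set y | res L y = w L] by rewrite /w; case: cid.
have val_ex (c : E) : exists t, U [set y | top_av nF y c = t].
  have [L Lc] := fg_containing E_galois [:: c].
  have {}Lc : (L : set E) c by apply: Lc; rewrite mem_head.
  exists (fin_av nF (w L) (sf_in Lc)); apply: filterS (Uw L) => y /= <-.
  exact: top_av_res (sf_in Lc).
have /choice[a Ua] := val_ex.
have a_ge0 c : 0 <= a c.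
  by have [y /= <-] := filter_ex (Ua c); exact: av_ge0.
have a_eq0 c : a c = 0 <-> c = 0.
  by have [y /= <-] := filter_ex (Ua c); exact: av_eq0.
have aM c d : a (c * d) = a c * a d.
  have [y [/= [<- <-] <-]] := filter_ex (filterI (filterI (Ua c) (Ua d)) (Ua (c * d))).
  exact: avM.
have aD c d : a (c + d) <= a c + a d.
  have [y [/= [<- <-] <-]] := filter_ex (filterI (filterI (Ua c) (Ua d)) (Ua (c + d))).
  exact: avD.
pose b := AbsVal a_ge0 a_eq0 aM aD.
have bL L (c : subfield_type L) : b (val c) = fin_av nF (w L) c.
  have [y [/= yw <-]] := filter_ex (filterI (Uw L) (Ua (val c))).
  by rewrite top_av_res yw.
have bE L : av_comp (val : {rmorphism subfield_type L -> E}) b = fin_av nF (w L).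
  by apply: absval_ext => c; exact: bL.
have nb : av_nontrivial b.
  have [c c0 vc] := place_nontrivial (fin_av_in (w K)).
  by exists (val c); rewrite ?fmorph_eq0 // bL.
pose z : Y := place_of nb.
have zw L : res L z = w L.
  apply: res_uniq; apply: lies_overI (place_ofP nb) _.
  by rewrite bE; exact: fin_av_in.
exists z; split.
  apply/places_overE; rewrite zw.
  have [y [/= yw /res_uniq yv]] := filter_ex (filterI (Uw K) Uv).
  by rewrite -yw.
move=> A /nbhs_place[L LA]; apply: filterS (Uw L) => y /= yw.
by apply: LA; rewrite yw zw.
Qed.

Lemma fg_bigcompositum (s : seq (finite_galois F)) K :
  exists M, K `<=` M /\ forall k : nat, (k < size s)%N -> nth K s k `<=` M.
Proof.
elim: s => [|L s [M [KM sM]]]; first by exists K; split=> // x.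
have [M' [LM' MM']] := fg_compositum E_galois L M.
exists M'; split; first exact: subset_trans KM MM'.
by case=> [|k] //= ks; exact: subset_trans (sM _ ks) MM'.
Qed.

(** The finite subcover property for covers by cells [res L @^-1` v], proved by
    clustering the filter generated by complements of finite unions of cells. *)
Lemma compact_cells (Z : set Y) (lev : Y -> finite_galois F) : compact Z ->
  exists s : seq Y, forall y, Z y ->
    exists2 x, x \in s & Z x /\ res (lev x) y = res (lev x) x.
Proof.
move=> cZ; apply: contrapT => H.
pose out (s : seq Y) := [set y | Z y /\ forall x, x \in s -> Z x ->
  res (lev x) y <> res (lev x) x].
pose U := [set A : set Y | exists s, out s `<=` A].
have FU : ProperFilter U.
  apply: Build_ProperFilter_ex => [A [s sA]|].
    apply: contrapT => nA; apply: H; exists s => y Zy; apply: contrapT => Hy.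
    apply: nA; exists y; apply: sA; split=> // x xs Zx yx; apply: Hy.
    by exists x.
  split=> [|A B [s sA] [t tB]|A B AB [s sA]]; first by exists [::].
    exists (s ++ t) => y [Zy hy]; split; [apply: sA|apply: tB]; split=> // x xs;
      by apply: hy; rewrite mem_cat xs ?orbT.
  by exists s; exact: subset_trans AB.
have [|x [Zx clx]] := cZ U FU; first by exists [::] => y [].
have [|y [[Zy hy] yx]] := clx (out [:: x]) [set y | res (lev x) y = res (lev x) x] (ex_intro _ [:: x] (@subset_refl _ _)).
  by apply/nbhs_place; exists (lev x).
by apply: (hy x); rewrite ?mem_head.
Qed.

(** Compactness of sets of places in the two forms in which it is used: local
    uniformity at some finite level becomes global, and so do positive bounds. *)
Lemma uniform_level K (Z : set Y) (P : finite_galois F -> Y -> Prop) :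
  compact Z ->
  (forall x y L, res L x = res L y -> P L x -> P L y) ->
  (forall x L M, L `<=` M -> P L x -> P M x) ->
  (forall x, Z x -> exists L, P L x) ->
  exists L, K `<=` L /\ forall x, Z x -> P L x.
Proof.
move=> cZ Pcell Pmono Pex.
have /choice[lev Plev] : forall x, exists L, Z x -> P L x.
  by move=> x; have [/Pex[L]|] := pselect (Z x); [exists L|exists K].
have [s sP] := compact_cells lev cZ.
have [M [KM sM]] := fg_bigcompositum [seq lev x | x <- s] K.
exists M; split=> // y /sP[x xs [vx yx]].
have LM : lev x `<=` M.
  have := sM (index x s); rewrite size_map index_mem => /(_ xs).
  by rewrite (nth_map x) ?index_mem // nth_index.
by apply: (Pmono _ _ _ LM); apply: Pcell (esym yx) (Plev _ vx).
Qed.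

Lemma uniform_pos (Z : set Y) (Q : Y -> R -> Prop) : compact Z ->
  (forall y e e', 0 < e' -> e' <= e -> Q y e -> Q y e') ->
  (forall x, Z x -> exists L, exists2 e, 0 < e &
    forall y, Z y -> res L y = res L x -> Q y e) ->
  exists2 e, 0 < e & forall y, Z y -> Q y e.
Proof.
move=> cZ Qmono Qex.
have [K0 _] := fg_containing E_galois [::].
have /choice[p hp] : forall x, exists p : finite_galois F * R,
    0 < p.2 /\ (Z x -> forall y, Z y -> res p.1 y = res p.1 x -> Q y p.2).
  move=> x; have [/Qex[L [e e0 h]]|nv] := pselect (Z x).
    by exists (L, e).
  by exists (K0, 1).
have [s sP] := compact_cells (fun x => (p x).1) cZ.
have [e e0 es] : exists2 e : R, 0 < e & forall x, x \in s -> e <= (p x).2.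
  elim: (s) => [|x s' [e e0 es]]; first by exists 1.
  have [px0 _] := hp x; exists (Num.min e (p x).2); first by rewrite lt_min e0.
  move=> y; rewrite inE => /orP[/eqP ->|ys]; first by rewrite ge_min lexx orbT.
  by rewrite ge_min es.
exists e => // y vy; have [x xs [vx yx]] := sP y vy.
by apply: Qmono e0 (es _ xs) _; have [_] := hp x; apply.
Qed.

Lemma compact_finite_places K (Z : set Y) : compact Z ->
  exists2 S : set (fin_place R K), finite_set S & forall y, Z y -> S (res K y).
Proof.
move=> /(compact_cells (fun=> K))[s sZ]; exists [set` [seq res K x | x <- s]].
  exact: finite_seq.
by move=> y /sZ[x xs [_ ->]] /=; rewrite map_f.
Qed.

Lemma compact_places_finite K (S : set (fin_place R K)) : finite_set S ->
  compact [set y : Y | S (res K y)].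
Proof.
move=> /finite_seqP[s ->].
have -> : [set y : Y | [set` s] (res K y)] = \big[setU/set0]_(v <- s) (places_over v : set Y).
  apply/seteqP; split=> y /=.
    elim: s => [|v s IH]; first by rewrite in_nil.
    rewrite inE big_cons => /orP[/eqP yv|/IH ys]; last by right.
    by left; apply/places_overE.
  elim: s => [|v s IH]; first by rewrite big_nil.
  rewrite big_cons inE => -[/res_uniq ->|/IH ->]; first by rewrite eqxx.
  by rewrite orbT.
by apply: bigsetU_compact => v _; exact: compact_places_over.
Qed.

Hypothesis F_global : global_field (subfield_type F).

Lemma few_fin_places K : @few_places R (subfield_type K).
Proof. by apply: few_places_ext (fg_finite K) _; exact: few_places_global. Qed.

Lemma finite_arch K :
  finite_set [set v : fin_place R K | ~ nonarchimedean (fin_av nF v)].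
Proof.
apply: sub_finite_set (few_fin_places K).2 => v nv.
by exists (fin_av nF v) => //; exact: fin_av_in.
Qed.


(** * The ring *)

Definition over K (v : fin_place R K) y (vy : places_over v y) : places_over v :=
  exist _ y (mem_set vy).

Lemma over_places K (v : fin_place R K) (y : places_over v) : places_over v (val y).
Proof. exact: set_mem (valP y). Qed.

Lemma res_over K (v : fin_place R K) (y : places_over v) : res K (val y) = v.
Proof. exact/res_uniq/over_places. Qed.

Variable K0 : finite_galois F.
Variable lam : forall v : fin_place R K0, transition_diagram nF v.
Variable r : forall v : fin_place R K0, places_over v.
Local Notation rho y := (@to_ref R E F nF K0 lam r _ y).
Implicit Types (a b : dprod (top_completion nF)).

Lemma to_ref_compat (v : fin_place R K0) (y : places_over v) c :
  top_av nF (val (r v)) (lam v y (r v) c) = top_av nF (val y) c.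
Proof. exact: td_place. Qed.

Lemma rhoB (v : fin_place R K0) (y : places_over v) : {morph rho y : s t / s - t}.
Proof. exact/completion_mapB/to_ref_compat. Qed.
Lemma rhoM (v : fin_place R K0) (y : places_over v) : {morph rho y : s t / s * t}.
Proof. exact/completion_mapM/to_ref_compat. Qed.
Lemma rho1 (v : fin_place R K0) (y : places_over v) : rho y 1 = 1.
Proof. exact/completion_map1/to_ref_compat. Qed.
Lemma rho_av (v : fin_place R K0) (y : places_over v) s : completion_av _ (rho y s) = completion_av _ s.
Proof. exact/completion_map_av/to_ref_compat. Qed.
Lemma rho_inj (v : fin_place R K0) (y : places_over v) : injective (rho y).
Proof. exact/completion_map_injective/to_ref_compat. Qed.
Arguments rhoB {v} y _ _.
Arguments rho_av {v} y _.
Lemma rho_surj (v : fin_place R K0) (y : places_over v) t : exists s, rho y s = t.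
Proof.
exists (completion_map (lam v (r v) y) (top_av nF (val (r v))) (top_av nF (val y)) t).
rewrite /to_ref -(@completion_map_comp _ _ _ _ (lam v (r v) y) (lam v y (r v))
  (lam v (r v) (r v))).
- by apply: completion_map_id => c; exact: td_id.
- by move=> c; exact: td_place.
- exact: to_ref_compat.
- by move=> c; rewrite td_comp.
Qed.

Definition transport_continuous (v : fin_place R K0) a :=
  forall (x : places_over v) (e : R), 0 < e -> exists L, forall y : places_over v,
    res L (val y) = res L (val x) ->
    completion_av _ (rho y (a (val y)) - rho x (a (val x))) < e.

(** A neighbourhood of [x] in a fibre is given by a finite level [L], one in the
    completion by a radius [e]. *)
Lemma transport_continuousP v a :
  continuous (fun y : places_over v => rho y (a (val y))) <-> transport_continuous v a.
Proof.
split=> [ca x e e0|ca x A].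
  have := ca x (fun t => completion_av _ (rho x (a (val x)) - t) < e).
  have nb : nbhs (rho x (a (val x))) (fun t => completion_av _ (rho x (a (val x)) - t) < e).
    by apply/completion_nbhsP; exists e.
  move=> /(_ nb)/nbhs_subtype[L hL]; exists L => y /hL.
  by rewrite av_distC.
move=> /completion_nbhsP[e e0 eA]; have [L hL] := ca x e e0.
by apply/nbhs_subtype; exists L => y /hL yx; apply: eA; rewrite av_distC.
Qed.

Definition integral_outside (S : set (fin_place R K0)) a :=
  forall y, ~ S (res K0 y) -> completion_av _ (a y : completion (top_av nF y)) <= 1.

(** Compact sets of places may be replaced by the sets of all places above a
    finite set of places of [K0]. *)
Lemma VbarP a : Vbar lam r a <->
  (exists2 S, finite_set S & integral_outside S a) /\
  forall v, transport_continuous v a.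
Proof.
split=> [[[Z cZ aZ] ca]|[[S finS aS] ca]]; split.
- have [S finS ZS] := compact_finite_places K0 cZ.
  by exists S => // y Sy; apply: aZ => /ZS.
- by move=> v; apply/transport_continuousP; exact: ca.
- exists [set y : Y | S (res K0 y)]; first exact: compact_places_finite.
  by move=> y /aS.
- by move=> v; apply/transport_continuousP.
Qed.

Let arch := [set v : fin_place R K0 | ~ nonarchimedean (fin_av nF v)].
Let finite_arch0 : finite_set arch.
Proof. exact: finite_arch. Qed.

Lemma nonarch_outside (S : set (fin_place R K0)) y : arch `<=` S -> ~ S (res K0 y) ->
  nonarchimedean (completion_av (top_av nF y)).
Proof.
move=> aS Sy; apply/completion_nonarchP/(nonarch_res K0).
by apply: contrapT => h; apply: Sy; exact: aS.
Qed.

(** Integrality of a difference requires the ultrametric inequality; for this the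
    finitely many archimedean places are added to the exceptional set. *)
Lemma Vbar_subring : subring_closed (mem (Vbar lam r)).
Proof.
split.
- apply/mem_set/VbarP; split.
    by exists set0 => // y _; rewrite [X in completion_av _ X]dprod1 av1.
  move=> v x e e0; exists K0 => y _.
  by rewrite !dprod1 !rho1 subrr av0.
- move=> a b /set_mem/VbarP[[S finS aS] ca] /set_mem/VbarP[[T finT bT] cb].
  apply/mem_set/VbarP; split.
    exists (S `|` T `|` arch); first by rewrite !finite_setU.
    move=> y yS; have na := nonarch_outside (@subsetUr _ _ _) yS.
    rewrite dprodB; apply: le_trans (na _ _) _; rewrite avN ge_max.
    by rewrite aS ?bT // => h; apply: yS; left; [right|left].
  move=> v x e e0; have e20 : 0 < e / 2 by rewrite divr_gt0.
  have [L1 h1] := ca v x _ e20; have [L2 h2] := cb v x _ e20.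
  have [M [L1M L2M]] := fg_compositum E_galois L1 L2; exists M => y yx.
  have {}h1 := h1 y (res_coarser L1M yx); have {}h2 := h2 y (res_coarser L2M yx).
  rewrite !dprodB !rhoB; move: h1 h2.
  set s := rho y (a _); set t := rho y (b _); set s0 := rho x _; set t0 := rho x _.
  have -> : s - t - (s0 - t0) = (s - s0) + - (t - t0) by ring.
  move=> h1 h2; rewrite (le_lt_trans (avD _ _ _)) // avN [ltRHS]splitr.
  exact: ltrD.
- move=> a b /set_mem/VbarP[[S finS aS] ca] /set_mem/VbarP[[T finT bT] cb].
  apply/mem_set/VbarP; split.
    exists (S `|` T); first by rewrite !finite_setU.
    move=> y yS; rewrite dprodM avM mulr_ile1 ?av_ge0 //.
      by apply: aS => h; apply: yS; left.
    by apply: bT => h; apply: yS; right.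
  move=> v x e e0.
  pose s0 := rho x (a (val x)); pose t0 := rho x (b (val x)).
  pose A := completion_av _ s0; pose B := completion_av _ t0.
  have A0 : 0 <= A := av_ge0 _ _; have B0 : 0 <= B := av_ge0 _ _.
  have AB : 0 < A + B + 1 by lra.
  have e1 : 0 < Num.min 1 (e / (A + B + 1)) by rewrite lt_min ltr01 divr_gt0.
  set e' := Num.min _ _ in e1.
  have [L1 h1] := ca v x _ e1; have [L2 h2] := cb v x _ e1.
  have [M [L1M L2M]] := fg_compositum E_galois L1 L2; exists M => y yx.
  have {}h1 := h1 y (res_coarser L1M yx); have {}h2 := h2 y (res_coarser L2M yx).
  rewrite !dprodM !rhoM -/s0 -/t0; rewrite -/s0 in h1; rewrite -/t0 in h2.
  move: h1 h2; set s := rho y (a (val y)); set t := rho y (b (val y)) => h1 h2.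
  have -> : s * t - s0 * t0 = (s - s0) * (t - t0) + (s - s0) * t0 + s0 * (t - t0) by ring.
  apply: le_lt_trans (avD _ _ _) _.
  apply: le_lt_trans (lerD (avD _ _ _) (lexx _)) _.
  rewrite !avM -/A -/B.
  have e'1 : e' <= 1 by rewrite ge_min lexx.
  have e'e : e' * (A + B + 1) <= e by rewrite -ler_pdivlMr // ge_min lexx orbT.
  set X := completion_av _ (s - s0) in h1 *; set W := completion_av _ (t - t0) in h2 *.
  have X0 : 0 <= X := av_ge0 _ _; have W0 : 0 <= W := av_ge0 _ _.
  have p1 : X * W <= X by rewrite ler_piMr // ltW // (lt_le_trans h2).
  have p2 : X * B <= e' * B by rewrite ler_wpM2r // ltW.
  have p3 : A * W <= A * e' by rewrite ler_wpM2l // ltW.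
  by lra.
Qed.

(** * A base of neighbourhoods *)

Lemma av_triangle (L : fieldType) (a : absval R L) s t u :
  a (s - u) <= a (s - t) + a (t - u).
Proof. by have := avD a (s - t) (t - u); rewrite addrA subrK. Qed.

Local Notation V := (Vbar_ring Vbar_subring).

(** As only [b - a] occurs, this relation is translation invariant, unlike the
    basic open sets, which ask for integrality of [b] itself. The two agree where
    [a] is integral and the place is nonarchimedean, so [S] has to contain the
    archimedean places, where the unit ball is neither open nor a subgroup. *)
Definition near_on (S : set (fin_place R K0)) (e : R) a b := forall y,
  (S (res K0 y) -> completion_av (top_av nF y) (b y - a y) < e) /\
  (~ S (res K0 y) -> completion_av (top_av nF y) (b y - a y) <= 1).

Definition Vnbhd S e (a : V) : set V := [set b : V | near_on S e (val a) (val b)].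

Lemma near_on_mono (S T : set (fin_place R K0)) (e e' : R) a b :
  S `<=` T -> e' <= e -> e' <= 1 -> near_on T e' a b -> near_on S e a b.
Proof.
move=> ST e'e e'1 H y; have [HT HnT] := H y; split=> [/ST/HT h|nS].
  exact: lt_le_trans e'e.
have [/HT h|/HnT //] := pselect (T (res K0 y)).
exact: ltW (lt_le_trans h e'1).
Qed.

Lemma V_transport (a : V) v : transport_continuous v (val a).
Proof. by have /set_mem/VbarP[_] := valP a; apply. Qed.

Lemma V_integral (a : V) : exists S, [/\ finite_set S, arch `<=` S &
  integral_outside S (val a)].
Proof.
have /set_mem/VbarP[[S finS aS] _] := valP a.
exists (S `|` arch); split; [by rewrite finite_setU|exact: subsetUr|].
by move=> y yS; apply: aS => h; apply: yS; left.
Qed.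

Lemma compact_over (S : set (fin_place R K0)) : finite_set S ->
  compact [set y : Y | S (res K0 y)].
Proof. exact: compact_places_finite. Qed.

(** Above each place of [S] an open set of the product topology contains a ball
    whose radius, measured after transport, is locally uniform in the place; by
    compactness of the places above [S] one radius serves for all. *)
Lemma Vbasis_contains_nbhd (B : set V) (a : V) : @Vbar_basis R E F nF K0 lam r Vbar_subring B -> B a ->
  exists S e, [/\ finite_set S, arch `<=` S, 0 < e, e <= 1 & Vnbhd S e a `<=` B].
Proof.
move=> [U [[Z cZ UZ] Uop ->]] aU.
have [S finS ZS] := compact_finite_places K0 cZ.
have finSa : finite_set (S `|` arch) by rewrite finite_setU.
have [] := @uniform_pos [set y : Y | (S `|` arch) (res K0 y)]
  (fun y e => forall u : completion (top_av nF y),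
     completion_av _ (u - val a y) < e -> U y u) (compact_over finSa).
- by move=> y e e' e'0 e'e H u hu; apply: H; exact: lt_le_trans e'e.
- move=> x Sx; pose v := res K0 x; pose x' : places_over v := over (resP K0 x).
  have := Uop v; rewrite openE => /(_ (x', rho x' (val a x)))[].
    by exists (val a x) => //; exact: aU.
  move=> [A1 A2] [/= /nbhs_subtype[L1 hL1] /completion_nbhsP[e2 e20 hA2]] AW.
  have e220 : 0 < e2 / 2 by rewrite divr_gt0.
  have [L2 hL2] := V_transport a x' e220.
  have [L3 [KL3 L13]] := fg_compositum E_galois K0 L1.
  have [L [L3L L2L]] := fg_compositum E_galois L3 L2.
  exists L, (e2 / 2) => // y _ yx u hu.
  have yx3 := res_coarser L3L yx.
  have vy : places_over v y by apply/places_overE; exact: res_coarser KL3 yx3.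
  pose y' : places_over v := over vy.
  have [|u' Uu' /rho_inj -> //] := AW (y', rho y' u).
  split=> /=; first by apply: hL1 => /=; exact: res_coarser L13 yx3.
  apply: hA2; rewrite av_distC.
  apply: le_lt_trans (av_triangle _ _ (rho y' (val a y)) _) _.
  rewrite [ltRHS]splitr; apply: ltrD; last exact: (hL2 y' (res_coarser L2L yx)).
  have -> := esym (rhoB y' u (val a y)); rewrite rho_av; exact: hu.
move=> e e0 He; exists (S `|` arch), (Num.min e 1); split=> //.
- by rewrite lt_min e0 ltr01.
- by rewrite ge_min lexx orbT.
move=> b ab y; have [h1 h2] := ab y.
have [Sy|Sy] := pselect ((S `|` arch) (res K0 y)).
  by apply: (He _ Sy); apply: lt_le_trans (h1 Sy) _; rewrite ge_min lexx.
have Zy : ~ Z y by move=> /ZS h; apply: Sy; left.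
have na := nonarch_outside (@subsetUr _ _ _) Sy.
have := aU y; rewrite UZ // => ay; rewrite /top_O /=.
rewrite -[val b y](subrK (val a y)); apply: le_trans (na _ _) _.
by rewrite ge_max h2.
Qed.

(** Enlarge [S] to a set [T] outside of which [a] is integral. There [|b - a| <= 1]
    means that [b] is integral, and on [T] the balls of radius [e] around the
    coordinates of [a] move continuously, so both conditions define a basic set. *)
Lemma nbhd_contains_Vbasis S e (a : V) : finite_set S -> 0 < e -> e <= 1 ->
  exists2 B : set V, @Vbar_basis R E F nF K0 lam r Vbar_subring B & B a /\ B `<=` Vnbhd S e a.
Proof.
move=> finS e0 e1; have [T0 [finT0 archT aT]] := V_integral a.
pose T := S `|` T0.
have finT : finite_set T by rewrite finite_setU.
pose U y : set (completion (top_av nF y)) := [set u |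
  (T (res K0 y) -> completion_av _ (u - val a y) < e) /\
  (~ T (res K0 y) -> completion_av _ u <= 1)].
exists [set b : V | forall y, U y (val b y)].
  exists U; split=> //.
    exists [set y : Y | T (res K0 y)]; first exact: compact_over.
    move=> y Ty; apply/seteqP; split=> u; first by move=> [_]; exact.
    by move=> uO; split.
  move=> v; rewrite openE => -[y m] /= [u [Uu1 Uu2] mE].
  have vy : res K0 (val y) = v := res_over y.
  have [Tv|Tv] := pselect (T v).
    have {}Uu1 : completion_av _ (u - val a (val y)) < e by apply: Uu1; rewrite vy.
    pose d := e - completion_av _ (u - val a (val y)).
    have d20 : 0 < d / 2 by rewrite divr_gt0 // subr_gt0.
    have [L hL] := V_transport a y d20.
    exists ([set z : places_over v | res L (val z) = res L (val y)],
            [set m' | completion_av _ (m - m') < d / 2]).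
      split=> /=; first by apply/nbhs_subtype; exists L.
      by apply/completion_nbhsP; exists (d / 2).
    move=> [z m'] /= [zy mm']; have [u' u'm] := rho_surj z m'.
    exists u'; last exact/esym; split=> [_|nT]; last by case: nT; rewrite res_over.
    rewrite -(rho_av z) rhoB u'm.
    have t1 := av_triangle (completion_av _) m' m (rho z (val a (val z))).
    have t2 := av_triangle (completion_av _) m (rho y (val a (val y))) (rho z (val a (val z))).
    have t3 := hL z zy; rewrite av_distC in t3.
    have t4 : completion_av _ (m - rho y (val a (val y))) = e - d.
      have -> := congr1 (fun m => m - _) mE.
      by rewrite -(rhoB y u (val a (val y))) rho_av /d subKr.
    rewrite [X in _ <= X + _]av_distC in t1; rewrite t4 in t2.
    exact: le_lt_trans t1 (add_halves_lt mm' t2 t3).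
  have na : nonarchimedean (completion_av (top_av nF (val (r v)))).
    apply: (@nonarch_outside T) => [w aw|]; first by right; exact: archT.
    by rewrite res_over.
  exists ([set: places_over v], [set m' | completion_av _ (m - m') < 1]).
    split=> /=; first exact: filterT.
    by apply/completion_nbhsP; exists 1.
  move=> [z m'] /= [_ mm']; have [u' u'm] := rho_surj z m'.
  exists u'; last exact/esym; split=> [Tz|_]; first by case: Tv; rewrite res_over in Tz.
  rewrite -(rho_av z) u'm -[m'](subrK m); apply: le_trans (na _ _) _.
  rewrite ge_max; apply/andP; split; first by rewrite av_distC ltW.
  have -> : completion_av _ m = completion_av _ u by rewrite mE; exact: rho_av.
  by apply: Uu2; rewrite vy.
split=> [y|b bU y]; split=> hy.
- by rewrite subrr av0.
- by apply: aT => h; apply: hy; right.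
- by have [h _] := bU y; apply: h; left.
have [h1 h2] := bU y.
have [Ty|Ty] := pselect (T (res K0 y)); first exact: ltW (lt_le_trans (h1 Ty) e1).
have na : nonarchimedean (completion_av (top_av nF y)).
  by apply: (@nonarch_outside T) => // w aw; right; exact: archT.
apply: le_trans (na _ _) _; rewrite avN ge_max h2 //=.
by apply: aT => h; apply: Ty; right.
Qed.

Lemma Vbar_nbhs (a : V) (A : set V) :
  nbhs a A <-> exists S e, [/\ finite_set S, arch `<=` S, 0 < e, e <= 1 & Vnbhd S e a `<=` A].
Proof.
pose N (a : V) : set (set V) := [set W | exists S e,
  [/\ finite_set S, arch `<=` S, 0 < e, e <= 1 & W = Vnbhd S e a]].
have : nbhs a A <-> exists2 W, N a W & W `<=` A.
  apply: (@subbase_nbhs V (@Vbar_basis R E F nF K0 lam r Vbar_subring) N).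
  - move=> B b BB Bb; have [S [e [? ? ? ? SB]]] := Vbasis_contains_nbhd BB Bb.
    by exists (Vnbhd S e b) => //; exists S, e.
  - by move=> b; exists (Vnbhd arch 1 b), arch, 1; split.
  - move=> b _ _ [S [e [finS aS e0 e1 ->]]] [T [d [finT aT d0 d1 ->]]].
    exists (Vnbhd (S `|` T) (Num.min e d) b).
      exists (S `|` T), (Num.min e d); split=> //.
      + by rewrite finite_setU.
      + by move=> v /aS; left.
      + by rewrite lt_min e0.
      + by rewrite ge_min e1.
    have ed1 : Num.min e d <= 1 by rewrite ge_min e1.
    move=> c bc; split; apply: (near_on_mono _ _ ed1 bc).
    + exact: subsetUl.
    + by rewrite ge_min lexx.
    + exact: subsetUr.
    + by rewrite ge_min lexx orbT.
  - by move=> b _ [S [e [finS aS e0 e1 ->]]]; exact: nbhd_contains_Vbasis.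
move=> ->; split=> [[_ [S [e [? ? ? ? ->]]] WA]|[S [e [? ? ? ? SA]]]].
  by exists S, e.
by exists (Vnbhd S e a) => //; exists S, e.
Qed.

(** The absolute values of the coordinates are locally bounded, hence bounded above
    a finite set of places by compactness. The bound is [e^-1], which puts it in
    the form of [uniform_pos]. *)
Lemma V_bounded (a : V) (S : set (fin_place R K0)) : finite_set S ->
  exists2 M : R, 0 < M & forall y, S (res K0 y) -> completion_av (top_av nF y) (val a y) <= M.
Proof.
move=> finS.
have [] := @uniform_pos [set y : Y | S (res K0 y)]
  (fun y e => completion_av (top_av nF y) (val a y) <= e^-1) (compact_over finS).
- move=> y e e' e'0 e'e H; apply: (le_trans H).
  by rewrite lef_pV2 // posrE // (lt_le_trans e'0).
- move=> x Sx; pose v := res K0 x; pose x' : places_over v := over (resP K0 x).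
  have [L hL] := V_transport a x' ltr01.
  have [M [KM LM]] := fg_compositum E_galois K0 L.
  have c0 : 0 < completion_av (top_av nF x) (val a x) + 1 by rewrite ltr_wpDl ?av_ge0.
  exists M, (completion_av (top_av nF x) (val a x) + 1)^-1; first by rewrite invr_gt0.
  move=> y _ yx; rewrite invrK.
  have vy : places_over v y by apply/places_overE; exact: res_coarser KM yx.
  pose y' : places_over v := over vy.
  have h := hL y' (res_coarser LM yx).
  have step : completion_av _ (rho y' (val a y)) <= completion_av _ (rho x' (val a x)) + 1.
    have := avD (completion_av _) (rho y' (val a y) - rho x' (val a x)) (rho x' (val a x)).
    by rewrite subrK => /le_trans; apply; rewrite addrC lerD2l ltW.
  have ey : completion_av _ (rho y' (val a y)) = completion_av (top_av nF y) (val a y).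
    exact: rho_av.
  have ex : completion_av _ (rho x' (val a x)) = completion_av (top_av nF x) (val a x).
    exact: rho_av.
  by rewrite ey ex in step.
by move=> e e0 H; exists e^-1; rewrite ?invr_gt0.
Qed.

(** * The topological ring and its completeness *)

Lemma V_topological : topological_ring V.
Proof.
split.
- move=> [a b] A /= /Vbar_nbhs[S [e [finS aS e0 e1 SA]]].
  have e20 : 0 < e / 2 by rewrite divr_gt0.
  have e21 : e / 2 <= 1 by rewrite ler_pdivrMr // mul1r (le_trans e1) // ler1n.
  exists (Vnbhd S (e / 2) a, Vnbhd S (e / 2) b).
    by split=> /=; apply/Vbar_nbhs; exists S, (e / 2); split.
  move=> [a' b'] /= [aa' bb']; apply: SA => y.
  have [h1 h2] := aa' y; have [k1 k2] := bb' y.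
  have -> : val (a' + b') y - val (a + b) y =
      (val a' y - val a y) + (val b' y - val b y) by rewrite addrACA -opprD.
  split=> Sy.
    apply: le_lt_trans (avD _ _ _) _.
    by rewrite [ltRHS]splitr; exact: ltrD (h1 Sy) (k1 Sy).
  apply: le_trans (nonarch_outside aS Sy _ _) _.
  by rewrite ge_max; apply/andP; split; [exact: h2|exact: k2].
- move=> a A /= /Vbar_nbhs[S [e [finS aS e0 e1 SA]]].
  apply/Vbar_nbhs; exists S, e; split=> // b ab; apply: SA => y.
  have [h1 h2] := ab y.
  have -> : val (- b) y - val (- a) y = - (val b y - val a y).
    by rewrite opprB opprK addrC.
  by rewrite avN.
- move=> [a b] A /= /Vbar_nbhs[S [e [finS aS e0 e1 SA]]].
  have [Sa [finSa _ intSa]] := V_integral a; have [Sb [finSb _ intSb]] := V_integral b.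
  pose T := S `|` (Sa `|` Sb).
  have finT : finite_set T by rewrite !finite_setU.
  have aT : arch `<=` T by move=> v /aS; left.
  have [M M0 hM] := V_bounded a finT; have [M' M'0 hM'] := V_bounded b finT.
  (* With [M] and [M'] bounding [a] and [b] on [T],
     [|a' b' - a b| <= d * d + d * M' + M * d <= d * (M + M' + 1) <= e]. *)
  pose d := Num.min 1 (e / (M + M' + 1)).
  have MM : 0 < M + M' + 1 by rewrite !addr_gt0.
  have d0 : 0 < d by rewrite lt_min ltr01 divr_gt0.
  have d1 : d <= 1 by rewrite ge_min lexx.
  have de : d * (M + M' + 1) <= e by rewrite -ler_pdivlMr // ge_min lexx orbT.
  exists (Vnbhd T d a, Vnbhd T d b).
    by split=> /=; apply/Vbar_nbhs; exists T, d; split.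
  move=> [a' b'] /= [aa' bb']; apply: SA.
  apply: (@near_on_mono _ T _ e) => //; first by move=> v; left.
  move=> y; have [h1 h2] := aa' y; have [k1 k2] := bb' y.
  have -> : val (a' * b') y - val (a * b) y =
      (val a' y - val a y) * (val b' y - val b y) + (val a' y - val a y) * val b y +
      val a y * (val b' y - val b y) by exact: mul_difference.
  split=> Ty.
    apply: le_lt_trans (avD _ _ _) _.
    apply: le_lt_trans (lerD (avD _ _ _) (lexx _)) _.
    rewrite !avM; apply: (mul_small_lt _ _ _ _ (h1 Ty) (k1 Ty) d1 _ _ de);
      rewrite ?av_ge0 ?hM ?hM' //.
  have na := nonarch_outside aT Ty.
  have ia : completion_av (top_av nF y) (val a y) <= 1.
    by apply: intSa => h; apply: Ty; right; left.
  have ib : completion_av (top_av nF y) (val b y) <= 1.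
    by apply: intSb => h; apply: Ty; right; right.
  have {}h2 := h2 Ty; have {}k2 := k2 Ty.
  apply: le_trans (na _ _) _; rewrite ge_max; apply/andP; split.
    apply: le_trans (na _ _) _; rewrite ge_max; apply/andP; split.
      by rewrite avM mulr_ile1 ?av_ge0.
    by rewrite avM mulr_ile1 ?av_ge0.
  by rewrite avM mulr_ile1 ?av_ge0.
Qed.

(** By invariance, a Cauchy sequence for [d] is Cauchy uniformly on the places
    above each finite set [S]. Its coordinatewise limit is therefore a uniform
    limit there, which makes the transported coordinates continuous; and at
    the nonarchimedean places it is integral wherever a late term is. *)
Lemma V_complete (d : V -> V -> R) : invariant_metric d -> complete_for d.
Proof.
move=> [_ ind inv] u cu.
have cauchy S (e : R) : finite_set S -> arch `<=` S -> 0 < e -> e <= 1 ->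
    exists N, forall m n, (N <= m)%N -> (N <= n)%N ->
      near_on S e (val (u m)) (val (u n)).
  move=> finS aS e0 e1.
  have /ind[de de0 hde] : nbhs (0 : V) (Vnbhd S e 0).
    by apply/Vbar_nbhs; exists S, e; split.
  have [N hN] := cu de de0; exists N => m n Nm Nn y.
  have : Vnbhd S e 0 (u n - u m).
    apply: hde => /=; have := hN m n Nm Nn.
    by rewrite (inv _ _ (- u m)) subrr.
  move=> /(_ y); have -> : val (u n - u m) y - val (0 : V) y = val (u n) y - val (u m) y.
    by rewrite subr0.
  by [].
have limit y : exists l : completion (top_av nF y), forall e : R, 0 < e ->
    exists N, forall n, (N <= n)%N -> completion_av (top_av nF y) (val (u n) y - l) < e.
  apply: completion_seq_complete => e e0.
  pose S := [set res K0 y] `|` arch.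
  have [||||N hN] := cauchy S (Num.min e 1).
  - by rewrite finite_setU.
  - exact: subsetUr.
  - by rewrite lt_min e0 ltr01.
  - by rewrite ge_min lexx orbT.
  exists N => m n Nm Nn; have [h _] := hN n m Nn Nm y.
  by apply: lt_le_trans (h _) _; [left|rewrite ge_min lexx].
pose l : dprod (top_completion nF) := fun y => projT1 (cid (limit y)).
have hl y e : 0 < e -> exists N, forall n, (N <= n)%N ->
    completion_av (top_av nF y) (val (u n) y - l y) < e.
  by rewrite /l; case: cid => x /= h /h.
have unif S (e : R) : finite_set S -> arch `<=` S -> 0 < e -> e <= 1 ->
    exists N, forall n, (N <= n)%N -> forall y,
      (S (res K0 y) -> completion_av (top_av nF y) (val (u n) y - l y) <= e) /\
      (~ S (res K0 y) -> completion_av (top_av nF y) (val (u n) y - l y) <= 1).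
  move=> finS aS e0 e1; have [N hN] := cauchy S e finS aS e0 e1.
  exists N => n Nn y.
  have step c : (forall m, (N <= m)%N -> completion_av (top_av nF y) (val (u n) y - val (u m) y) <= c) ->
      completion_av (top_av nF y) (val (u n) y - l y) <= c.
    move=> hc; apply/ler_addgt0Pr => e' e'0; have [N' hN'] := hl y e' e'0.
    pose m := maxn N N'.
    apply: le_trans (av_triangle _ _ (val (u m) y) _) _.
    exact: lerD (hc m (leq_maxl _ _)) (ltW (hN' m (leq_maxr _ _))).
  split=> Sy; apply: step => m Nm; have [h1 h2] := hN m n Nm Nn y.
    exact/ltW/h1.
  exact: h2.
have lV : l \in Vbar lam r.
  apply/mem_set/VbarP; split.
    have [N hN] := unif arch 1 finite_arch0 (@subset_refl _ _) ltr01 (lexx _).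
    have [S [finS aS uS]] := V_integral (u N); exists S => // y Sy.
    have [_ h] := hN N (leqnn _) y.
    have ay : ~ arch (res K0 y) by move=> /aS.
    rewrite -[l y](subKr (val (u N) y)).
    apply: le_trans (nonarch_outside aS Sy _ _) _.
    by rewrite ge_max avN uS // h.
  move=> v x e e0.
  pose e' := Num.min 1 (e / 3).
  have e'0 : 0 < e' by rewrite lt_min ltr01 divr_gt0.
  have e'1 : e' <= 1 by rewrite ge_min lexx.
  pose S := [set v] `|` arch.
  have [||N hN] := unif S e' _ _ e'0 e'1; first by rewrite finite_setU.
    exact: subsetUr.
  have e30 : 0 < e / 3 by rewrite divr_gt0.
  have [L hL] := V_transport (u N) x e30; exists L => y yx.
  have bound (z : places_over v) : completion_av _ (rho z (val (u N) (val z)) - rho z (l (val z))) <= e / 3.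
    rewrite -rhoB rho_av; have [h _] := hN N (leqnn _) (val z).
    apply: le_trans (h _) _; last by rewrite ge_min lexx orbT.
    by left; rewrite res_over.
  apply: (three_thirds_lt (bound y) (hL y yx) (bound x)).
  set p := rho y (l _); set q := rho x (l _).
  set s := rho y _; set t := rho x _.
  have -> : p - q = - (s - p) + ((s - t) + (t - q)) by ring.
  apply: le_trans (avD _ _ _) _; rewrite avN -[leRHS]addrA lerD2l; exact: avD.
exists (exist _ l lV : V).
move=> A /Vbar_nbhs[S [e [finS aS e0 e1 SA]]].
have e20 : 0 < e / 2 by rewrite divr_gt0.
have e2e : e / 2 < e by rewrite ltr_pdivrMr // mulr_natr mulr2n ltrDl.
have [N hN] := unif S (e / 2) finS aS e20 (ltW (lt_le_trans e2e e1)).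
exists N => // n Nn; apply: SA => y; have [h1 h2] := hN n Nn y.
by split=> // Sy; apply: le_lt_trans (h1 Sy) _.
Qed.

(** * Metrizability *)

Section Gauge.
Variable idx : fin_place R K0 -> nat.
Hypothesis idx_inj : injective idx.

(** A bounded gauge at [y]; at nonarchimedean places it shrinks with the index of
    the place, so that small distances constrain only finitely many places. *)
Let gauge y (t : R) : R :=
  if 1 < t then 1 else
  if `[< arch (res K0 y) >] then t else Num.min t (idx (res K0 y)).+1%:R^-1.

Let inv_idx_gt0 y : 0 < (idx (res K0 y)).+1%:R^-1 :> R.
Proof. by rewrite invr_gt0. Qed.

Let gauge_ge0 y t : 0 <= t -> 0 <= gauge y t.
Proof.
move=> t0; rewrite /gauge; case: ifP => // _; case: ifP => // _.
by rewrite le_min t0 ltW.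
Qed.

Let gauge_le1 y t : gauge y t <= 1.
Proof.
rewrite /gauge; case: ltrP => // t1; case: ifP => // _.
by rewrite ge_min t1.
Qed.

Let gauge_mono y s t : s <= t -> gauge y s <= gauge y t.
Proof.
move=> st; have [t1|t1] := ltrP 1 t; first by rewrite [X in _ <= X]/gauge t1 gauge_le1.
have s1 : s <= 1 := le_trans st t1.
rewrite /gauge !ltNge s1 t1 /=; case: ifP => // _.
by rewrite le_min !ge_min lexx st orbT.
Qed.

Let gauge_eq0 y t : 0 <= t -> gauge y t <= 0 -> t = 0.
Proof.
move=> t0; rewrite /gauge; case: ltrP => [_|_]; first by rewrite leNgt ltr01.
case: ifP => _; first by move=> h; apply/le_anti; rewrite h.
rewrite ge_min leNgt => /orP[h|]; first by apply/le_anti; rewrite t0 leNgt h.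
by rewrite leNgt inv_idx_gt0.
Qed.

Let gaugeD y (s t : completion (top_av nF y)) :
  gauge y (completion_av _ (s + t)) <= gauge y (completion_av _ s) + gauge y (completion_av _ t).
Proof.
have s0 := av_ge0 (completion_av _) s; have t0 := av_ge0 (completion_av _) t.
have gs := gauge_ge0 y s0; have gt := gauge_ge0 y t0.
have [ay|ay] := pselect (arch (res K0 y)).
  apply: le_trans (gauge_mono _ (avD _ _ _)) _.
  by rewrite /gauge (asboolT ay); exact: truncate_subadd.
have na := nonarch_outside (@subset_refl _ _) ay.
apply: le_trans (gauge_mono _ (na s t)) _.
move: gs gt; move: (completion_av _ s) (completion_av _ t) => p q gp gq.
by case: (leP p q) => _; rewrite ?lerDl ?lerDr.
Qed.

Let diff (a b : V) y := completion_av (top_av nF y) (val a y - val b y).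
Let dset (a b : V) : set R := [set t | t = 0 \/ exists y, t = gauge y (diff a b y)].
Definition gauge_dist (a b : V) : R := sup (dset a b).

Let diffC (a b : V) y : diff a b y = diff b a y.
Proof. exact: av_distC. Qed.

Let gauge_dist_leP (a b : V) e : 0 <= e ->
  gauge_dist a b <= e <-> forall y, gauge y (diff a b y) <= e.
Proof.
move=> e0; split=> [h y|h].
  apply: le_trans h; apply: ub_le_sup; last by right; exists y.
  by exists 1 => _ [->|[z ->]]; [exact: ler01|exact: gauge_le1].
apply: sup_le_ub; first by exists 0; left.
by move=> _ [->|[z ->]].
Qed.

Let gauge_le_dist (a b : V) y : gauge y (diff a b y) <= gauge_dist a b.
Proof.
apply: ub_le_sup; last by right; exists y.
by exists 1 => _ [->|[z ->]]; [exact: ler01|exact: gauge_le1].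
Qed.

Let gauge_dist_ge0 (a b : V) : 0 <= gauge_dist a b.
Proof.
apply: ub_le_sup; last by left.
by exists 1 => _ [->|[z ->]]; [exact: ler01|exact: gauge_le1].
Qed.

Lemma gauge_dist_metric : is_metric gauge_dist.
Proof.
split.
- move=> a b; split=> [ab|->].
    apply/val_inj/functional_extensionality_dep => y.
    have := gauge_le_dist a b y; rewrite ab => /(gauge_eq0 (av_ge0 _ _))/av_eq0/eqP.
    by rewrite subr_eq0 => /eqP.
  apply/le_anti; rewrite gauge_dist_ge0 andbT; apply/(gauge_dist_leP _ _ (lexx _)) => y.
  by rewrite /diff subrr av0 /gauge [1 < _]ltNge ler01 /=; case: ifP => // _; rewrite ge_min lexx.
- move=> a b; congr (sup _); apply/seteqP.
  by split=> t [->|[y ->]]; [left|right; exists y; rewrite diffC|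
    left|right; exists y; rewrite diffC].
- move=> a b c; apply/gauge_dist_leP; first exact: addr_ge0.
  move=> y; apply: le_trans (lerD (gauge_le_dist a b y) (gauge_le_dist b c y)).
  apply: le_trans (gaugeD _ _); apply: gauge_mono; rewrite le_eqVlt; apply/orP; left.
  by rewrite addrA subrK.
Qed.

(** Distances less than [e] constrain only the archimedean places and those whose
    index is at most about [1 / e]; elsewhere they merely force the difference to be
    integral, the jump of the gauge to [1] beyond [t = 1]. *)
Lemma gauge_dist_topology : induces_topology gauge_dist.
Proof.
move=> a A; split=> [/Vbar_nbhs[S [e [finS aS e0 e1 SA]]]|[e e0 eA]].
  have [] := @finite_pos R _ S (fun v e => e <= (idx v).+1%:R^-1) finS.
  - by move=> v t t' t'0 t't; exact: le_trans.
  - by move=> v _; exists (idx v).+1%:R^-1; rewrite ?invr_gt0.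
  move=> e' e'0 he'; exists (Num.min e e'); first by rewrite lt_min e0.
  move=> b /= dab; apply: SA => y.
  have gy := le_lt_trans (gauge_le_dist a b y) dab.
  rewrite -[completion_av _ _]/(diff b a y) diffC.
  have d1 : diff a b y <= 1.
    rewrite leNgt; apply/negP => h; move: gy.
    by rewrite /gauge h lt_min => /andP[h1 _]; rewrite ltNge e1 in h1.
  split=> // Sy; move: gy; rewrite /gauge [1 < _]ltNge d1 /=.
  case: ifP => _; first by rewrite lt_min => /andP[].
  rewrite gt_min => /orP[]; rewrite lt_min => /andP[] // _.
  by rewrite ltNge he'.
have e20 : 0 < e / 2 by rewrite divr_gt0.
pose S := [set v | ~ ((idx v).+1%:R^-1 < e / 2)] `|` arch.
have finS : finite_set S.
  rewrite finite_setU; split=> //.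
  have := @finite_preimage _ _ `I_(Num.truncn (e / 2)^-1).+1 idx
    (fun v w _ _ => @idx_inj v w) (finite_II _).
  apply: sub_finite_set => v /negP; rewrite -leNgt /= => h.
  have i0 : 0 < (idx v).+1%:R :> R by [].
  have {}h : (idx v).+1%:R <= (e / 2)^-1 by rewrite -lef_pV2 ?posrE ?invr_gt0 // invrK.
  by rewrite -(ltr_nat R) (le_lt_trans _ (truncnS_gt _)) // (le_trans _ h) // ler_nat.
have e1 : 0 < Num.min (e / 2) 1 by rewrite lt_min e20 ltr01.
apply/Vbar_nbhs; exists S, (Num.min (e / 2) 1); split=> //.
- exact: subsetUr.
- by rewrite ge_min lexx orbT.
move=> b ab; apply: eA => /=.
apply: (@le_lt_trans _ _ (e / 2)); last by rewrite ltr_pdivrMr // mulr_natr mulr2n ltrDl.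
apply/gauge_dist_leP; first exact: ltW.
move=> y; have [h1 h2] := ab y; rewrite diffC.
have [Sy|Sy] := pselect (S (res K0 y)).
  have := h1 Sy; rewrite lt_min => /andP[d1 d2].
  rewrite /gauge [1 < _]ltNge (ltW d2) /=; case: ifP => _; first exact: ltW.
  by rewrite ge_min (ltW d1).
rewrite /gauge [1 < _]ltNge (h2 Sy) /= asboolF; last by move=> h; apply: Sy; right.
rewrite ge_min; apply/orP; right; apply: ltW.
by apply: contrapT => h; apply: Sy; left.
Qed.
End Gauge.

Lemma V_metrizable : metrizable R V.
Proof.
have [cK _] := few_fin_places K0; have /countable_injP[idx idxi] := cK.
have inj : injective idx by move=> v w; apply: idxi; exact: mem_set.
exists (gauge_dist idx); [exact: gauge_dist_metric|exact: gauge_dist_topology].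
Qed.

(** * The embedding of the adeles of a finite level *)

Section AdeleTopology.
Variable K : finite_galois F.
Implicit Types (c d : dprod (@fin_completion R E F nF K)).

Let archK := [set v : fin_place R K | ~ nonarchimedean (fin_av nF v)].

Definition adele_near (T : set (fin_place R K)) (e : R) c d := forall v,
  (T v -> completion_av (fin_av nF v) (d v - c v) < e) /\
  (~ T v -> completion_av (fin_av nF v) (d v - c v) <= 1).

Lemma adele_near_mono (S T : set (fin_place R K)) (e e' : R) c d :
  S `<=` T -> e' <= e -> e' <= 1 -> adele_near T e' c d -> adele_near S e c d.
Proof.
move=> ST e'e e'1 H v; have [HT HnT] := H v; split=> [/ST/HT h|nS].
  exact: lt_le_trans e'e.
have [/HT h|/HnT //] := pselect (T v).
exact: ltW (lt_le_trans h e'1).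
Qed.

Lemma adele_integral (al : adele_ring nF K) : exists T, [/\ finite_set T, archK `<=` T &
  forall v, ~ T v -> completion_av (fin_av nF v) (val al v) <= 1].
Proof.
exists (archK `|` [set v | nonarchimedean (fin_av nF v) /\ ~ fin_O (val al v)]).
split; first by rewrite finite_setU; split; [exact: finite_arch|exact: set_mem (valP al)].
  exact: subsetUl.
move=> v Tv; apply: contrapT => h; apply: Tv.
by have [na|] := pselect (nonarchimedean (fin_av nF v)); [right|left].
Qed.

Let nonarchK T v : archK `<=` T -> ~ T v -> nonarchimedean (completion_av (fin_av nF v)).
Proof.
by move=> aT Tv; apply/completion_nonarchP; apply: contrapT => h; apply/Tv/aT.
Qed.

(** The counterpart of [Vbar_nbhs] at a finite level. *)
Lemma adele_nbhs (al : adele_ring nF K) (A : set (adele_ring nF K)) :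
  nbhs al A <-> exists T e, [/\ finite_set T, archK `<=` T, 0 < e, e <= 1 &
    [set be : adele_ring nF K | adele_near T e (val al) (val be)] `<=` A].
Proof.
pose N (al : adele_ring nF K) : set (set (adele_ring nF K)) := [set W | exists T e,
  [/\ finite_set T, archK `<=` T, 0 < e, e <= 1 &
   W = [set be : adele_ring nF K | adele_near T e (val al) (val be)]]].
have : nbhs al A <-> exists2 W, N al W & W `<=` A.
  apply: (@subbase_nbhs (adele_ring nF K) (@adele_basis R E F nF K) N).
  - move=> B be [U [Uop finU ->]] beU.
    pose T := archK `|` [set v | nonarchimedean (fin_av nF v) /\ U v <> fin_O (v:=v)].
    have finT : finite_set T by rewrite finite_setU; split=> //; exact: finite_arch.
    have [] := @finite_pos R _ T (fun v e => forall u : completion (fin_av nF v),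
      completion_av _ (u - val be v) < e -> U v u) finT.
    + by move=> v e e' e'0 e'e H u hu; apply: H; exact: lt_le_trans e'e.
    + move=> v _; have := Uop v; rewrite openE => /(_ _ (beU v))/completion_nbhsP[e e0 eU].
      by exists e => // u hu; apply: eU; rewrite av_distC.
    move=> e e0 He.
    exists [set ga : adele_ring nF K | adele_near T (Num.min e 1) (val be) (val ga)].
      exists T, (Num.min e 1); split=> //; first exact: subsetUl.
        by rewrite lt_min e0 ltr01.
      by rewrite ge_min lexx orbT.
    move=> ga near v; have [h1 h2] := near v.
    have [Tv|Tv] := pselect (T v).
      by apply: (He _ Tv); apply: lt_le_trans (h1 Tv) _; rewrite ge_min lexx.
    have na := nonarchK (@subsetUl _ _ _) Tv.
    have UO : U v = fin_O (v:=v).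
      by apply: contrapT => h; apply: Tv; right; split=> //; exact/completion_nonarchP.
    have := beU v; rewrite UO /fin_O /= => bev.
    rewrite -[val ga v](subrK (val be v)); apply: le_trans (na _ _) _.
    by rewrite ge_max h2.
  - move=> be; exists [set ga : adele_ring nF K | adele_near archK 1 (val be) (val ga)].
    by exists archK, 1; split=> //; exact: finite_arch.
  - move=> be _ _ [S [e [finS aS e0 e1 ->]]] [T [d [finT aT d0 d1 ->]]].
    have ed1 : Num.min e d <= 1 by rewrite ge_min e1.
    exists [set ga : adele_ring nF K | adele_near (S `|` T) (Num.min e d) (val be) (val ga)].
      exists (S `|` T), (Num.min e d); split=> //.
      + by rewrite finite_setU.
      + by move=> v /aS; left.
      + by rewrite lt_min e0.
    move=> ga near; split; apply: (adele_near_mono _ _ ed1 near).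
    + exact: subsetUl.
    + by rewrite ge_min lexx.
    + exact: subsetUr.
    + by rewrite ge_min lexx orbT.
  - move=> be _ [S [e [finS aS e0 e1 ->]]].
    have [T0 [finT0 archT bT]] := adele_integral be.
    pose T := S `|` T0.
    have finT : finite_set T by rewrite finite_setU.
    pose U v : set (completion (fin_av nF v)) := [set u |
      (T v -> completion_av _ (u - val be v) < e) /\
      (~ T v -> completion_av _ u <= 1)].
    exists [set ga : adele_ring nF K | forall v, U v (val ga v)].
      exists U; split=> //.
        move=> v; rewrite openE => u [Uu1 Uu2]; apply/completion_nbhsP.
        have [Tv|Tv] := pselect (T v).
          exists (e - completion_av _ (u - val be v)); first by rewrite subr_gt0 Uu1.
          move=> u' uu'; split=> // _; apply: le_lt_trans (av_triangle _ _ u _) _.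
          by rewrite av_distC -ltrBrDr.
        have na : nonarchimedean (completion_av (fin_av nF v)).
          by apply: (@nonarchK T) => // w aw; right; exact: archT.
        exists 1 => // u' uu'; split=> // _.
        rewrite -[u'](subrK u); apply: le_trans (na _ _) _.
        rewrite ge_max; apply/andP; split; first by rewrite av_distC ltW.
        exact: Uu2.
      apply: sub_finite_set finT => v [na UO]; apply: contrapT => Tv; apply: UO.
      by apply/seteqP; split=> u; [move=> [_]; exact|move=> uO; split].
    split=> [v|ga gaU v]; split=> hv.
    + by rewrite subrr av0.
    + by apply: bT => h; apply: hv; right.
    + by have [h _] := gaU v; apply: h; left.
    have [h1 h2] := gaU v.
    have [Tv|Tv] := pselect (T v); first exact: ltW (lt_le_trans (h1 Tv) e1).
    have na : nonarchimedean (completion_av (fin_av nF v)).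
      by apply: (@nonarchK T) => // w aw; right; exact: archT.
    apply: le_trans (na _ _) _; rewrite avN ge_max h2 //=.
    by apply: bT => h; apply: Tv; right.
move=> ->; split=> [[_ [S [e [? ? ? ? ->]]] WA]|[S [e [? ? ? ? SA]]]].
  by exists S, e.
by exists [set be : adele_ring nF K | adele_near S e (val al) (val be)] => //; exists S, e.
Qed.
End AdeleTopology.

(** The automorphisms agreeing on [L] with a given one form an open set of the
    Krull topology on [Gal(E / K0)]; this uses that [L] is Galois over [K0]. *)
Lemma lam_locally_constant (L : finite_galois F) (v : fin_place R K0) (x : places_over v) :
  K0 `<=` L -> exists M, forall y : places_over v, res M (val y) = res M (val x) ->
    forall c, (L : set E) c -> lam v y (r v) c = lam v x (r v) c.
Proof.
move=> KL; set s := lam v x (r v).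
have ns : nbhs s [set t : gal K0 | forall c, (L : set E) c -> t c = s c].
  exists [set t : gal K0 | forall c, (L : set E) c -> t c = s c]; split=> //.
  exists [set [set t : gal K0 | forall c, (L : set E) c -> t c = s c]]; last by rewrite bigcup_set1.
  move=> _ ->; exists (finmap.fset1 [set t : gal K0 | forall c, (L : set E) c -> t c = s c]).
    move=> C; rewrite finmap.in_fset1 => /eqP ->; apply/mem_set.
    by exists (fg_over KL), s.
  by rewrite set_fset1 bigcap_set1.
have [[A1 A2] [/= nA1 nA2] AW] := @td_continuous _ _ _ _ _ _ (lam v) (x, r v) _ ns.
have [M hM] := (nbhs_subtype _ _).1 nA1; exists M => y yx c Lc.
by apply: (AW (y, r v)) => //; split=> /=; [exact: hM|exact: nbhs_singleton nA2].
Qed.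

Section Embedding.
Variable K : finite_galois F.
Local Notation iK := (val : {rmorphism subfield_type K -> E}).

Definition place_embedding y : completion (fin_av nF (res K y)) -> completion (top_av nF y) :=
  completion_map iK (fin_av nF (res K y)) (top_av nF y).

Let compat y (c : subfield_type K) : top_av nF y (iK c) = fin_av nF (res K y) c.
Proof. exact: top_av_res. Qed.

Lemma place_embeddingB y : {morph @place_embedding y : s t / s - t}.
Proof. exact/completion_mapB/compat. Qed.
Lemma place_embeddingM y : {morph @place_embedding y : s t / s * t}.
Proof. exact/completion_mapM/compat. Qed.
Lemma place_embedding1 y : place_embedding (1 : completion (fin_av nF (res K y))) = 1.
Proof. exact/completion_map1/compat. Qed.
Lemma place_embedding_av y s : completion_av _ (@place_embedding y s) = completion_av _ s.
Proof. exact/completion_map_av/compat. Qed.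

Definition diagonal (c : dprod (@fin_completion R E F nF K)) : dprod (top_completion nF) :=
  fun y => place_embedding (c (res K y)).


Lemma place_embedding_inj y : injective (@place_embedding y).
Proof. exact/completion_map_injective/compat. Qed.

Lemma diagonal_dist c d y :
  completion_av (top_av nF y) (diagonal d y - diagonal c y) =
  completion_av (fin_av nF (res K y)) (d (res K y) - c (res K y)).
Proof.
rewrite -(place_embedding_av (y := y)); congr (completion_av _ _).
by rewrite place_embeddingB.
Qed.

(** After transport, the coordinate of a diagonal element depends on [y] only
    through the place of [K] below [y] and the embedding [h] of [K] into [E]. *)
Lemma rho_diagonal c (v : fin_place R K0) (y : places_over v)
    (h : {rmorphism subfield_type K -> E}) :
  (forall t, h t = lam v y (r v) (iK t)) ->
  rho y (diagonal c (val y)) =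
  completion_map h (fin_av nF (res K (val y))) (top_av nF (val (r v))) (c (res K (val y))).
Proof.
move=> hE; apply/esym.
apply: (@completion_map_comp _ _ _ _ iK (lam v y (r v)) h
  (fin_av nF (res K (val y))) (top_av nF (val y)) (top_av nF (val (r v)))).
- exact: compat.
- exact: to_ref_compat.
- exact: hE.
Qed.

(** The transported coordinates of a diagonal element are locally constant: both
    the place of [K] below [y] and the restriction of [lam] to [K] are. *)
Lemma diagonal_Vbar (al : adele_ring nF K) : diagonal (val al) \in Vbar lam r.
Proof.
apply/mem_set/VbarP; split.
  have [T [finT aT hT]] := adele_integral al.
  exists [set v | exists2 y : Y, T (res K y) & res K0 y = v].
    exact: finite_res_rel.
  move=> y ny; rewrite place_embedding_av; apply: hT => Ty; apply: ny.
  by exists y.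
move=> v x e e0; have [L [KL K'L]] := fg_compositum E_galois K0 K.
have [M1 hM1] := lam_locally_constant x KL.
have [M [LM M1M]] := fg_compositum E_galois L M1; exists M => y yx.
have yK : res K (val y) = res K (val x) := res_coarser (subset_trans K'L LM) yx.
pose h : {rmorphism subfield_type K -> E} :=
  (gal_fun (lam v x (r v)) : {rmorphism E -> E}) \o iK.
rewrite (@rho_diagonal _ v y h) ?(@rho_diagonal _ v x h) //.
  by rewrite yK subrr av0.
move=> t; rewrite hM1 //; first exact: res_coarser M1M yx.
exact/K'L/sf_val.
Qed.

Definition embed (al : adele_ring nF K) : V := exist _ (diagonal (val al)) (diagonal_Vbar al).

Lemma embed_zmod : zmod_morphism embed.
Proof.
move=> al be; apply/val_inj/functional_extensionality_dep => y.
exact: place_embeddingB.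
Qed.

Lemma embed_monoid : monoid_morphism embed.
Proof.
split=> [|al be]; apply/val_inj/functional_extensionality_dep => y.
  exact: place_embedding1.
exact: place_embeddingM.
Qed.

(** Every place of [K] has some place of [E] above it, where the coordinate of the
    adele can be recovered. *)
Lemma embed_inj : injective embed.
Proof.
move=> al be /(congr1 val) ab; apply/val_inj/functional_extensionality_dep => v.
have [y <-] := place_above v; apply: (@place_embedding_inj y).
exact: (congr1 (fun f => f y) ab).
Qed.

Definition image_ring : set V := range embed.

Lemma image_ring_subring : subring_closed (mem image_ring).
Proof.
split.
- by apply/mem_set; exists 1 => //; exact: embed_monoid.1.
- move=> _ _ /set_mem[al _ <-] /set_mem[be _ <-]; apply/mem_set.
  by exists (al - be) => //; exact: embed_zmod.
- move=> _ _ /set_mem[al _ <-] /set_mem[be _ <-]; apply/mem_set.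
  by exists (al * be) => //; exact: embed_monoid.2.
Qed.

Definition embed_image (al : adele_ring nF K) : image_ring :=
  exist _ (embed al) (mem_set (ex_intro2 _ _ al I erefl)).

Definition embed_inv (x : image_ring) : adele_ring nF K :=
  projT1 (cid2 (set_mem (valP x))).

Lemma embed_invK : cancel embed_inv embed_image.
Proof.
by move=> x; apply: val_inj; rewrite /embed_inv; case: cid2 => al /=.
Qed.

Lemma embed_imageK : cancel embed_image embed_inv.
Proof.
move=> al; apply: embed_inj.
exact: (congr1 val (embed_invK (embed_image al))).
Qed.

(** Distances are preserved coordinatewise, so it suffices to take for [T] the
    places of [K] that share a place of [E] above them with a place in [S]. *)
Lemma embed_image_continuous : continuous embed_image.
Proof.
move=> al U /set_type_nbhs[B /Vbar_nbhs[S [e [finS aS e0 e1 SB]]] BU].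
pose T := [set v | exists2 y : Y, S (res K0 y) & res K y = v] `|`
  [set v : fin_place R K | ~ nonarchimedean (fin_av nF v)].
apply/adele_nbhs; exists T, e; split=> //.
- by rewrite finite_setU; split; [exact: finite_res_rel|exact: finite_arch].
- exact: subsetUr.
move=> be near; apply: BU; apply: SB => y; have [h1 h2] := near (res K y).
have E1 := diagonal_dist (val al) (val be) y.
split=> Sy.
  by apply: le_lt_trans (h1 _); [rewrite -E1|left; exists y].
have [Ty|Ty] := pselect (T (res K y)); last by apply: le_trans (h2 Ty); rewrite -E1.
by apply: le_trans (ltW (lt_le_trans (h1 Ty) e1)); rewrite -E1.
Qed.

Lemma embed_inv_continuous : continuous embed_inv.
Proof.
move=> x A /adele_nbhs[T [e [finT aT e0 e1 TA]]].
pose S := [set v | exists2 y : Y, T (res K y) & res K0 y = v] `|` arch.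
apply/set_type_nbhs; exists (Vnbhd S e (val x)).
  apply/Vbar_nbhs; exists S, e; split=> //.
    by rewrite finite_setU; split; [exact: finite_res_rel|].
  exact: subsetUr.
move=> z; have zE := congr1 val (embed_invK z); have xE := congr1 val (embed_invK x).
rewrite -zE -xE => near; apply: TA => v.
have [y yv] := place_above v; subst v; have [h1 h2] := near y.
have E1 := diagonal_dist (val (embed_inv x)) (val (embed_inv z)) y.
split=> Tv.
  by apply: le_lt_trans (h1 _); [rewrite -E1|left; exists y].
have [Sy|Sy] := pselect (S (res K0 y)); last by apply: le_trans (h2 Sy); rewrite -E1.
by apply: le_trans (ltW (lt_le_trans (h1 Sy) e1)); rewrite -E1.
Qed.

Lemma embed_subring_iso : topological_subring_iso embed_image embed_inv.
Proof.
split.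
- exact: image_ring_subring.
- exact: embed_zmod.
- exact: embed_monoid.
- by split; [exact: embed_imageK|exact: embed_invK].
- by split; [exact: embed_image_continuous|exact: embed_inv_continuous].
Qed.
End Embedding.

(** * Conorms and density *)

Section Conorm.
Variables (K L : finite_galois F) (KL : K `<=` L).

Let compatKL (w : fin_place R L) (v : fin_place R K) :
  lies_over (incl_subfield KL) w v ->
  forall c, fin_av nF w (incl_subfield KL c) = fin_av nF v c.
Proof. by move=> wv c; exact: fin_av_rel. Qed.

Lemma con_prodE (c : dprod (@fin_completion R E F nF K)) (w : fin_place R L)
    (v : fin_place R K) : lies_over (incl_subfield KL) w v ->
  con_prod KL c w = completion_map (incl_subfield KL) (fin_av nF v) (fin_av nF w) (c v).
Proof.
move=> wv; rewrite /con_prod; case: pselect => [h|nh]; last by case: nh; exists v.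
by case: (cid h) => u wu /=; have -> := lies_over_uniq wu wv.
Qed.

Lemma con_prod_adele (al : adele_ring nF K) : con_prod KL (val al) \in @adeles R E F nF L.
Proof.
apply/mem_set; have [T [finT _ hT]] := adele_integral al.
apply: (@sub_finite_set _ _ (\bigcup_(v in T) [set w : fin_place R L | lies_over (incl_subfield KL) w v])).
  move=> w [na nO]; have [v wv] := place_below w (alg_rel KL).
  exists v => //; apply: contrapT => Tv; apply: nO; rewrite /fin_O /=.
  have := hT v Tv; rewrite -(completion_map_av (compatKL wv)).
  by rewrite (con_prodE _ wv).
apply: bigcup_finite => // v _; apply: finite_places_above.
exact: (fg_relative KL).1.
Qed.

Lemma embed_con (al : adele_ring nF K) : embed (con KL al) = embed al.
Proof.
have conE : val (con KL al) = con_prod KL (val al).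
  by rewrite /con insubdK //; exact: con_prod_adele.
apply/val_inj/functional_extensionality_dep => y.
have -> : val (embed (con KL al)) y = place_embedding (con_prod KL (val al) (res L y)).
  by rewrite -conE.
rewrite (con_prodE _ (res_rel KL y)); apply/esym.
apply: (@completion_map_comp _ _ _ _ (incl_subfield KL)
  (val : {rmorphism subfield_type L -> E}) (val : {rmorphism subfield_type K -> E})
  (fin_av nF (res K y)) (fin_av nF (res L y)) (top_av nF y)).
- exact/compatKL/res_rel.
- by move=> c; exact: top_av_res.
- exact: val_incl.
Qed.

Lemma conorm_square : exists VKL : image_ring K `<=` image_ring L,
  (forall al : adele_ring nF K, embed_image (con KL al) = set_incl VKL (embed_image al)) /\
  (forall x : image_ring K, con KL (embed_inv x) = embed_inv (set_incl VKL x)).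
Proof.
have VKL : image_ring K `<=` image_ring L.
  by move=> _ [al _ <-]; exists (con KL al) => //; exact: embed_con.
have sq (al : adele_ring nF K) : embed_image (con KL al) = set_incl VKL (embed_image al).
  by apply: val_inj; exact: embed_con.
exists VKL; split=> // x.
by rewrite -{2}(embed_invK x) -sq embed_imageK.
Qed.
End Conorm.

(** As [L] is normal over [F], it contains the conjugates of its elements. *)
Lemma gal_stable (L : finite_galois F) (s : gal K0) t : (L : set E) t -> (L : set E) (s t).
Proof.
move=> Lt; have [alg _ nor] := fg_galois L.
have [p px] := minimal_poly_exists (alg (sf_in Lt)); have [zs pzs] := nor _ _ px.
have pE : map_poly (val : {rmorphism subfield_type F -> E}) p = \prod_(z <- zs) ('X - (val z)%:P).
  have -> : map_poly (val : {rmorphism subfield_type F -> E}) p =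
      map_poly (val : {rmorphism subfield_type L -> E}) (map_poly (incl_subfield (fg_sub L)) p).
    by rewrite -map_poly_comp; apply: eq_map_poly.
  rewrite pzs rmorph_prod; apply: eq_bigr => z _; exact: map_polyXsubC.
have root_t : root (map_poly (val : {rmorphism subfield_type F -> E}) p) t.
  have [_ rp _] := px; rewrite -(root_map_comp _ _ (val_incl (fg_sub L))) in rp.
  exact: rp.
have : root (map_poly (val : {rmorphism subfield_type F -> E}) p) (s t).
  rewrite -(fmorph_root s) in root_t.
  move: root_t; rewrite -map_poly_comp; congr (is_true (root _ _)).
  apply: eq_map_poly => c /=; apply: gal_fix; exact/(fg_sub K0)/sf_val.
rewrite pE -(big_map val predT (fun u : E => 'X - u%:P)) root_prod_XsubC.
by move=> /mapP[z _ ->]; exact: sf_val.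
Qed.

(** The levels [L1], [L2], [L3] ensure in turn that on the fibres over the places
    of the level the transported coordinates of [a] vary by less than [e / 2]; that
    the elements [c w] of [E] approximating them belong to the level; and that
    [lam], restricted to these elements, is constant on the fibres. Then the
    elements, transported back, lie in [L3] and depend only on the place of [L3],
    so they are the coordinates of an adele [be] of [L3], set to be zero away from
    the places above [S'], outside of which [a] is integral. *)
Lemma embed_dense (a : V) (S : set (fin_place R K0)) (e : R) :
  finite_set S -> arch `<=` S -> 0 < e -> e <= 1 ->
  exists (L : finite_galois F) (be : adele_ring nF L), Vnbhd S e a (embed be).
Proof.
move=> finS aS e0 e1; have [Sa [finSa _ intSa]] := V_integral a.
pose S' := S `|` Sa.
have finS' : finite_set S' by rewrite finite_setU.
pose Z := [set y : Y | S' (res K0 y)].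
have cZ : compact Z by exact: compact_over.
have e20 : 0 < e / 2 by rewrite divr_gt0.
have e40 : 0 < e / 2 / 2 by rewrite divr_gt0.
have same (v : fin_place R K0) (y : places_over v) L x :
    K0 `<=` L -> res L (val y) = res L x -> v = res K0 x.
  by move=> KL yx; rewrite -(res_over y); exact: res_coarser KL yx.
(* The oscillation is measured against the centre [x] of the fibre, whence the
   radius [e / 2 / 2] below. *)
pose P1 L x := forall (v : fin_place R K0) (y z : places_over v),
  res L (val y) = res L x -> res L (val z) = res L x ->
  completion_av _ (rho y (val a (val y)) - rho z (val a (val z))) < e / 2.
have [L1 [KL1 hL1]] : exists L, K0 `<=` L /\ forall x, Z x -> P1 L x.
  apply: uniform_level => //.
  - by move=> x x' L xx' H v y z hy hz; apply: H; rewrite xx'.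
  - by move=> x L M LM H v y z hy hz; apply: H; exact: res_coarser LM _.
  move=> x Zx; have [L hL] := V_transport a (over (resP K0 x)) e40.
  have [M [KM LM]] := fg_compositum E_galois K0 L; exists M => v y z yx zx.
  have vx := same v y M x KM yx; subst v.
  have hy := hL y (res_coarser LM yx); have hz := hL z (res_coarser LM zx).
  apply: le_lt_trans (av_triangle _ _ (rho (over (resP K0 x)) (val a x)) _) _.
  rewrite [ltRHS]splitr; apply: ltrD; first exact: hy.
  by rewrite av_distC; exact: hz.
have /choice[c hc] : forall w : fin_place R L1, exists t : E,
    forall (v : fin_place R K0) (y : places_over v), S' v -> res L1 (val y) = w ->
    completion_av _ (rho y (val a (val y)) - completion_inj _ t) < e.
  move=> w; have [[x [Zx xw]]|nw] := pselect (exists x, Z x /\ res L1 x = w); last first.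
    exists 0 => v y Sv yw; case: nw; exists (val y); split=> //.
    by rewrite /Z /= res_over.
  pose x' : places_over (res K0 x) := over (resP K0 x).
  have [t ht] := completion_dense (rho x' (val a x)) e20; exists t => v y Sv yw.
  have yx : res L1 (val y) = res L1 x by rewrite yw.
  have vx := same v y L1 x KL1 yx; subst v.
  apply: le_lt_trans (av_triangle _ _ (rho x' (val a x)) _) _.
  rewrite [ltRHS]splitr; apply: ltrD; last exact: ht.
  exact: (hL1 x Zx _ y x' yx erefl).
have /finite_seqP[ws wsE] := finite_res_rel L1 finS'.
have [L2 [L12 cL2]] := fg_contains_ext E_galois L1 [seq c w | w <- ws].
have cin y : Z y -> (L2 : set E) (c (res L1 y)).
  move=> Zy; apply: cL2; apply: map_f.
  by have : [set` ws] (res L1 y) by rewrite -wsE; exists y.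
have KL2 := subset_trans KL1 L12.
pose P2 L x := forall (v : fin_place R K0) (y z : places_over v),
  res L (val y) = res L x -> res L (val z) = res L x ->
  forall t, (L2 : set E) t -> lam v y (r v) t = lam v z (r v) t.
have [L3 [L23 hL3]] : exists L, L2 `<=` L /\ forall x, Z x -> P2 L x.
  apply: uniform_level => //.
  - by move=> x x' L xx' H v y z hy hz; apply: H; rewrite xx'.
  - by move=> x L M LM H v y z hy hz; apply: H; exact: res_coarser LM _.
  move=> x Zx; have [L hL] := lam_locally_constant (over (resP K0 x)) KL2.
  have [M [KM LM]] := fg_compositum E_galois K0 L; exists M => v y z yx zx t L2t.
  have vx := same v y M x KM yx; subst v.
  rewrite (hL y (res_coarser LM yx)) //.
  by rewrite (hL z (res_coarser LM zx)).
have KL3 := subset_trans KL2 L23; have L13 := subset_trans L12 L23.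
pose iL := (val : {rmorphism subfield_type L3 -> E}).
have coord (w : fin_place R L3) : exists be : completion (fin_av nF w),
    (forall (v : fin_place R K0) (y : places_over v), res L3 (val y) = w -> S' v ->
       rho y (completion_map iL (fin_av nF w) (top_av nF (val y)) be) =
       completion_inj _ (c (res L1 (val y)))) /\
    ((forall y, res L3 y = w -> ~ Z y) -> be = 0).
  have [[x [Zx xw]]|nw] := pselect (exists x, Z x /\ res L3 x = w); last first.
    exists 0; split=> // v y yw Sv; case: nw; exists (val y); split=> //.
    by rewrite /Z /= res_over.
  pose x' : places_over (res K0 x) := over (resP K0 x).
  pose t := c (res L1 x); have L2t : (L2 : set E) t := cin x Zx.
  pose s := lam (res K0 x) (r (res K0 x)) x' t.
  have L2s : (L2 : set E) s by exact: gal_stable.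
  exists (completion_inj _ (sf_in (L23 _ L2s))); split; last by move=> h; case: (h x xw).
  move=> v y yw Sv; have yx : res L3 (val y) = res L3 x by rewrite yw.
  have vx := same v y L3 x KL3 yx; subst v.
  rewrite /to_ref !completion_map_inj.
  - congr completion_inj; rewrite (res_coarser L13 yx).
    rewrite (hL3 x Zx _ y x' yx erefl) //.
    by rewrite td_comp td_id.
  - exact: to_ref_compat.
  - by move=> q; rewrite -yw; exact: top_av_res.
pose be (w : fin_place R L3) : completion (fin_av nF w) := projT1 (cid (coord w)).
have hbe w : (forall (v : fin_place R K0) (y : places_over v), res L3 (val y) = w -> S' v ->
       rho y (completion_map iL (fin_av nF w) (top_av nF (val y)) (be w)) =
       completion_inj _ (c (res L1 (val y)))) /\
    ((forall y, res L3 y = w -> ~ Z y) -> be w = 0).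
  by rewrite /be; case: cid.
have beA : (be : dprod (@fin_completion R E F nF L3)) \in @adeles R E F nF L3.
  apply/mem_set; apply: sub_finite_set (finite_res_rel L3 finS').
  move=> w [_ nO]; apply: contrapT => nw; apply: nO.
  rewrite /fin_O /= (hbe w).2 ?[completion_norm 0](completion_norm0) //.
  by move=> y yw Zy; apply: nw; exists y.
exists L3, (exist _ (be : dprod (@fin_completion R E F nF L3)) beA).
move=> y; have near : S' (res K0 y) ->
    completion_av (top_av nF y) (place_embedding (be (res L3 y)) - val a y) < e.
  move=> Sy; pose y' : places_over (res K0 y) := over (resP K0 y).
  have E1 := (hbe (res L3 y)).1 (res K0 y) y' erefl Sy.
  have E2 := hc (res L1 y) (res K0 y) y' Sy erefl.
  rewrite -E1 in E2.
  have E3 := rhoB y' (val a y) (place_embedding (be (res L3 y))).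
  have E4 := rho_av y' (val a y - place_embedding (be (res L3 y))).
  rewrite av_distC; rewrite E3 in E4.
  exact: etrans (congr1 (fun t => t < e) (esym E4)) E2.
split=> Sy; first by apply: near; left.
have [Sy'|Sy'] := pselect (S' (res K0 y)).
  exact: ltW (lt_le_trans (near Sy') e1).
have b0 : be (res L3 y) = 0.
  apply: (hbe _).2 => z zy Zz; apply: Sy'; move: Zz; rewrite /Z /=.
  by rewrite (res_coarser KL3 zy).
have E0 : place_embedding (be (res L3 y)) = 0.
  by rewrite b0 /place_embedding; apply: completion_map0 => q; exact: top_av_res.
have -> : val (embed (exist _ (be : dprod (@fin_completion R E F nF L3)) beA : adele_ring nF L3)) y - val a y
    = - val a y.
  by rewrite -[RHS]sub0r; congr (_ - _); exact: E0.
by rewrite avN; apply: intSa => h; apply: Sy'; right.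
Qed.

Lemma closure_images : closure (\bigcup_L image_ring L) = [set: V].
Proof.
apply/seteqP; split=> // a _ B /Vbar_nbhs[S [e [finS aS e0 e1 SB]]].
have [L [be hbe]] := embed_dense a finS aS e0 e1.
by exists (embed be); split; [exists L => //; exists be|exact: SB].
Qed.

End PlacesOfE.

Theorem theorem2p5 (R : realType) (E : fieldType) (F : subfield E)
    (F_global : global_field (subfield_type F))
    (E_galois : galois_ext (val : subfield_type F -> E))
    (nF : place R (subfield_type F) -> absval R (subfield_type F))
    (nF_in : forall p : place R (subfield_type F), val p (nF p))
    (K0 : finite_galois F)
    (lam : forall v : fin_place R K0, transition_diagram nF v)
    (r : forall v : fin_place R K0, places_over v) :
  exists hV : subring_closed (mem (Vbar lam r)),
  let V := Vbar_ring hV in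
  [/\ topological_ring V /\ metrizable R V,
      forall d : V -> V -> R, invariant_metric d -> complete_for d
    & exists (VK : finite_galois F -> set V)
             (phi : forall K, adele_ring nF K -> VK K)
             (psi : forall K, VK K -> adele_ring nF K),
      [/\ forall K, topological_subring_iso (phi K) (psi K),
          forall (K L : finite_galois F) (KL : K `<=` L),
            exists VKL : VK K `<=` VK L,
              (forall a, phi L (con KL a) = set_incl VKL (phi K a)) /\
              (forall x, con KL (psi K x) = psi L (set_incl VKL x))
        & closure (\bigcup_K VK K) = [set: V]]].
Proof.
exists (Vbar_subring E_galois nF_in F_global lam r); split.
- by split; [exact: V_topological|exact: V_metrizable].
- exact: V_complete.
- exists (@image_ring R E F nF E_galois nF_in F_global K0 lam r).
  exists (@embed_image R E F nF E_galois nF_in F_global K0 lam r).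
  exists (@embed_inv R E F nF E_galois nF_in F_global K0 lam r).
  split.
  + by move=> K; exact: embed_subring_iso.
  + by move=> K L KL; exact: conorm_square.
  + exact: closure_images.
Qed.
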